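(* Suppose that the initial values $(\boldsymbol u_0,\varphi_0)$ satisfy $\mathcal J_{\varepsilon,\lambda}(\boldsymbol u_0,\varphi_0)<\infty$, where $$\mathcal J_{\varepsilon,\lambda}(\boldsymbol v,\phi):=\tfrac12\|\boldsymbol v\|_{0,\Omega}^2+\tfrac{\lambda}{2}|\phi|_{1,\Omega}^2+\lambda\varepsilon^{-2}(F(\phi),1)_\Omega .$$ Then every regular solution $(\boldsymbol u,\varphi)$ (with associated pressure $\widehat p$) of the system $$\begin{cases}\partial_t\boldsymbol u-\nu\boldsymbol\Delta\boldsymbol u+(\boldsymbol\nabla\boldsymbol u)\boldsymbol u+\nabla\widehat p+\lambda\nabla\varphi\,\Delta\varphi=\boldsymbol g & \text{in }\Omega\times(0,T],\\ \operatorname{div}\boldsymbol u=0&\text{in }\Omega\times(0,T],\\ \partial_t\varphi+\boldsymbol u\cdot\nabla\varphi+\gamma\Delta(\Delta\varphi-\varepsilon^{-2}f(\varphi))=0&\text{in }\Omega\times(0,T],\end{cases}$$ with boundary conditions $\boldsymbol u=\boldsymbol 0$, $\partial_{\boldsymbol n}\varphi=\partial_{\boldsymbol n}\Delta\varphi=0$ on $\Gamma\times(0,T]$ and initial conditions $\boldsymbol u(\cdot,0)=\boldsymbol u_0$, $\varphi(\cdot,0)=\varphi_0$ in $\Omega$, satisfies $$(\varphi(\cdot,t),1)_\Omega=(\varphi_0,1)_\Omega\quad\text{for a.e. }t\in(0,T),$$ $$\operatorname*{ess\,sup}_{0\le t\le T}\mathcal J_{\varepsilon,\lambda}(\boldsymbol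 u(\cdot,t),\varphi(\cdot,t))\le C_{\rm stab},$$ $$\int_0^T\nu|\boldsymbol u|_{1,\Omega}^2\,dt+\int_0^T\lambda\gamma^{-1}\|\partial_t\varphi+\boldsymbol u\cdot\nabla\varphi\|_{-1,\Omega}^2\,dt\le C_{\rm stab},$$ where $C_{\rm stab}$ is a positive constant depending on the data and the physical parameters.
   Context: $\Omega\subset\mathbb R^2$ is a polygonal domain with boundary $\Gamma$ and outward unit normal $\boldsymbol n$; $T>0$ is the final time; $\nu,\lambda,\gamma,\varepsilon>0$ are constants (the physical parameters); $\boldsymbol g\in L^2(0,T;\boldsymbol L^2(\Omega))$ is the load; $F(s)=\frac14(s^2-1)^2$ and $f=F'$, i.e. $f(s)=s^3-s$. The data are $\boldsymbol g,\boldsymbol u_0,\varphi_0$ (together with $\Omega$ and $T$). $(\cdot,\cdot)_\Omega$ is the $L^2(\Omega)$ inner product; $|\cdot|_{s,\Omega}$ and $\|\cdot\|_{s,\Omega}$ are the seminorm and norm of $H^s(\Omega)$ (also for vector fields), and $\|w\|_{-1,\Omega}=\sup_{0\ne v\in H^1_0(\Omega)}(w,v)_\Omega/\|\nabla v\|_{0,\Omega}$. $(\boldsymbol\nabla\boldsymbol u)\boldsymbol u=\sum_j u_j\partial_{x_j}\boldsymbol u$. ''Regular solution'' means a solution smooth enough for the equations, boundary and initial conditions to hold in the classical sense and for integrations by parts to be justified. *)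

(* Defs.v *)
From HB Require Import structures.
From mathcomp Require Import all_boot all_order all_algebra.
From mathcomp Require Import all_classical all_reals all_analysis.

Set Implicit Arguments.
Unset Strict Implicit.
Unset Printing Implicit Defensive.
Import Order.TTheory GRing.Theory Num.Theory.
Import numFieldNormedType.Exports.

Local Open Scope classical_set_scope.
Local Open Scope ring_scope.

Section Plane.
Context {R : realType}.
Local Notation X := (R * R)%type.
Implicit Types (Om : set X) (x y a b n : X).

Definition dot x y : R := x.1 * y.1 + x.2 * y.2.

(* X with its Borel sigma-algebra, as the domain of the area measure. *)
Local Notation bR := (measurableTypeR R).
Definition area : {measure set (bR * bR) -> \bar R} :=
  (@lebesgue_measure R \x @lebesgue_measure R)%E.

Definition boundary Om : set X := closure Om `\` interior Om.

Definition segment a b : set X :=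
  [set x | exists2 s : R, 0 <= s <= 1 & x = (1 - s) *: a + s *: b].

(* Near x, Om is exactly the open half plane on the side of x opposite to n;
   this fails at corners and on slits. *)
Definition outward_normal Om x n : Prop :=
  dot n n = 1 /\ \forall y \near x, Om y <-> dot (y - x) n < 0.

(* A bounded domain whose boundary consists of finitely many edges, and whose
   outward unit normal exists outside a finite set of vertices.  Holes and
   re-entrant corners are allowed; slits are not. *)
Definition polygonal_domain Om : Prop :=
  [/\ Om !=set0, open Om, connected Om & bounded_set Om] /\
  (exists edges : seq (X * X),
     (forall e, e \in edges -> e.1 != e.2) /\
     boundary Om = [set x | exists2 e, e \in edges & segment e.1 e.2 x]) /\
  finite_set [set x | boundary Om x /\ ~ exists n, outward_normal Om x n].

Section Operators.
Context {V : normedModType R}.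
Implicit Types f : X -> V.

Definition e1 : X := (1, 0).
Definition e2 : X := (0, 1).
Definition d1 f x : V := 'D_e1 f x.
Definition d2 f x : V := 'D_e2 f x.
Definition laplacian f x : V := d1 (d1 f) x + d2 (d2 f) x.
(* The convective term, usually written (grad f) v or (v . grad) f. *)
Definition advect (v : X -> X) f x : V :=
  (v x).1 *: d1 f x + (v x).2 *: d2 f x.

Fixpoint Ck (k : nat) f : Prop :=
  continuous f /\
  if k is k'.+1 then
    (forall x, derivable f x e1 /\ derivable f x e2) /\
    Ck k' (d1 f) /\ Ck k' (d2 f)
  else True.
End Operators.

Definition grad (f : X -> R) x : X := (d1 f x, d2 f x).
Definition divergence (v : X -> X) x : R :=
  d1 (fun y => (v y).1) x + d2 (fun y => (v y).2) x.

(* In h t x, t is the time and x the position. *)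
Section SpaceTime.
Context {V : normedModType R}.
Implicit Types (h : R -> X -> V) (I : set R).

(* h is continuous on I x Om up to the boundary of Om. *)
Definition continuous_upto I Om h : Prop :=
  exists2 H : R * X -> V, {within I `*` closure Om, continuous H} &
    forall t x, I t -> Om x -> H (t, x) = h t x.

(* All space derivatives of h of order at most k exist in Om for t in I and
   are continuous on I x Om up to the boundary of Om. *)
Fixpoint Ck_upto k I Om h : Prop :=
  continuous_upto I Om h /\
  if k is k'.+1 then
    (forall t x, I t -> Om x ->
      derivable (h t) x e1 /\ derivable (h t) x e2) /\
    Ck_upto k' I Om (fun t => d1 (h t)) /\
    Ck_upto k' I Om (fun t => d2 (h t))
  else True.

(* Time derivative within ]0, T]: two-sided for t < T, from the left at T. *)
Definition dt_quotient h x t (s : R) : V := (s - t)^-1 *: (h s x - h t x).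
Definition dt_filter (T t : R) := within `]0, T] (dnbhs t).
Definition derivable_t T h t x : Prop := cvg (dt_quotient h x t @ dt_filter T t).
Definition dt T h t x : V := lim (dt_quotient h x t @ dt_filter T t).

(* f extends continuously from Om to the boundary point x, with value l. *)
Definition trace_at Om (f : X -> V) x (l : V) : Prop :=
  f y @[y --> within Om (nbhs x)] --> l.
End SpaceTime.

Section Sobolev.
Variable Om : set X.

Definition L2sq (f : X -> R) : \bar R := \int[area]_(x in Om) ((f x) ^+ 2)%:E.
Definition L2sqv (v : X -> X) : \bar R := \int[area]_(x in Om) (dot (v x) (v x))%:E.
Definition ip (f g : X -> R) : R := \int[area]_(x in Om) (f x * g x).

Definition L2 (f : X -> R) : Prop :=
  measurable_fun (Om : set (bR * bR)) f /\ (L2sq f < +oo)%E.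

Definition test_function (psi : X -> R) : Prop :=
  (forall k, Ck k psi) /\
  exists2 K : set X, compact K /\ K `<=` Om & forall x, ~ K x -> psi x = 0.

Definition weak_grad (f : X -> R) (G : X -> X) : Prop :=
  forall psi, test_function psi ->
    ip f (d1 psi) = - ip (fun x => (G x).1) psi /\
    ip f (d2 psi) = - ip (fun x => (G x).2) psi.

(* f is in H^1(Om), with weak gradient G. *)
Definition H1 (f : X -> R) (G : X -> X) : Prop :=
  [/\ L2 f, L2 (fun x => (G x).1), L2 (fun x => (G x).2) & weak_grad f G].

(* |f|_{1,Om}^2.  Any two weak gradients of f agree almost everywhere, so the
   infimum ranges over one value if f is in H^1(Om), and is +oo otherwise. *)
Definition H1semi2 (f : X -> R) : \bar R :=
  ereal_inf [set L2sqv G | G in H1 f].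
Definition H1semi2v (v : X -> X) : \bar R :=
  (H1semi2 (fun x => (v x).1) + H1semi2 (fun x => (v x).2))%E.

(* f, with weak gradient G, is in H^1_0(Om): the closure of the test functions
   in H^1(Om). *)
Definition H10 (f : X -> R) (G : X -> X) : Prop :=
  H1 f G /\
  exists psi : nat -> X -> R,
    [/\ forall k, test_function (psi k),
        L2sq (fun x => psi k x - f x) @[k --> \oo] --> 0%E &
        L2sqv (fun x => grad (psi k) x - G x) @[k --> \oo] --> 0%E].

(* The supremum is taken in [0, +oo]: the set of quotients is symmetric, so 0
   only fixes the supremum of the empty set. *)
Definition Hm1norm (w : X -> R) : \bar R :=
  ereal_sup ([set 0%E] `|`
    [set q : \bar R | exists v G, [/\ H10 v G,
       ~ {ae area, forall x, Om x -> v x = 0} &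
       q = (ip w v / Num.sqrt (fine (L2sqv G)))%:E]]).

End Sobolev.

Definition potential (s : R) : R := (s ^+ 2 - 1) ^+ 2 / 4.
Definition potential' (s : R) : R := s ^+ 3 - s.

Definition energy Om (eps lam : R) (v : X -> X) (phi : X -> R) : \bar R :=
  ((2^-1)%:E * L2sqv Om v + (lam / 2)%:E * H1semi2 Om phi +
   (lam * eps ^- 2)%:E * \int[area]_(x in Om) (potential (phi x))%:E)%E.

(* L^2(0,T; L^2(Om)^2), identified with the square-integrable fields on
   the cylinder (0,T) x Om. *)
Definition L2L2 Om (T : R) (g : R -> X -> X) : Prop :=
  measurable_fun (`]0, T[ `*` Om : set (bR * (bR * bR)))
    (fun z => g z.1 z.2) /\
  (\int[lebesgue_measure]_(t in `]0%R, T[) L2sqv Om (g t) < +oo)%E.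

Section System.
Variables (Om : set X) (T nu lam gam eps : R).
Variables (g : R -> X -> X) (u0 : X -> X) (phi0 : X -> R).
Variables (u : R -> X -> X) (phi p : R -> X -> R).

Definition material_dt t x : R := dt T phi t x + dot (u t x) (grad (phi t) x).

(* Continuity down to t = 0 is asked only of u, phi and grad phi. *)
Definition regular : Prop :=
  [/\ continuous_upto `[0, T] Om u,
      Ck_upto 2 `]0, T] Om u,
      (forall t x, 0 < t <= T -> Om x -> derivable_t T u t x) &
      continuous_upto `]0, T] Om (dt T u)] /\
  [/\ Ck_upto 1 `[0, T] Om phi,
      Ck_upto 4 `]0, T] Om phi,
      (forall t x, 0 < t <= T -> Om x -> derivable_t T phi t x) &
      Ck_upto 1 `]0, T] Om (dt T phi)] /\
  Ck_upto 1 `]0, T] Om p.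

Definition equations : Prop := forall t x, 0 < t <= T -> Om x ->
  [/\ dt T u t x - nu *: laplacian (u t) x + advect (u t) (u t) x
        + grad (p t) x + (lam * laplacian (phi t) x) *: grad (phi t) x = g t x,
      divergence (u t) x = 0 &
      material_dt t x
        + gam * laplacian (fun y => laplacian (phi t) y
                             - eps ^- 2 * potential' (phi t y)) x = 0].

Definition boundary_conditions : Prop :=
  forall t x, 0 < t <= T -> boundary Om x ->
    trace_at Om (u t) x 0 /\
    forall n, outward_normal Om x n ->
      trace_at Om (fun y => dot (grad (phi t) y) n) x 0 /\
      trace_at Om (fun y => dot (grad (laplacian (phi t)) y) n) x 0.

Definition initial_conditions : Prop :=
  forall x, Om x -> u 0 x = u0 x /\ phi 0 x = phi0 x.

Definition regular_solution : Prop :=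
  [/\ regular, equations, boundary_conditions & initial_conditions].

End System.

Definition time_measure (T : R) : {measure set bR -> \bar R} :=
  mrestr (@lebesgue_measure R) (measurable_itv `[0, T]).

End Plane.

(* Main.v *)
Require Import Defs.
From mathcomp Require Import all_boot all_order all_algebra.
From mathcomp Require Import all_classical all_reals all_analysis.
From mathcomp Require Import measurable_realfun ess_sup_inf.
From mathcomp Require Import ring lra.
Import Order.TTheory GRing.Theory Num.Theory.
Import numFieldNormedType.Exports.
Local Open Scope classical_set_scope.
Local Open Scope ring_scope.
Set Implicit Arguments.
Unset Strict Implicit.
Unset Printing Implicit Defensive.

(** The estimate is the energy method. Write w for Lap phi - eps^-2 f(phi). If the
momentum equation is tested with u and the phase equation with - lam * w, the capillary
force and the transport term cancel up to the integral of u . grad S for a scalar S,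
which vanishes because u is solenoidal and zero on the boundary. What remains is
    E' = (g, u) - nu |grad u|^2 - lam gam |grad w|^2
for the energy E of (u, phi) (energy_rate). By Young's inequality (g, u) is at most
|g|^2 / 2 + E, and Gronwall's inequality bounds E and the time integral of the
dissipation by expR T times the sum of the initial energy and half of the integral
of |g|^2 (energy_estimate). The mean of phi is constant because the phase equation is
in divergence form (mass_rate). Finally grad w controls the H^-1 norm: the material
derivative of phi is - gam Lap w, and Green's formula against functions of H^1_0 with
Cauchy-Schwarz gives gam |grad w| as a bound (Hm1norm_le).

All integrations by parts rest on a divergence theorem for bounded continuous fields
F on Om with continuous d1 F1 and d2 F2, bounded divergence, and a normal component that
tends to zero at the boundary (divergence_theorem0). What enters from the polygon is that
Om is bounded, open and a half plane near every boundary point outside a finite set of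
corners. The flux of F through a cut-off psi is the integral of div (psi F), and the claim
is that it vanishes for psi = 1. It does when psi has compact support in Om (Fubini and
the fundamental theorem of calculus); when psi lives near a straight piece of the
boundary, as cutting off a slab of width d costs a gradient of size 1/d on an area of
order d against a normal component that tends to zero (flux_good_halfplane); hence, by
compactness, when psi vanishes near the corners; and in general because a cut-off at
distance r of a corner has a gradient of size 1/r on an area of order r^2
(flux_near_corners).

The solution is differentiable in time but its gradient is not assumed to be, so the
gradient energy cannot be differentiated under the integral. Instead its increment is
rewritten as a pairing of the increment of phi with Laplacians (grad_increment); all
parts of the energy have this form, which derive_pairing differentiates by dominated
convergence. *)

(** * The area measure on the plane *)

Section PlaneMeasure.
Context {R : realType}.
Local Notation X := (R * R)%type.
Local Notation bR := (measurableTypeR R).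
Implicit Types (U : set X) (x y : X).

(** An open set is a countable union of squares with rational centres, and squares
are boxes of the product sigma-algebra. *)
Lemma plane_open_measurable U : open U -> measurable (U : set (bR * bR)).
Proof.
move=> oU.
pose B (p : rat * rat * nat) : set X :=
  ball (ratr p.1.1 : R, ratr p.1.2 : R) (p.2.+1%:R^-1 : R).
have mB p : measurable (B p : set (bR * bR)).
  have -> : B p = ball (ratr p.1.1 : R) (p.2.+1%:R^-1 : R) `*` ball (ratr p.1.2 : R) (p.2.+1%:R^-1 : R).
    by apply/seteqP; split.
  apply: measurableX; rewrite ball_itv; exact: measurable_itv.
pose C (i : nat) : set (bR * bR) := if unpickle i is Some p then
  (if asbool (B p `<=` U) then B p else set0) else set0.
rewrite (_ : U = \bigcup_i C i); last first.
  apply/seteqP; split=> [x Ux|x [i _]]; last first.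
    by rewrite /C; case: unpickle => [p|//]; case: asboolP => // + Bx; exact.
  have /nbhs_ballP[e /= e0 eU] := open_nbhs_nbhs (conj oU Ux).
  have [n [d [derive_value d0 ne]]] : exists n, exists d : R, [/\ d = n.+1%:R^-1, 0 < d & d < e / 2].
    have [n _ /(_ n (leqnn n)) nP] := near_infty_natSinv_lt (PosNum (divr_gt0 e0 (ltr0n R 2))).
    by exists n, n.+1%:R^-1; split => //; rewrite invr_gt0.
  have rat_near (a : R) : exists q : rat, `|ratr q - a| < d.
    have [|q] := @rat_in_itvoo R (a - d) (a + d); first by lra.
    by rewrite in_itv/= => /andP[q1 q2]; exists q; rewrite ltr_norml; lra.
  have [q1 q1P] := rat_near x.1; have [q2 q2P] := rat_near x.2.
  pose p := (q1, q2, n).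
  exists (pickle p); [exact: I|]; rewrite /C pickleK; case: asboolP => [_|].
    by rewrite /B/= -derive_value; split.
  case=> y; rewrite /B/= -derive_value => -[/= y1 y2]; apply: eU; split; rewrite /ball/=.
    rewrite -[x.1](subrK (ratr q1 : R)) -addrA (le_lt_trans (ler_normD _ _))//.
    rewrite distrC; move: q1P y1; rewrite /ball/= => q1P y1; lra.
  rewrite -[x.2](subrK (ratr q2 : R)) -addrA (le_lt_trans (ler_normD _ _))//.
  rewrite distrC; move: q2P y2; rewrite /ball/= => q2P y2; lra.
apply: bigcupT_measurable => i; rewrite /C; case: unpickle => [p|//].
by case: asboolP.
Qed.

Lemma plane_continuous_measurable U (f : X -> R) : open U ->
  (forall x, U x -> {for x, continuous f}) ->
  measurable_fun (U : set (bR * bR)) f.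
Proof.
move=> oU cf; apply: (measurability _ (RGenOpens.measurableE R)).
move=> _ [_ [a [b ->] <-]]; apply: plane_open_measurable.
rewrite openE => x [Ux xab]; rewrite /interior.
apply: filterI; first exact: open_nbhs_nbhs.
by apply: (cf _ Ux); apply: open_nbhs_nbhs; split => //; exact: interval_open.
Qed.

Lemma area_ball x (r : R) : 0 <= r -> area (ball x r) = ((r *+ 2) * (r *+ 2))%:E.
Proof.
move=> r0; have -> : ball x r = ball x.1 r `*` ball x.2 r by apply/seteqP; split.
transitivity (lebesgue_measure (ball x.1 r) * lebesgue_measure (ball x.2 r))%E.
  by apply: product_measure1E; exact: measurable_ball.
by rewrite !lebesgue_measure_ball.
Qed.

Lemma bounded_setP (U : set X) : bounded_set U -> exists2 M : R, 0 < M &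
  forall x, U x -> `|x.1| < M /\ `|x.2| < M.
Proof.
move=> [M [_ UM]]; exists (`|M| + 2); first by rewrite ltr_wpDl.
have M1 : M < `|M| + 1 by rewrite ltr_pwDr// ler_norm.
move=> x /(UM _ M1)/= xM;
have M2 : `|x| < `|M| + 2 by rewrite (le_lt_trans xM)// ltrD2l ltr1n.
by split; apply: le_lt_trans M2; rewrite /Num.norm/= le_max lexx ?orbT.
Qed.

Lemma bounded_setT (U : set X) (M : R) :
  (forall x, U x -> `|x.1| <= M /\ `|x.2| <= M) -> bounded_set U.
Proof.
move=> UM; exists M; split; first exact: num_real.
move=> r Mr x /UM[x1 x2] /=.
by rewrite /Num.norm/= ge_max !(le_trans _ (ltW Mr)).
Qed.

Lemma bounded_subset_ball (U : set X) : bounded_set U -> exists2 M : R, 0 < M &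
  U `<=` ball (0 : X) M.
Proof.
move=> /bounded_setP[M M0 UM]; exists M => // x /UM[x1 x2].
by split; rewrite /ball/= sub0r normrN.
Qed.

Lemma closed_bounded_compact (U : set X) : closed U -> bounded_set U -> compact U.
Proof.
move=> cU /bounded_setP[M M0 UM].
apply: (@subclosed_compact _ _ (`[- M, M] `*` `[- M, M])) => //.
  by apply: compact_setX; exact: segment_compact.
move=> x /UM[x1 x2]; split; rewrite /= in_itv/=.
  by move: x1; rewrite ltr_norml => /andP[/ltW-> /ltW->].
by move: x2; rewrite ltr_norml => /andP[/ltW-> /ltW->].
Qed.

Lemma bounded_closure (U : set X) : bounded_set U -> bounded_set (closure U).
Proof.
move=> /bounded_setP[M M0 UM]; apply: (@bounded_setT _ (M + 1)) => x Ux /=.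
have [|y [Uy [y1 y2]]] := Ux (ball x 1); first exact: nbhsx_ballx.
have [y1M y2M] := UM _ Uy.
move: y1 y2; rewrite /ball/= => y1 y2.
rewrite -[x.1](subrK y.1) -[x.2](subrK y.2).
by split; apply: le_trans (ler_normD _ _) _; rewrite addrC; lra.
Qed.

Lemma area_bounded_fin (U : set X) : open U -> bounded_set U -> (area U < +oo)%E.
Proof.
move=> oU /bounded_subset_ball[M M0 UM].
apply: (@le_lt_trans _ _ (area (ball (0 : X) M))); last by rewrite area_ball ?ltry// ltW.
apply: le_measure => //; rewrite inE; last apply: plane_open_measurable => //.
  exact: plane_open_measurable.
exact: ball_open.
Qed.

Lemma plane_integrable U (f : X -> R) (M : R) : open U -> bounded_set U ->
  (forall x, U x -> {for x, continuous f}) -> (forall x, U x -> `|f x| <= M) ->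
  area.-integrable (U : set (bR * bR)) (EFin \o f).
Proof.
move=> oU bU cf fM; apply: measurable_bounded_integrable.
- exact: plane_open_measurable.
- exact: area_bounded_fin.
- exact: plane_continuous_measurable.
- by exists M; split; [exact: num_real|move=> r /ltW Mr x /= /fM/le_trans; apply].
Qed.

(** The way all the error terms of the cut-off arguments are estimated: bounded
integrands on supports of small area. *)
Lemma Rintegral_support_bound (U A : set X) (f : X -> R) (M : R) :
  open U -> measurable (A : set (bR * bR)) -> (area A < +oo)%E ->
  area.-integrable (U : set (bR * bR)) (EFin \o f) -> 0 <= M ->
  (forall x, U x -> `|f x| <= M) -> (forall x, U x -> ~ A x -> f x = 0) ->
  `|\int[area]_(x in U) f x| <= M * fine (area A).
Proof.
move=> oU mA Afin intf M0 fM f0.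
have mU := plane_open_measurable oU.
apply: le_trans (le_normr_Rintegral mU intf) _.
have -> : M * fine (area A) = \int[area]_(x in A) M by rewrite Rintegral_cst.
have mf : measurable_fun (U : set (bR * bR)) f.
  by move/integrableP : intf => [/measurable_EFinP].
apply: fine_le.
- apply: integrable_fin_num => //.
  exact: integrable_norm.
- rewrite integral_cst// ge0_fin_numE ?mule_ge0//.
  by rewrite lte_mul_pinfty// ge0_fin_numE.
rewrite integral_mkcond [leRHS]integral_mkcond.
apply: ge0_le_integral => //.
- by move=> x _; rewrite patchE; case: ifP.
- apply/(measurable_restrictT _ _).1 => //.
  by apply/measurable_EFinP; exact: measurableT_comp.
- by apply/(measurable_restrictT _ _).1.
- move=> x _; rewrite !patchE; case: ifPn => [/set_mem Ux|_]; last first.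
    by case: ifP.
  case: ifPn => [_|/negP/=]; first by rewrite lee_fin fM.
  by rewrite inE => /f0->//; rewrite normr0.
Qed.

(** Cavalieri: the area is the integral of the lengths of the slices. *)
Lemma area_xslices (A : set X) (a r l : R) : measurable (A : set (bR * bR)) ->
  0 <= r -> 0 <= l -> (forall y, A y -> ball a r y.1) ->
  (forall s, exists b, forall t, A (s, t) -> ball b l t) ->
  (area A <= ((r *+ 2) * (l *+ 2))%:E)%E.
Proof.
move=> mA r0 l0 Ar Al; rewrite /area /= /product_measure1.
apply: (@le_trans _ _ (\int[lebesgue_measure]_s ((l *+ 2)%:E * (\1_(ball a r : set R) s)%:E))%E).
  apply: ge0_le_integral => //.
  - exact: measurable_fun_xsection.
  - apply: measurable_funeM; apply/measurable_EFinP.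
    by apply: measurable_indic; exact: measurable_ball.
  - move=> s _ /=; rewrite indicE; case: (boolP (s \in (ball a r : set R))) => [_|/negP]/=.
      rewrite mule1; have [b bP] := Al s.
      rewrite -(@lebesgue_measure_ball _ b)//.
      apply: le_measure; rewrite ?inE; [exact: measurable_xsection|exact: measurable_ball|].
      by move=> t; rewrite /xsection/= inE => /bP.
    rewrite inE => nA; rewrite (_ : xsection _ _ = set0) ?measure0 ?mule0//.
    by apply/seteqP; split=> // t; rewrite /xsection/= inE => /Ar.
rewrite ge0_integralZl//=; last 2 first.
- by apply/measurable_EFinP; apply: measurable_indic; exact: measurable_ball.
- by rewrite lee_fin mulrn_wge0.
rewrite integral_indic ?setIT//; last exact: measurable_ball.
by rewrite [X in (_ * X)%E](@lebesgue_measure_ball R a r r0) -EFinM mulrC.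
Qed.

Lemma area_yslices (A : set X) (a r l : R) : measurable (A : set (bR * bR)) ->
  0 <= r -> 0 <= l -> (forall y, A y -> ball a r y.2) ->
  (forall t, exists b, forall s, A (s, t) -> ball b l s) ->
  (area A <= ((r *+ 2) * (l *+ 2))%:E)%E.
Proof.
move=> mA r0 l0 Ar Al; rewrite /area /=.
rewrite (@product_measure_unique _ _ bR bR R lebesgue_measure lebesgue_measure
  (@product_measure2 _ _ bR bR R lebesgue_measure lebesgue_measure))//; last first.
  by move=> B C mB mC; exact: product_measure2E.
rewrite /= /product_measure2.
apply: (@le_trans _ _ (\int[lebesgue_measure]_s ((l *+ 2)%:E * (\1_(ball a r : set R) s)%:E))%E).
  apply: ge0_le_integral => //.
  - exact: measurable_fun_ysection.
  - apply: measurable_funeM; apply/measurable_EFinP.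
    by apply: measurable_indic; exact: measurable_ball.
  - move=> s _ /=; rewrite indicE; case: (boolP (s \in (ball a r : set R))) => [_|/negP]/=.
      rewrite mule1; have [b bP] := Al s.
      rewrite -(@lebesgue_measure_ball _ b)//.
      apply: le_measure; rewrite ?inE; [exact: measurable_ysection|exact: measurable_ball|].
      by move=> t; rewrite /ysection/= inE => /bP.
    rewrite inE => nA; rewrite (_ : ysection _ _ = set0) ?measure0 ?mule0//.
    by apply/seteqP; split=> // t; rewrite /ysection/= inE => /Ar.
rewrite ge0_integralZl//=; last 2 first.
- by apply/measurable_EFinP; apply: measurable_indic; exact: measurable_ball.
- by rewrite lee_fin mulrn_wge0.
rewrite integral_indic ?setIT//; last exact: measurable_ball.
by rewrite [X in (_ * X)%E](@lebesgue_measure_ball R a r r0) -EFinM mulrC.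
Qed.

Lemma dot_continuous n : continuous (fun y => dot y n).
Proof.
by move=> y; apply: cvgD; apply: cvgM; [exact: cvg_fst|exact: cvg_cst|exact: cvg_snd|exact: cvg_cst].
Qed.

Lemma strip_open n (a b : R) : open [set y | a < dot y n < b].
Proof.
have -> : [set y | a < dot y n < b] = (fun y => dot y n) @^-1` `]a, b[.
  by apply/seteqP; split => y; rewrite /= in_itv.
by apply: open_comp => [y _|]; [exact: dot_continuous|exact: interval_open].
Qed.

(** A slab of width h meets a square of side 2 r in an area at most 4 r h: slice
along the coordinate direction that is transversal to the slab. *)
Lemma area_strip x (r : R) n (c h : R) : dot n n = 1 -> 0 <= r -> 0 <= h ->
  (area (ball x r `&` [set y | (c < dot y n < c + h)%R]) <= (4 * r * h)%:E)%E.
Proof.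
move=> n1 r0 h0.
set A := _ `&` _.
have mA : measurable (A : set (bR * bR)).
  apply: plane_open_measurable; apply: openI; [exact: ball_open|exact: strip_open].
have -> : 4 * r * h = (r *+ 2) * (h *+ 2) by ring.
have key (m p q : R) : 1 <= 4 * m ^+ 2 -> c < p + q * m < c + h -> `|(c + h / 2 - p) / m - q| < h.
  move=> m2 cq.
  have m0 : m != 0 by apply: contraTneq m2 => ->; rewrite expr0n/= mulr0 ler10.
  have -> : (c + h / 2 - p) / m - q = (c + h / 2 - (p + q * m)) / m by field.
  rewrite normrM normfV ltr_pdivrMr ?normr_gt0//.
  have mh : 2^-1 <= `|m|.
    rewrite -(@ler_pXn2r _ 2) ?nnegrE//; rewrite real_normK ?num_real//; lra.
  have : `|c + h / 2 - (p + q * m)| < h / 2 by rewrite ltr_norml; lra.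
  move=> /lt_le_trans; apply; nra.
(* One component of the unit vector n has modulus at least 1/2; slices in that
   direction have length at most 2 h. *)
have : 1 <= 4 * n.1 ^+ 2 \/ 1 <= 4 * n.2 ^+ 2.
  move: n1; rewrite /dot -!expr2 => n1.
  case: (lerP 1 (4 * n.1 ^+ 2)) => [|?]; [by left|right; lra].
case=> [n1h|n2h].
- apply: (@area_yslices A x.2) => //; first by move=> y [[]].
  move=> t; exists ((c + h / 2 - t * n.2) / n.1) => s [_]; rewrite /dot/= /ball/= => sP.
  by apply: key => //; rewrite addrC.
- apply: (@area_xslices A x.1) => //; first by move=> y [[]].
  move=> s; exists ((c + h / 2 - s * n.1) / n.2) => t [_]; rewrite /dot/= /ball/= => sP.
  exact: key.
Qed.

End PlaneMeasure.

(** * Directional derivatives and functions of class C^1 *)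

Section Derivatives.
Context {R : realType}.
Local Notation X := (R * R)%type.
Implicit Types (x : X) (f g : X -> R).

(** Along a line a directional derivative is an ordinary one; this brings the
rules of one-variable calculus to the plane. *)
Lemma is_derive_line (V W : normedModType R) (f : V -> W) (a v : V) (df : W) :
  is_derive a v f df <-> is_derive (0 : R) (1 : R) (fun h : R => f (h *: v + a)) df.
Proof.
have E : (fun h : R => h^-1 *: ((f \o shift a) (h *: v) - f a)) =
  (fun h : R => h^-1 *: (((fun h : R => f (h *: v + a)) \o shift 0) (h *: 1) - f (0 *: v + a))).
  by apply/funext => h; rewrite /= addr0 scale0r add0r [h *: (1 : R)]mulr1.
by split=> -[dfx <-]; split; rewrite /derivable /derive/= ?E// -?E.
Qed.

Lemma is_derive_slice1 f x (df : R) :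
  is_derive x e1 f df <-> is_derive x.1 (1 : R) (fun s : R => f (s, x.2)) df.
Proof.
rewrite is_derive_line [X in _ <-> X]is_derive_line.
rewrite (_ : (fun h : R => f (h *: e1 + x)) = (fun h : R => f (h *: 1 + x.1, x.2)))//.
apply/funext => h; congr f; case: x => a b /=; congr pair.
by rewrite /= [h *: (0 : R)]mulr0 add0r.
Qed.

Lemma is_derive_slice2 f x (df : R) :
  is_derive x e2 f df <-> is_derive x.2 (1 : R) (fun s : R => f (x.1, s)) df.
Proof.
rewrite is_derive_line [X in _ <-> X]is_derive_line.
rewrite (_ : (fun h : R => f (h *: e2 + x)) = (fun h : R => f (x.1, h *: 1 + x.2)))//.
apply/funext => h; congr f; case: x => a b /=; congr pair.
by rewrite /= [h *: (0 : R)]mulr0 add0r.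
Qed.

Lemma is_derive_compR (V : normedModType R) (f : V -> R) (g : R -> R) (a v : V) (df dg : R) :
  is_derive a v f df -> is_derive (f a) 1 g dg -> is_derive a v (g \o f) (dg * df).
Proof.
move=> /is_derive_line df0 dg0; apply/is_derive_line.
apply: (@is_derive1_comp R g (fun h : R => f (h *: v + a))) => //.
by rewrite scale0r add0r.
Qed.

(** The rules, for functions written pointwise: they can then be nested in a proof
term that computes both the function and its derivative. *)
Section Rules.
Context (V : normedModType R) (a v : V).

Lemma derive_add (f g : V -> R) (df dg : R) : is_derive a v f df -> is_derive a v g dg ->
  is_derive a v (fun y => f y + g y) (df + dg).
Proof. by move=> f1 g1; exact: (is_deriveD f1 g1). Qed.

Lemma derive_sub (f g : V -> R) (df dg : R) : is_derive a v f df -> is_derive a v g dg ->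
  is_derive a v (fun y => f y - g y) (df - dg).
Proof. by move=> f1 g1; exact: (is_deriveB f1 g1). Qed.

Lemma derive_mul (f g : V -> R) (df dg : R) : is_derive a v f df -> is_derive a v g dg ->
  is_derive a v (fun y => f y * g y) (f a * dg + g a * df).
Proof. by move=> f1 g1; exact: (is_deriveM f1 g1). Qed.

Lemma derive_const (c : R) : is_derive a v (fun=> c) 0.
Proof. exact: is_derive_cst. Qed.

Lemma derive_value (f : V -> R) (df df' : R) : is_derive a v f df -> df = df' -> is_derive a v f df'.
Proof. by move=> ? <-. Qed.

Lemma derive_scale (c : R) (f : V -> R) (df : R) : is_derive a v f df ->
  is_derive a v (fun y => c * f y) (c * df).
Proof. by move=> f1; apply: derive_value (derive_mul (derive_const c) f1) _; rewrite mulr0 addr0. Qed.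

End Rules.

Lemma derive_idR (s : R) : is_derive s 1 (fun t : R => t) 1.
Proof. exact: is_derive_id. Qed.

Lemma is_derive_fst1 x : is_derive x e1 (fst : X -> R) 1.
Proof. by apply/is_derive_slice1 => /=; exact: is_derive_id. Qed.
Lemma is_derive_fst2 x : is_derive x e2 (fst : X -> R) 0.
Proof. by apply/is_derive_slice2 => /=; exact: is_derive_cst. Qed.
Lemma is_derive_snd1 x : is_derive x e1 (snd : X -> R) 0.
Proof. by apply/is_derive_slice1 => /=; exact: is_derive_cst. Qed.
Lemma is_derive_snd2 x : is_derive x e2 (snd : X -> R) 1.
Proof. by apply/is_derive_slice2 => /=; exact: is_derive_id. Qed.

Lemma Ck1I f (F1 F2 : X -> R) : continuous f ->
  (forall x, is_derive x e1 f (F1 x)) -> (forall x, is_derive x e2 f (F2 x)) ->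
  continuous F1 -> continuous F2 -> Ck 1 f.
Proof.
move=> cf f1 f2 c1 c2.
have E1 : F1 = d1 f by apply/funext => x; rewrite /d1 derive_val.
have E2 : F2 = d2 f by apply/funext => x; rewrite /d2 derive_val.
rewrite E1 in c1; rewrite E2 in c2.
refine (conj cf (conj _ (conj (conj c1 I) (conj c2 I)))) => x.
by split; [case: (f1 x)|case: (f2 x)].
Qed.

Lemma Ck1P f : Ck 1 f -> [/\ continuous f,
  (forall x, is_derive x e1 f (d1 f x)) /\ (forall x, is_derive x e2 f (d2 f x)),
  continuous (d1 f) & continuous (d2 f)].
Proof.
case=> cf [df [[c1 _] [c2 _]]]; split=> //.
by split=> x; have [? ?] := df x; exact: derivableP.
Qed.

Lemma Ck1_cst (c : R) : Ck 1 (cst c : X -> R).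
Proof.
apply: (@Ck1I _ (cst 0) (cst 0) _ (fun x => derive_const x _ c) (fun x => derive_const x _ c)).
- by move=> ?; exact: cvg_cst.
- by move=> ?; exact: cvg_cst.
- by move=> ?; exact: cvg_cst.
Qed.

Lemma Ck1M f g : Ck 1 f -> Ck 1 g -> Ck 1 (f \* g).
Proof.
move=> /Ck1P[cf [f1 f2] cf1 cf2] /Ck1P[cg [g1 g2] cg1 cg2].
apply: (@Ck1I _ (fun x => f x * d1 g x + g x * d1 f x) (fun x => f x * d2 g x + g x * d2 f x) _
  (fun x => derive_mul (f1 x) (g1 x)) (fun x => derive_mul (f2 x) (g2 x))).
- by move=> x; apply: cvgM; [exact: cf|exact: cg].
- move=> x; apply: cvgD; apply: cvgM; [exact: cf|exact: cg1|exact: cg|exact: cf1].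
- move=> x; apply: cvgD; apply: cvgM; [exact: cf|exact: cg2|exact: cg|exact: cf2].
Qed.

Lemma Ck1_comp (h h' : R -> R) f : (forall s, is_derive s (1 : R) h (h' s)) -> continuous h' ->
  Ck 1 f -> Ck 1 (h \o f).
Proof.
move=> dh ch' /Ck1P[cf [f1 f2] cf1 cf2].
have ch : continuous h.
  by move=> s; apply: differentiable_continuous; apply/derivable1_diffP; case: (dh s).
apply: (@Ck1I _ (fun x => h' (f x) * d1 f x) (fun x => h' (f x) * d2 f x)).
- by move=> x; apply: continuous_comp; [exact: cf|exact: ch].
- by move=> x; exact: is_derive_compR.
- by move=> x; exact: is_derive_compR.
- move=> x; apply: cvgM; last exact: cf1.
  by apply: continuous_comp; [exact: cf|exact: ch'].
- move=> x; apply: cvgM; last exact: cf2.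
  by apply: continuous_comp; [exact: cf|exact: ch'].
Qed.

Lemma is_derive_affine1 (a b c : R) x : is_derive x e1 (fun x : X => a * x.1 + b * x.2 + c) a.
Proof.
have d := derive_add (derive_add (derive_scale a (is_derive_fst1 x)) (derive_scale b (is_derive_snd1 x))) (derive_const x e1 c).
by apply: derive_value d _; ring.
Qed.

Lemma is_derive_affine2 (a b c : R) x : is_derive x e2 (fun x : X => a * x.1 + b * x.2 + c) b.
Proof.
have d := derive_add (derive_add (derive_scale a (is_derive_fst2 x)) (derive_scale b (is_derive_snd2 x))) (derive_const x e2 c).
by apply: derive_value d _; ring.
Qed.

Lemma Ck1_affine (a b c : R) : Ck 1 (fun x : X => a * x.1 + b * x.2 + c).
Proof.
apply: (@Ck1I _ (cst a) (cst b)).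
- move=> x; apply: cvgD; last exact: cvg_cst.
  by apply: cvgD; apply: cvgM; [exact: cvg_cst|exact: cvg_fst|exact: cvg_cst|exact: cvg_snd].
- exact: is_derive_affine1.
- exact: is_derive_affine2.
- by move=> x; exact: cvg_cst.
- by move=> x; exact: cvg_cst.
Qed.

(** * A step function of class C^1 *)

Definition sqpos (s : R) : R := Num.max 0 s ^+ 2.

Lemma continuous_maxr0 : continuous (fun s : R => Num.max 0 s).
Proof.
rewrite (_ : (fun s => _) = (fun s : R => (s + `|s|) / 2)); last first.
  by apply/funext => s; rewrite maxr_absE add0r sub0r normrN.
move=> s; apply: cvgM; last exact: cvg_cst.
by apply: cvgD; [exact: cvg_id|apply: cvg_norm; exact: cvg_id].
Qed.

Lemma is_derive_sqpos (s : R) : is_derive s 1 sqpos (2 * Num.max 0 s).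
Proof.
have [s0|s0|->] := ltgtP s 0.
- rewrite mulr0; apply: (near_eq_is_derive _ (derive_const s (1 : R) (0 : R))).
  near=> t; rewrite /sqpos max_l ?expr0n//.
  by apply: ltW; near: t; exact: lt_nbhsl.
- have : is_derive s 1 (fun t : R => t * t) (2 * s).
    by apply: derive_value (derive_mul (derive_idR s) (derive_idR s)) _; ring.
  apply: near_eq_is_derive; near=> t; rewrite /sqpos max_r ?expr2//.
  by apply: ltW; near: t; exact: lt_nbhsr.
- rewrite mulr0.
  have : h^-1 *: ((sqpos \o shift 0) (h *: (1 : R)) - sqpos 0) @[h --> (0 : R)^'] --> (0 : R).
    apply: norm_cvg0; apply: (@squeeze_cvgr _ _ _ _ (cst 0) (fun h : R => `|h|)).
    - near=> h; rewrite normr_ge0/= addr0 [h *: _]mulr1 /sqpos maxxx expr0n subr0.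
      rewrite [_ *: _]/(_ * _) normrM normfV.
      have h0 : h != 0 by near: h; exact: nbhs_dnbhs_neq.
      rewrite ler_pdivrMl ?normr_gt0// -expr2 normrX ler_pXn2r ?nnegrE//.
      by rewrite ger0_norm ?le_max ?lexx// ge_max normr_ge0 ler_norm.
    - exact: cvg_cst.
    - rewrite -[X in _ --> X](@normr0 _ R); apply: cvg_norm.
      by move=> A; exact: nbhs_dnbhs.
  move=> c0; split; first by apply/cvg_ex; exists 0.
  exact: cvg_lim.
Unshelve. all: by end_near. Qed.

(** The quadratic spline whose second derivative is 4 on ]0, 1/2[, - 4 on ]1/2, 1[
and 0 elsewhere. *)
Definition step (s : R) : R := 2 * sqpos s - 4 * sqpos (s - 2^-1) + 2 * sqpos (s - 1).
Definition dstep (s : R) : R :=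
  4 * Num.max 0 s - 8 * Num.max 0 (s - 2^-1) + 4 * Num.max 0 (s - 1).

Lemma is_derive_step (s : R) : is_derive s 1 step (dstep s).
Proof.
have sh (c : R) : is_derive s 1 (fun t => sqpos (t - c)) (2 * Num.max 0 (s - c)).
  rewrite -[2 * _]mulr1; apply: (@is_derive1_comp R sqpos (fun t => t - c)).
    exact: is_derive_sqpos.
  by apply: derive_value (derive_sub (derive_idR s) (derive_const _ _ c)) _; rewrite subr0.
have d := derive_add (derive_sub (derive_scale 2 (is_derive_sqpos s)) (derive_scale 4 (sh (2^-1)))) (derive_scale 2 (sh 1)).
by apply: derive_value d _; rewrite /dstep; ring.
Qed.

Lemma continuous_dstep : continuous dstep.
Proof.
move=> s; have sh (c : R) : {for s, continuous (fun t => Num.max 0 (t - c))}.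
  apply: (@continuous_comp _ _ _ (fun t => t - c) (fun t => Num.max 0 t)).
    by apply: cvgB; [exact: cvg_id|exact: cvg_cst].
  exact: continuous_maxr0.
apply: cvgD; [apply: cvgB|]; apply: cvgM; try exact: cvg_cst.
- exact: continuous_maxr0.
- exact: sh.
- exact: sh.
Qed.

Lemma step_le0 (s : R) : s <= 0 -> step s = 0.
Proof. by move=> s0; rewrite /step /sqpos !max_l; [ring|lra..]. Qed.

Lemma step_ge1 (s : R) : 1 <= s -> step s = 1.
Proof. by move=> s1; rewrite /step /sqpos !max_r; [field|lra..]. Qed.

Lemma dstep_out (s : R) : s <= 0 \/ 1 <= s -> dstep s = 0.
Proof.
by case=> sP; rewrite /dstep; [rewrite !max_l|rewrite !max_r]; try lra; field.
Qed.

Lemma dstep_bound (s : R) : 0 <= dstep s <= 2.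
Proof.
by rewrite /dstep; case: (lerP 0 s) => ?; case: (lerP 0 (s - 2^-1)) => ?;
  case: (lerP 0 (s - 1)) => ?; lra.
Qed.

Lemma step_bound (s : R) : 0 <= step s <= 1.
Proof.
by rewrite /step /sqpos; case: (lerP 0 s) => ?; case: (lerP 0 (s - 2^-1)) => ?;
  case: (lerP 0 (s - 1)) => ?; nra.
Qed.

End Derivatives.

(** * Functions with compact support *)

Section CompactSupport.
Context {R : realType}.
Local Notation X := (R * R)%type.
Local Notation bR := (measurableTypeR R).
Local Notation mu := (@lebesgue_measure R).

Lemma compact_bound (T : topologicalType) (K : set T) (f : T -> R) : compact K ->
  {within K, continuous f} -> exists2 M : R, 0 <= M & forall x, K x -> `|f x| <= M.
Proof.
move=> cK cf; have /compact_bounded[M [_ fM]] := continuous_compact cf cK.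
exists (`|M| + 1); first by rewrite addr_ge0.
by move=> x Kx; apply: (fM (`|M| + 1)); [rewrite ltr_pwDr// ler_norm|exists x].
Qed.

Lemma finite_ball_cover (K : set X) (rad : X -> R) : compact K ->
  (forall x, K x -> 0 < rad x) -> exists2 s : seq X, (forall x, x \in s -> K x) &
    forall y, K y -> exists2 x, x \in s & ball x (rad x) y.
Proof.
move=> /compact_near_coveringP cK rad0.
(* The filter of the lists that are large enough. *)
pose F : set_system (seq X) := [set A : set (seq X) | exists s0 : seq X, forall s : seq X, {subset s0 <= s} -> A s].
have FF : Filter F.
  split; first by exists [::].
  - move=> A B [a aA] [b bB]; exists (a ++ b) => s abs.
    by split; [apply: aA|apply: bB] => x xs; apply: abs; rewrite mem_cat xs ?orbT.
  - by move=> A B AB [a aA]; exists a => s /aA/AB.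
pose P (s : seq X) (y : X) := exists2 x : X, x \in s & K x /\ ball x (rad x) y.
have [s0 s0P] : \forall s \near F, K `<=` P s.
  apply: cK => x Kx; exists (ball x (rad x), [set s : seq X | (x : X) \in s]).
    split; last by exists [:: x] => s; apply; exact: mem_head.
    by apply: nbhsx_ballx; exact: rad0.
  by move=> [y s] [/= xy xs]; exists x.
exists [seq x <- s0 | `[< K x >]].
  by move=> x; rewrite mem_filter => /andP[/asboolP].
move=> y /(s0P _ (fun _ => id))[x xs [Kx xy]]; exists x => //.
by rewrite mem_filter xs andbT; apply/asboolP.
Qed.

Lemma integral_derive_compact (G g : R -> R) (M : R) : 0 < M ->
  (forall s, is_derive s (1 : R) G (g s)) -> continuous g ->
  (forall s, M <= `|s| -> G s = 0) -> (forall s, M <= `|s| -> g s = 0) ->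
  (\int[mu]_s (g s)%:E = 0)%E.
Proof.
move=> M0 dG cg G0 g0.
have cG : continuous G.
  by move=> s; apply: differentiable_continuous; apply/derivable1_diffP; case: (dG s).
have -> : (\int[mu]_s (g s)%:E = \int[mu]_(s in `[(- M)%R, M]) (g s)%:E)%E.
  rewrite [RHS]integral_mkcond; apply: eq_integral => s _; rewrite patchE.
  case: ifPn => // /negP; rewrite inE/= in_itv/= => sM.
  rewrite g0// leNgt; apply/negP => /ltW; rewrite ler_norml; exact: sM.
rewrite (@continuous_FTC2 R g G)//.
- by rewrite !G0 ?normrN ?ger0_norm ?(ltW M0)// subee.
- by rewrite -subr_gt0 opprK addr_gt0.
- exact: continuous_subspaceT.
- split.
  + by move=> s _; case: (dG s).
  + by apply: cvg_at_right_filter; exact: cG.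
  + by apply: cvg_at_left_filter; exact: cG.
- by move=> s _; rewrite derive1E derive_val.
Qed.

Lemma integrable_ball_support (f : X -> R) (M : R) : 0 < M -> continuous f ->
  (forall x, ~ ball (0 : X) M x -> f x = 0) ->
  area.-integrable (setT : set (bR * bR)) (EFin \o f).
Proof.
move=> M0 cf f0.
have mB : measurable (ball (0 : X) M : set (bR * bR)).
  by apply: plane_open_measurable; exact: ball_open.
have bB : bounded_set (ball (0 : X) M).
  apply: (@bounded_setT _ _ M) => x [x1 x2].
  by move: x1 x2; rewrite /ball/= !sub0r !normrN => /ltW-> /ltW->.
have cK : compact (closure (ball (0 : X) M)).
  by apply: closed_bounded_compact; [exact: closed_closure|exact: bounded_closure].
have [N N0 fN] := compact_bound cK (continuous_subspaceT cf).
have -> : EFin \o f = (EFin \o f) \_ (ball (0 : X) M : set (bR * bR)).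
  apply/funext => x; rewrite patchE; case: ifPn => // /negP.
  by rewrite inE => /f0/= ->.
apply: (iffLR (integrable_mkcond _ mB)).
apply: (@plane_integrable _ _ f N) => //; first exact: ball_open.
- by move=> x _; exact: cf.
- by move=> x Bx; apply: fN; exact: subset_closure.
Qed.

Lemma Rintegral_xslices0 (f : X -> R) (M : R) : 0 < M -> continuous f ->
  (forall x, ~ ball (0 : X) M x -> f x = 0) ->
  (forall t, \int[mu]_s (f (s, t))%:E = 0)%E -> \int[area]_x f x = 0.
Proof.
move=> M0 cf f0 fs; have intf := integrable_ball_support M0 cf f0.
rewrite /Rintegral -(integral21_prod_meas1 (m1 := mu) (m2 := mu) intf) /fubini_G/=.
by rewrite integral0_eq.
Qed.

Lemma Rintegral_yslices0 (f : X -> R) (M : R) : 0 < M -> continuous f ->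
  (forall x, ~ ball (0 : X) M x -> f x = 0) ->
  (forall s, \int[mu]_t (f (s, t))%:E = 0)%E -> \int[area]_x f x = 0.
Proof.
move=> M0 cf f0 fs; have intf := integrable_ball_support M0 cf f0.
rewrite /Rintegral -(integral12_prod_meas1 (m1 := mu) (m2 := mu) intf) /fubini_F/=.
by rewrite integral0_eq.
Qed.

Section Support.
Implicit Types (x : X).
Variables (Om K : set X) (h : X -> R).
Hypotheses (cK : compact K) (KOm : K `<=` Om).
Hypothesis h0 : forall x, ~ K x -> h x = 0.

Let oKC : open (~` K).
Proof. by apply: closed_openC; apply: compact_closed => //; exact: norm_hausdorff. Qed.

Let near0 x : ~ K x -> \forall y \near x, h y = 0.
Proof. by move=> nK; near=> y; apply: h0; near: y; exact: open_nbhs_nbhs. Unshelve. all: by end_near. Qed.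

Let der0 x v : ~ K x -> is_derive x v h 0.
Proof.
move=> nK; apply: (near_eq_is_derive _ (derive_const x v (0 : R))).
by near=> y; apply/esym; near: y; exact: near0.
Unshelve. all: by end_near. Qed.

(* The function h is constrained only in Om, but near a point outside K it
   vanishes: it is as regular on the whole plane as in Om. *)
Let dir_derive (v : X) : (forall x, Om x -> derivable h x v) ->
  (forall x, Om x -> {for x, continuous ('D_v h)}) ->
  [/\ forall x, is_derive x v h ('D_v h x), continuous ('D_v h) &
     exists2 M : R, 0 < M & forall x, ~ ball (0 : X) M x -> h x = 0 /\ 'D_v h x = 0].
Proof.
move=> dh ch; split.
- move=> x; have [/KOm/dh/derivableP//|nK] := pselect (K x).
  by have d0 := der0 v nK; rewrite derive_val.
- move=> x; have [/KOm/ch//|nK] := pselect (K x).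
  have E0 : 'D_v h x = 0 by have d0 := der0 v nK; rewrite derive_val.
  rewrite /prop_for /continuous_at E0; apply: cvg_near_cst.
  have nx : nbhs x (~` K) by exact: open_nbhs_nbhs.
  move: nx; apply: filterS => y nKy.
  by have d0 := der0 v nKy; rewrite derive_val.
- have [M M0 KM] := bounded_subset_ball (compact_bounded cK); exists M => // x nB.
  have nK : ~ K x by move/KM.
  by split; [exact: h0|have d0 := der0 v nK; rewrite derive_val].
Unshelve. all: by end_near. Qed.

Let extend0 (v : X) : \int[area]_x 'D_v h x = 0 -> \int[area]_(x in Om) 'D_v h x = 0.
Proof.
move=> <-; rewrite Rintegral_mkcond; congr (Rintegral _ _ _).
apply/funext => x; rewrite patchE; case: ifPn => // /negP; rewrite inE => nOm.
have nK : ~ K x by move/KOm.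
by have d0 := der0 v nK; rewrite derive_val.
Qed.

(** The integral of a derivative of a function with compact support vanishes:
integrate first along the lines in the direction of the derivative. *)
Lemma Rintegral_d1_compact : (forall x, Om x -> derivable h x e1) ->
  (forall x, Om x -> {for x, continuous (d1 h)}) -> \int[area]_(x in Om) d1 h x = 0.
Proof.
move=> dh ch; have [der cd [M M0 hM]] := dir_derive dh ch; apply: extend0.
apply: (@Rintegral_xslices0 _ M M0 cd) => [x /hM[]//|t].
have out s : M <= `|s| -> ~ ball (0 : X) M (s, t).
  by move=> Ms [/=]; rewrite /ball/= sub0r normrN ltNge Ms.
apply: (@integral_derive_compact (fun s => h (s, t)) _ M) => //.
- by move=> s; exact: (iffLR (is_derive_slice1 _ (s, t) _) (der (s, t))).
- move=> s; apply: (@continuous_comp _ _ _ (fun s => (s, t)) ('D_e1 h)); last exact: cd.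
  exact: (cvg_pair cvg_id (cvg_cst t)).
- by move=> s /out/hM[].
- by move=> s /out/hM[].
Qed.

Lemma Rintegral_d2_compact : (forall x, Om x -> derivable h x e2) ->
  (forall x, Om x -> {for x, continuous (d2 h)}) -> \int[area]_(x in Om) d2 h x = 0.
Proof.
move=> dh ch; have [der cd [M M0 hM]] := dir_derive dh ch; apply: extend0.
apply: (@Rintegral_yslices0 _ M M0 cd) => [x /hM[]//|s].
have out t : M <= `|t| -> ~ ball (0 : X) M (s, t).
  by move=> Mt [/= _]; rewrite /ball/= sub0r normrN ltNge Mt.
apply: (@integral_derive_compact (fun t => h (s, t)) _ M) => //.
- by move=> t; exact: (iffLR (is_derive_slice2 _ (s, t) _) (der (s, t))).
- move=> t; apply: (@continuous_comp _ _ _ (fun t => (s, t)) ('D_e2 h)); last exact: cd.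
  exact: (cvg_pair (cvg_cst s) cvg_id).
- by move=> t /out/hM[].
- by move=> t /out/hM[].
Qed.

End Support.
End CompactSupport.

(** * Cut-off functions *)

Section Bump.
Context {R : realType}.
Local Notation X := (R * R)%type.

(** Equal to 1 on [-1, 1] and to 0 outside [-2, 2]; squaring makes it even without
losing the differentiability at 0. *)
Definition plateau (s : R) : R := 1 - step (s ^+ 2 - 1).
Definition dplateau (s : R) : R := - (dstep (s ^+ 2 - 1) * (2 * s)).

Lemma is_derive_plateau (s : R) : is_derive s (1 : R) plateau (dplateau s).
Proof.
have sq : is_derive s (1 : R) (fun t : R => t ^+ 2 - 1) (2 * s).
  by apply: derive_value (derive_sub (derive_mul (derive_idR s) (derive_idR s)) (derive_const _ _ 1)) _; ring.
apply: derive_value (derive_sub (derive_const s (1 : R) (1 : R)) (is_derive_compR sq (is_derive_step _))) _.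
by rewrite sub0r.
Qed.

Lemma continuous_dplateau : continuous dplateau.
Proof.
move=> s; apply: cvgN; apply: cvgM.
  apply: (@continuous_comp _ _ _ (fun t : R => t ^+ 2 - 1) dstep); last exact: continuous_dstep.
  by apply: cvgB; [exact: exprn_continuous|exact: cvg_cst].
by apply: cvgM; [exact: cvg_cst|exact: cvg_id].
Qed.

Lemma plateau_in (s : R) : `|s| <= 1 -> plateau s = 1.
Proof.
rewrite ler_norml => /andP[s1 s2].
by rewrite /plateau step_le0 ?subr0//; nra.
Qed.

Lemma plateau_out (s : R) : 2 <= `|s| -> plateau s = 0 /\ dplateau s = 0.
Proof.
move=> s2; have s4 : 1 <= s ^+ 2 - 1.
  by rewrite -(real_normK (num_real s)); nra.
rewrite /plateau step_ge1// subrr; split=> //.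
by rewrite /dplateau dstep_out ?mul0r ?oppr0//; right.
Qed.

Lemma plateau_bound (s : R) : 0 <= plateau s <= 1.
Proof. by rewrite /plateau; have := step_bound (s ^+ 2 - 1); lra. Qed.

Lemma dplateau_bound (s : R) : `|dplateau s| <= 8.
Proof.
have [/ltW s2|/plateau_out[_ ->]] := ltP `|s| 2; last by rewrite normr0.
rewrite /dplateau normrN !normrM [`|2|]ger0_norm//.
have /andP[d0 d2] := dstep_bound (s ^+ 2 - 1); rewrite [`|dstep _|]ger0_norm//.
have := normr_ge0 s; nra.
Qed.

(** A product of one-variable plateaus fits the balls of the plane, which are
squares. *)
Lemma bump_exists (z : X) (r : R) : 0 < r -> exists b : X -> R,
  [/\ Ck 1 b, (forall y, 0 <= b y <= 1), (forall y, ball z r y -> b y = 1),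
    (forall y, ~ ball z (2 * r) y -> [/\ b y = 0, d1 b y = 0 & d2 b y = 0]) &
    (forall y, `|d1 b y| <= 8 / r /\ `|d2 b y| <= 8 / r)].
Proof.
move=> r0; have rN0 : r != 0 by rewrite gt_eqF.
pose l1 (y : X) := r^-1 * y.1 + 0 * y.2 + (- z.1 / r).
pose l2 (y : X) := 0 * y.1 + r^-1 * y.2 + (- z.2 / r).
have C1 : Ck 1 l1 := Ck1_affine _ _ _.
have C2 : Ck 1 l2 := Ck1_affine _ _ _.
have l1E y : l1 y = (y.1 - z.1) / r by rewrite /l1; field.
have l2E y : l2 y = (y.2 - z.2) / r by rewrite /l2; field.
have d11 y : is_derive y e1 l1 r^-1.
  exact: is_derive_affine1.
have d12 y : is_derive y e2 l1 0.
  exact: is_derive_affine2.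
have d21 y : is_derive y e1 l2 0.
  exact: is_derive_affine1.
have d22 y : is_derive y e2 l2 r^-1.
  exact: is_derive_affine2.
have db1 y : is_derive y e1 (fun y => plateau (l1 y) * plateau (l2 y))
    (dplateau (l1 y) / r * plateau (l2 y)).
  apply: derive_value (derive_mul (is_derive_compR (d11 y) (is_derive_plateau _))
    (is_derive_compR (d21 y) (is_derive_plateau _))) _; by rewrite /=; ring.
have db2 y : is_derive y e2 (fun y => plateau (l1 y) * plateau (l2 y))
    (dplateau (l2 y) / r * plateau (l1 y)).
  apply: derive_value (derive_mul (is_derive_compR (d12 y) (is_derive_plateau _))
    (is_derive_compR (d22 y) (is_derive_plateau _))) _; by rewrite /=; ring.
have norml (a b : R) : `|(a - b) / r| = `|b - a| / r.
  by rewrite normrM normfV (gtr0_norm r0) distrC.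
exists (fun y => plateau (l1 y) * plateau (l2 y)); split.
- exact: (Ck1M (Ck1_comp is_derive_plateau continuous_dplateau C1)
    (Ck1_comp is_derive_plateau continuous_dplateau C2)).
- move=> y; have /andP[a0 a1] := plateau_bound (l1 y).
  by have /andP[b0 b1] := plateau_bound (l2 y); apply/andP; split; nra.
- move=> y [/= y1 y2]; rewrite !plateau_in ?mulr1// ?l1E ?l2E norml ler_pdivrMr// mul1r ltW//.
- move=> y nB; rewrite /d1 /d2 (@derive_val _ _ _ _ _ _ _ (db1 y)) (@derive_val _ _ _ _ _ _ _ (db2 y)).
  have [y1|y1] := leP (2 * r) `|z.1 - y.1|.
    have [|-> ->] := @plateau_out (l1 y); last by rewrite !(mul0r, mulr0).
    by rewrite l1E norml ler_pdivlMr.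
  have [y2|y2] := leP (2 * r) `|z.2 - y.2|; last by exfalso; apply: nB; split.
  have [|-> ->] := @plateau_out (l2 y); last by rewrite !(mul0r, mulr0).
  by rewrite l2E norml ler_pdivlMr.
- move=> y; rewrite /d1 /d2 (@derive_val _ _ _ _ _ _ _ (db1 y)) (@derive_val _ _ _ _ _ _ _ (db2 y)).
  have /andP[a0 a1] := plateau_bound (l1 y); have /andP[b0 b1] := plateau_bound (l2 y).
  have q1 := dplateau_bound (l1 y); have q2 := dplateau_bound (l2 y).
  have ri0 : 0 < r^-1 by rewrite invr_gt0.
  rewrite !normrM !normfV (gtr0_norm r0) (ger0_norm a0) (ger0_norm b0).
  split; rewrite -[leRHS]mulr1; apply: ler_pM => //; rewrite ?mulr_ge0 ?(ltW ri0)//;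
    by rewrite ler_pM2r.
Qed.

End Bump.

(** * The divergence theorem for fields without normal component *)

Lemma small_eq0 (R : realType) (a C : R) : 0 <= C ->
  (forall e, 0 < e -> e < 1 -> `|a| <= C * e) -> a = 0.
Proof.
move=> C0 aC; apply/eqP; apply: contraT => an0.
have a0 : 0 < `|a| by rewrite normr_gt0.
have C1 : 0 < C + 1 by rewrite ltr_wpDl.
pose e := Num.min (2^-1) (`|a| / (2 * (C + 1))).
have e0 : 0 < e by rewrite lt_min invr_gt0 ltr0n/= divr_gt0// mulr_gt0.
have e1 : e < 1 by rewrite gt_min; apply/orP; left; rewrite invf_lt1// ltr1n.
have := aC _ e0 e1.
have : e * (2 * (C + 1)) <= `|a| by rewrite -ler_pdivlMr ?mulr_gt0// ge_min lexx orbT.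
nra.
Qed.

Lemma absorb_le (R : realType) (a b : R) : 0 <= a -> a <= a * b ->
  3 * a + 16 * a * b <= 27 * a * b.
Proof. lra. Qed.

Section Flux.
Context {R : realType}.
Local Opaque Ck Rintegral area.
Local Notation X := (R * R)%type.
Local Notation bR := (measurableTypeR R).
Variables (Om : set X) (F1 F2 : X -> R) (M : R).
Hypotheses (oOm : open Om) (bOm : bounded_set Om) (M0 : 0 <= M).
Hypotheses (cF1 : forall x, Om x -> {for x, continuous F1})
  (cF2 : forall x, Om x -> {for x, continuous F2})
  (dF1 : forall x, Om x -> derivable F1 x e1)
  (dF2 : forall x, Om x -> derivable F2 x e2)
  (cdF1 : forall x, Om x -> {for x, continuous (d1 F1)})
  (cdF2 : forall x, Om x -> {for x, continuous (d2 F2)}).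
Hypotheses (bF1 : forall x, Om x -> `|F1 x| <= M) (bF2 : forall x, Om x -> `|F2 x| <= M)
  (bdF : forall x, Om x -> `|d1 F1 x + d2 F2 x| <= M).
Implicit Types (psi chi : X -> R) (x y z : X).

(** The divergence of psi F. Its integral depends linearly on psi, so that it can be
localised with cut-off functions. *)
Definition flux_density psi x : R :=
  F1 x * d1 psi x + F2 x * d2 psi x + psi x * (d1 F1 x + d2 F2 x).
Definition flux psi : R := \int[area]_(x in Om) flux_density psi x.

Let mOm : measurable (Om : set (bR * bR)) := plane_open_measurable oOm.

Lemma near_d1_eq (f g : X -> R) x : (\forall y \near x, f y = g y) ->
  d1 f x = d1 g x /\ d2 f x = d2 g x.
Proof. by move=> fg; split; exact: near_eq_derive. Qed.

Lemma open_d_eq (U : set X) (f g : X -> R) x : open U -> (forall y, U y -> f y = g y) ->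
  U x -> d1 f x = d1 g x /\ d2 f x = d2 g x.
Proof.
move=> oU fg Ux; apply: near_d1_eq.
by have := open_nbhs_nbhs (conj oU Ux); apply: filterS => y /fg.
Qed.

Let compact_clOm : compact (closure Om).
Proof. by apply: closed_bounded_compact; [exact: closed_closure|exact: bounded_closure]. Qed.

Lemma Ck1_bounded psi : Ck 1 psi -> exists2 N : R, 0 <= N & forall x, Om x ->
  [/\ `|psi x| <= N, `|d1 psi x| <= N & `|d2 psi x| <= N].
Proof.
move=> /Ck1P[c0 _ c1 c2].
have [N0 N00 P0] := compact_bound compact_clOm (continuous_subspaceT c0).
have [N1 N10 P1] := compact_bound compact_clOm (continuous_subspaceT c1).
have [N2 N20 P2] := compact_bound compact_clOm (continuous_subspaceT c2).
exists (N0 + N1 + N2); first by rewrite !addr_ge0.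
move=> x /(@subset_closure _ Om) clx.
have p0 := P0 _ clx; have p1 := P1 _ clx; have p2 := P2 _ clx.
by split; [apply: le_trans p0 _|apply: le_trans p1 _|apply: le_trans p2 _]; lra.
Qed.

Let continuous_density psi x : Ck 1 psi -> Om x -> {for x, continuous (flux_density psi)}.
Proof.
move=> /Ck1P[c0 _ c1 c2] Ox; apply: cvgD; first apply: cvgD.
- by apply: cvgM; [exact: cF1|exact: c1].
- by apply: cvgM; [exact: cF2|exact: c2].
- by apply: cvgM; [exact: c0|apply: cvgD; [exact: cdF1|exact: cdF2]].
Qed.

Let density_bound (N a b c : R) x : 0 <= N -> Om x -> `|a| <= N -> `|b| <= N -> `|c| <= N ->
  `|F1 x * a + F2 x * b + c * (d1 F1 x + d2 F2 x)| <= 3 * M * N.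
Proof.
move=> N0 Ox aN bN cN; have f1 := bF1 Ox; have f2 := bF2 Ox; have f3 := bdF Ox.
have H1 : `|F1 x * a| <= M * N by rewrite normrM ler_pM.
have H2 : `|F2 x * b| <= M * N by rewrite normrM ler_pM.
have H3 : `|c * (d1 F1 x + d2 F2 x)| <= M * N by rewrite normrM mulrC ler_pM.
apply: le_trans (ler_normD _ _) _; apply: le_trans (lerD (ler_normD _ _) (lexx _)) _.
lra.
Qed.

Lemma flux_integrable psi : Ck 1 psi ->
  area.-integrable (Om : set (bR * bR)) (EFin \o flux_density psi).
Proof.
move=> Cpsi; have [N N0 psiN] := Ck1_bounded Cpsi.
apply: (plane_integrable oOm bOm (M := 3 * M * N)) => x Ox; first exact: continuous_density.
by have [p0 p1 p2] := psiN _ Ox; exact: (density_bound N0 Ox p1 p2 p0).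
Qed.

Lemma eq_flux psi chi : (forall x, Om x -> psi x = chi x) -> flux psi = flux chi.
Proof.
move=> pc; apply: eq_Rintegral => x /set_mem Ox; rewrite /flux_density pc//.
by have [-> ->] := open_d_eq oOm pc Ox.
Qed.

Lemma fluxD psi chi : Ck 1 psi -> Ck 1 chi -> flux (psi \+ chi) = flux psi + flux chi.
Proof.
move=> Cpsi Cchi; rewrite -RintegralD; [|exact: mOm|exact: flux_integrable..].
apply: eq_Rintegral => x _; rewrite /flux_density.
have [_ [p1 p2] _ _] := Ck1P Cpsi; have [_ [q1 q2] _ _] := Ck1P Cchi.
have -> : d1 (psi \+ chi) x = d1 psi x + d1 chi x.
  by have r1 := derive_add (p1 x) (q1 x); rewrite {1}/d1 derive_val.
have -> : d2 (psi \+ chi) x = d2 psi x + d2 chi x.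
  by have r1 := derive_add (p2 x) (q2 x); rewrite {1}/d2 derive_val.
by rewrite /=; ring.
Qed.

Lemma d12M psi chi x : Ck 1 psi -> Ck 1 chi ->
  d1 (psi \* chi) x = psi x * d1 chi x + chi x * d1 psi x /\
  d2 (psi \* chi) x = psi x * d2 chi x + chi x * d2 psi x.
Proof.
move=> /Ck1P[_ [p1 p2] _ _] /Ck1P[_ [q1 q2] _ _].
have r1 := derive_mul (p1 x) (q1 x); have r2 := derive_mul (p2 x) (q2 x).
by split; [rewrite {1}/d1|rewrite {1}/d2]; rewrite derive_val.
Qed.

Lemma Ck1_compl psi : Ck 1 psi -> Ck 1 (fun x => 1 - psi x).
Proof.
move=> /Ck1P[c0 [p1 p2] c1 c2].
apply: (@Ck1I _ _ (fun x => 0 - d1 psi x) (fun x => 0 - d2 psi x) _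
  (fun x => derive_sub (derive_const x _ 1) (p1 x)) (fun x => derive_sub (derive_const x _ 1) (p2 x))).
- by move=> x; apply: cvgB; [exact: cvg_cst|exact: c0].
- by move=> x; apply: cvgB; [exact: cvg_cst|exact: c1].
- by move=> x; apply: cvgB; [exact: cvg_cst|exact: c2].
Qed.

Lemma d12_compl psi x : Ck 1 psi ->
  d1 (fun x => 1 - psi x) x = - d1 psi x /\ d2 (fun x => 1 - psi x) x = - d2 psi x.
Proof.
move=> /Ck1P[_ [p1 p2] _ _].
have r1 := derive_sub (derive_const x e1 1) (p1 x); have r2 := derive_sub (derive_const x e2 1) (p2 x).
by split; [rewrite {1}/d1|rewrite {1}/d2]; rewrite derive_val sub0r.
Qed.

Lemma fluxM_compl psi chi : Ck 1 psi -> Ck 1 chi ->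
  flux psi = flux (psi \* chi) + flux (psi \* (fun x => 1 - chi x)).
Proof.
move=> Cpsi Cchi; rewrite -fluxD; [|exact: Ck1M|exact: Ck1M Cpsi (Ck1_compl Cchi)].
by apply: eq_flux => x _ /=; ring.
Qed.

Lemma flux_compact psi (K : set X) : Ck 1 psi -> compact K -> K `<=` Om ->
  (forall x, ~ K x -> psi x = 0) -> flux psi = 0.
Proof.
move=> /Ck1P[c0 [p1 p2] c1 c2] cK KOm psi0.
have D1 x : Om x -> is_derive x e1 (fun y => psi y * F1 y) (psi x * d1 F1 x + F1 x * d1 psi x).
  by move=> Ox; exact: derive_mul (p1 x) (derivableP (dF1 Ox)).
have D2 x : Om x -> is_derive x e2 (fun y => psi y * F2 y) (psi x * d2 F2 x + F2 x * d2 psi x).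
  by move=> Ox; exact: derive_mul (p2 x) (derivableP (dF2 Ox)).
have E1 x : Om x -> d1 (fun y => psi y * F1 y) x = psi x * d1 F1 x + F1 x * d1 psi x.
  by move=> Ox; have d := D1 _ Ox; rewrite {1}/d1 derive_val.
have E2 x : Om x -> d2 (fun y => psi y * F2 y) x = psi x * d2 F2 x + F2 x * d2 psi x.
  by move=> Ox; have d := D2 _ Ox; rewrite {1}/d2 derive_val.
have C1 x : Om x -> {for x, continuous (fun x => psi x * d1 F1 x + F1 x * d1 psi x)}.
  by move=> Ox; apply: cvgD; apply: cvgM; [exact: c0|exact: cdF1|exact: cF1|exact: c1].
have C2 x : Om x -> {for x, continuous (fun x => psi x * d2 F2 x + F2 x * d2 psi x)}.
  by move=> Ox; apply: cvgD; apply: cvgM; [exact: c0|exact: cdF2|exact: cF2|exact: c2].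
have nearE (f g : X -> R) x : (forall x, Om x -> f x = g x) -> Om x ->
    {for x, continuous g} -> {for x, continuous f}.
  move=> fg Ox cg; rewrite /prop_for /continuous_at fg//; apply: cvg_trans cg.
  apply: near_eq_cvg; have := open_nbhs_nbhs (conj oOm Ox).
  by apply: filterS => y /fg.
have I1 : \int[area]_(x in Om) (psi x * d1 F1 x + F1 x * d1 psi x) = 0.
  transitivity (\int[area]_(x in Om) d1 (fun y => psi y * F1 y) x).
    by apply: eq_Rintegral => x /set_mem Ox; rewrite E1.
  apply: (Rintegral_d1_compact (h := fun y => psi y * F1 y) cK KOm).
  - by move=> x /psi0->; rewrite mul0r.
  - by move=> x /D1[].
  - by move=> x Ox; apply: nearE E1 Ox (C1 _ Ox).
have I2 : \int[area]_(x in Om) (psi x * d2 F2 x + F2 x * d2 psi x) = 0.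
  transitivity (\int[area]_(x in Om) d2 (fun y => psi y * F2 y) x).
    by apply: eq_Rintegral => x /set_mem Ox; rewrite E2.
  apply: (Rintegral_d2_compact (h := fun y => psi y * F2 y) cK KOm).
  - by move=> x /psi0->; rewrite mul0r.
  - by move=> x /D2[].
  - by move=> x Ox; apply: nearE E2 Ox (C2 _ Ox).
(* Each of the two parts is integrable since it vanishes outside K. *)
have int (f : X -> R) : (forall x, Om x -> {for x, continuous f}) ->
    (forall x, ~ K x -> f x = 0) -> area.-integrable (Om : set (bR * bR)) (EFin \o f).
  move=> cf f0; have [|N N0 fN] := @compact_bound _ _ K f cK.
    apply: continuous_in_subspaceT => x /set_mem/KOm; exact: cf.
  apply: (plane_integrable oOm bOm cf (M := N)) => x Ox.
  by have [/fN//|/f0->] := pselect (K x); rewrite normr0.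
have oKC : open (~` K) by apply: closed_openC; apply: compact_closed => //; exact: norm_hausdorff.
have dpsi0 x : ~ K x -> d1 psi x = 0 /\ d2 psi x = 0.
  move=> nK; have [-> ->] := @open_d_eq _ psi (fun=> 0) x oKC psi0 nK.
  by have z1 := derive_const x e1 (0 : R); have z2 := derive_const x e2 (0 : R); rewrite /d1 /d2 !derive_val.
transitivity (\int[area]_(x in Om) (psi x * d1 F1 x + F1 x * d1 psi x) +
  \int[area]_(x in Om) (psi x * d2 F2 x + F2 x * d2 psi x)); last by rewrite I1 I2 addr0.
rewrite -RintegralD; [|exact: mOm|apply: int; first exact: C1|apply: int; first exact: C2].
- by apply: eq_Rintegral => x _; rewrite /flux_density; ring.
- by move=> x nK; have [-> _] := dpsi0 _ nK; rewrite psi0// mul0r mulr0 addr0.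
- by move=> x nK; have [_ ->] := dpsi0 _ nK; rewrite psi0// mul0r mulr0 addr0.
Qed.

(** There is no flux through a neighbourhood of x. *)
Definition flux_good x (r : R) : Prop := 0 < r /\ forall psi, Ck 1 psi ->
  (forall y, ~ ball x r y -> psi y = 0) -> flux psi = 0.

Lemma closed_box_sub x (r : R) : 0 < r -> exists2 K : set X, compact K &
  ball x r `<=` K /\ K `<=` ball x (2 * r).
Proof.
move=> r0; exists (`[x.1 - r, x.1 + r] `*` `[x.2 - r, x.2 + r]).
  by apply: compact_setX; exact: segment_compact.
split=> y [/=].
  rewrite /ball/= => y1 y2; split; rewrite /= in_itv/=.
    by move: y1; rewrite ltr_norml; lra.
  by move: y2; rewrite ltr_norml; lra.
rewrite !in_itv/= => /andP[a b] /andP[c d].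
by split; rewrite /ball/= ltr_norml; lra.
Qed.

Lemma flux_good_interior x : Om x -> exists r, flux_good x r.
Proof.
move=> Ox; have /nbhs_ballP[e /= e0 eO] := open_nbhs_nbhs (conj oOm Ox).
exists (e / 2); split=> [|psi Cpsi psi0]; first by rewrite divr_gt0.
have [|K cK [xK Kx]] := @closed_box_sub x (e / 2); first by rewrite divr_gt0.
apply: (flux_compact Cpsi cK) => [y /Kx|y nK]; last by apply: psi0 => /xK.
by rewrite mulrC divfK// => /eO.
Qed.

Lemma flux_zero psi : (forall x, Om x -> psi x = 0) -> flux psi = 0.
Proof.
move=> psi0; rewrite (@eq_flux psi (cst 0))//.
rewrite /flux (@eq_Rintegral _ _ _ _ _ (cst 0)); last first.
  move=> x _; rewrite /flux_density.
  have z1 := derive_const x e1 (0 : R); have z2 := derive_const x e2 (0 : R).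
  by rewrite {1}/d1 {1}/d2 !derive_val !mulr0 mul0r !addr0.
by rewrite Rintegral_cst// mul0r.
Qed.

Lemma dotBl y x (n : X) : dot (y - x) n = dot y n - dot x n.
Proof. by rewrite /dot/=; ring. Qed.

Lemma dot_step (z n : X) (s : R) : dot (z - s *: n) n = dot z n - s * dot n n.
Proof.
have -> : dot (z - s *: n) n = (z.1 - s * n.1) * n.1 + (z.2 - s * n.2) * n.2 by [].
by rewrite /dot; ring.
Qed.

Lemma norm_le1_dot (n : X) : dot n n = 1 -> `|n.1| <= 1 /\ `|n.2| <= 1.
Proof.
rewrite /dot -!expr2 => n1.
by split; rewrite -(@ler_pXn2r _ 2) ?nnegrE// real_normK ?num_real// expr1n -n1 ?lerDl ?lerDr sqr_ge0.
Qed.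

Lemma boundary_open U x : open U -> boundary U x <-> closure U x /\ ~ U x.
Proof. by move=> oU; rewrite /boundary (iffLR (interior_id _) oU). Qed.

(** The outward normal is locally constant along the boundary. *)
Lemma outward_normal_nbhs x (n : X) : outward_normal Om x n -> exists2 r0 : R, 0 < r0 &
  (forall y, ball x r0 y -> Om y <-> dot (y - x) n < 0) /\
  (forall y, ball x r0 y -> dot (y - x) n = 0 -> boundary Om y /\ outward_normal Om y n).
Proof.
move=> [nn /nbhs_ballP[r0 /= r00 OmE]]; exists r0 => //; split=> // y xy yx0.
have nb : nbhs y (ball x r0) by apply: open_nbhs_nbhs; split=> //; exact: ball_open.
split; last first.
  split=> //; move: nb; apply: filterS => z /OmE ->.
  by rewrite !dotBl; move: yx0; rewrite dotBl => /subr0_eq ->.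
apply/boundary_open => //; split; last by move/(OmE _ xy); rewrite yx0 ltxx.
move=> B nB; have /nbhs_ballP[d /= d0 ballB] : nbhs y (B `&` ball x r0) by exact: filterI.
have [n1 n2] := norm_le1_dot nn.
pose z := y - (d / 2) *: n.
have yz : ball y d z.
  split; rewrite /ball /GRing.scale/= opprD addrA subrr sub0r opprK normrM ger0_norm ?divr_ge0 ?ltW//.
    by rewrite (le_lt_trans (ler_wpM2l _ n1))// ?divr_ge0 ?ltW//; lra.
  by rewrite (le_lt_trans (ler_wpM2l _ n2))// ?divr_ge0 ?ltW//; lra.
have [Bz xz] := ballB _ yz; exists z; split=> //.
by apply/(OmE _ xz); rewrite dotBl dot_step nn; move: yx0; rewrite dotBl; lra.
Qed.

Hypothesis trace0 : forall x (n : X), boundary Om x -> outward_normal Om x n ->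
  trace_at Om (fun y => F1 y * n.1 + F2 y * n.2) x 0.

(** The normal component is small on a thin slab along the boundary, uniformly:
a compactness argument. *)
Lemma normal_trace_unif x (n : X) (r0 : R) (K : set X) (e : R) : 
  (forall y, ball x r0 y -> Om y <-> dot (y - x) n < 0) ->
  (forall y, ball x r0 y -> dot (y - x) n = 0 -> boundary Om y /\ outward_normal Om y n) ->
  compact K -> K `<=` ball x r0 -> 0 < e ->
  \forall d \near (0 : R)^'+, forall y, K y -> Om y -> - d < dot (y - x) n ->
     `|F1 y * n.1 + F2 y * n.2| < e.
Proof.
move=> OmE bE /compact_near_coveringP cK Kr e0.
pose P (d : R) (y : X) := Om y -> - d < dot (y - x) n -> `|F1 y * n.1 + F2 y * n.2| < e.
have cdot y : {for y, continuous (fun y => dot (y - x) n)}.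
  rewrite (_ : (fun y => dot (y - x) n) = (fun y => dot y n - dot x n)); last first.
    by apply/funext => z; rewrite dotBl.
  by apply: cvgB; [exact: dot_continuous|exact: cvg_cst].
suff : \forall d \near (0 : R)^'+, K `<=` P d.
  by apply: filterS => d KP y /KP.
apply: (cK _ _ P) => z Kz.
have nb : nbhs z (ball x r0) by apply: open_nbhs_nbhs; split; [exact: ball_open|exact: Kr].
have [zn|zn|zn] := ltgtP (dot (z - x) n) 0.
- near=> y d => /= Oy yd; exfalso; move: yd; apply/negP; rewrite -leNgt.
  apply: (@le_trans _ _ (dot (z - x) n / 2)).
    apply: ltW; near: y; apply: (cvgr_lt _ (cdot z)); lra.
  rewrite lerNr; apply: ltW; near: d; apply: nbhs_right_lt; lra.
- near=> y d => /= Oy; exfalso.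
  have xy : ball x r0 y by near: y.
  have : dot (y - x) n < 0 by apply/(OmE _ xy).
  apply/negP; rewrite -leNgt; apply: ltW; near: y.
  exact: (cvgr_gt _ (cdot z)).
- have [bz oz] := bE _ (Kr _ Kz) zn.
  have /cvgrPdist_lt/(_ _ e0) := trace0 bz oz; rewrite near_withinE => nz.
  near=> y d => /= Oy _.
  have : Om y -> `|0 - (F1 y * n.1 + F2 y * n.2)| < e by near: y.
  by rewrite sub0r normrN; apply.
Unshelve. all: by end_near. Qed.

Let nearP (f : R -> Prop) : (\forall d \near (0 : R)^'+, f d) ->
  forall e : R, 0 < e -> exists d : R, [/\ 0 < d, d <= e & f d].
Proof.
move=> nf e e0.
have : \forall d \near (0 : R)^'+, [/\ 0 < d, d <= e & f d].
  near=> d; split; near: d; [exact: nbhs_right_gt|exact: nbhs_right_le|exact: nf].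
by move/(@filter_ex _ _ (at_right_proper_filter 0)).
Unshelve. all: by end_near. Qed.

Lemma vanish_out_ball psi x (r : R) y : 0 < r -> (forall y, ~ ball x r y -> psi y = 0) ->
  ~ ball x (2 * r) y -> [/\ psi y = 0, d1 psi y = 0 & d2 psi y = 0].
Proof.
move=> r0 psi0 nB.
have o z : ball y r z -> psi z = 0.
  move=> yz; apply: psi0 => xz; apply: nB.
  by rewrite (_ : 2 * r = r + r); [exact: ball_triangle xz (ball_sym yz)|ring].
have [-> ->] := @open_d_eq _ psi (fun=> 0) y (ball_open y r) o (ballxx _ r0).
have z1 := derive_const y e1 (0 : R); have z2 := derive_const y e2 (0 : R).
by split; [apply: o; exact: ballxx|rewrite /d1 derive_val|rewrite /d2 derive_val].
Qed.

(** Cutting off a slab of width 2 d along the boundary leaves a field with compact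
support; the cut-off has a gradient of size 1/d in the normal direction only. *)
Lemma flux_good_halfplane x (n : X) : outward_normal Om x n -> exists r, flux_good x r.
Proof.
move=> on; have nn := on.1; have [r0 r00 [OmE bE]] := outward_normal_nbhs on.
pose r := r0 / 4; have rp : 0 < r by rewrite divr_gt0.
exists r; split=> // psi Cpsi psi0.
have [K cK [xK Kx]] := closed_box_sub x rp.
have r4 : 2 * r < r0 by rewrite /r; lra.
have Kr0 : K `<=` ball x r0 by move=> y /Kx; apply: le_ball; exact: ltW.
have [K2 cK2 [xK2 K2x]] : exists2 K2 : set X, compact K2 & ball x (2 * r) `<=` K2 /\ K2 `<=` ball x r0.
  have [|K2 cK2 [xK2 K2x]] := @closed_box_sub x (2 * r); first by rewrite mulr_gt0.
  exists K2 => //; split=> // y /K2x; rewrite (_ : 2 * (2 * r) = r0)//.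
  by rewrite /r; field.
have [N N0 psiN] := Ck1_bounded Cpsi.
have C0 : 0 <= 48 * r * M * N + 32 * r * N.
  by apply: addr_ge0; repeat (apply: mulr_ge0 => //); exact: ltW.
apply: (small_eq0 C0) => e e0 _.
have [d [d0 de unif]] := nearP (normal_trace_unif OmE bE cK2 K2x e0) e0.
pose del := d / 2; have del0 : 0 < del by rewrite divr_gt0.
(* chi is 1 at a distance more than d from the line and 0 up to d/2. *)
pose lin (y : X) := (- n.1 / del) * y.1 + (- n.2 / del) * y.2 + (dot x n / del - 1).
have linE y : lin y = - dot (y - x) n / del - 1.
  by rewrite dotBl /lin /dot; field; rewrite gt_eqF.
have Clin : Ck 1 lin := Ck1_affine _ _ _.
have dl1 y : is_derive y e1 lin (- n.1 / del).
  exact: is_derive_affine1.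
have dl2 y : is_derive y e2 lin (- n.2 / del).
  exact: is_derive_affine2.
pose chi := step \o lin.
have Cchi : Ck 1 chi := Ck1_comp is_derive_step continuous_dstep Clin.
have dchi1 y : d1 chi y = dstep (lin y) * (- n.1 / del).
  by have dc := is_derive_compR (dl1 y) (is_derive_step _); rewrite /d1 derive_val.
have dchi2 y : d2 chi y = dstep (lin y) * (- n.2 / del).
  by have dc := is_derive_compR (dl2 y) (is_derive_step _); rewrite /d2 derive_val.
(* Away from the line psi chi has compact support; what remains lives on a slab. *)
rewrite (fluxM_compl Cpsi Cchi).
have -> : flux (psi \* chi) = 0.
  apply: (flux_compact (K := K `&` [set y | dot y n <= dot x n - del]) (Ck1M Cpsi Cchi)).
  - apply: (subclosed_compact _ cK) => [|y []//].
    apply: closedI; first by apply: compact_closed => //; exact: norm_hausdorff.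
    have -> : [set y | dot y n <= dot x n - del] = (fun y => dot y n) @^-1` [set s | s <= dot x n - del].
      by [].
    by apply: closed_comp => [y _|]; [exact: dot_continuous|exact: closed_le].
  - by move=> y [Ky yd]; apply/(OmE _ (Kr0 _ Ky)); rewrite dotBl; move: yd => /=; lra.
  - move=> y nKy /=; have [xy|nxy] := pselect (ball x r y); last by rewrite psi0// mul0r.
    rewrite /chi /= step_le0 ?mulr0// linE subr_le0 ler_pdivrMr// mul1r dotBl.
    have : ~ (dot y n <= dot x n - del) by move=> yd; apply: nKy; split => //; exact: xK.
    by move/negP; rewrite -ltNge; lra.
rewrite add0r.
have Ccc := Ck1_compl Cchi.
pose S := ball x (2 * r) `&` [set y | dot x n - d < dot y n < dot x n - d + d].
have Sfin : (area S < +oo)%E.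
  by rewrite (le_lt_trans (area_strip _ _ nn _ _))// ?ltry ?mulr_ge0 ?ltW//.
have areaS : fine (area S) <= 4 * (2 * r) * d.
  rewrite -lee_fin fineK; first by apply: area_strip; rewrite ?mulr_ge0 ?ltW.
  by rewrite ge0_fin_numE.
have mS : measurable (S : set (bR * bR)).
  by apply: plane_open_measurable; apply: openI; [exact: ball_open|exact: strip_open].
apply: (@le_trans _ _ ((3 * M * N + N * (2 / del) * e) * fine (area S))); last first.
  apply: (@le_trans _ _ ((3 * M * N + N * (2 / del) * e) * (4 * (2 * r) * d))).
    by apply: ler_wpM2l; rewrite ?addr_ge0 ?mulr_ge0 ?invr_ge0 ?(ltW e0) ?(ltW del0).
  have -> : (3 * M * N + N * (2 / del) * e) * (4 * (2 * r) * d) =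
      24 * r * M * N * d + 32 * r * N * e by rewrite /del; field; rewrite gt_eqF.
  have MN : 0 <= r * M * N by rewrite !mulr_ge0 // ltW.
  have := ler_wpM2l MN de; have := mulr_ge0 MN (ltW e0); lra.
have densE y : flux_density (psi \* (fun x => 1 - chi x)) y =
    (1 - chi y) * flux_density psi y +
    psi y * (dstep (lin y) / del) * (F1 y * n.1 + F2 y * n.2).
  have [q1 q2] := d12M y Cpsi Ccc; have [c1 c2] := d12_compl y Cchi.
  by rewrite /flux_density q1 q2 c1 c2 dchi1 dchi2 /=; ring.
have out y : Om y -> ~ S y -> flux_density (psi \* (fun x => 1 - chi x)) y = 0.
  move=> Oy nS; have [xy|nxy] := pselect (ball x (2 * r) y); last first.
    have [p0 p1 p2] := vanish_out_ball rp psi0 nxy.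
    by rewrite densE /flux_density p0 p1 p2; ring.
  have xy0 : ball x r0 y by move: xy; apply: le_ball; exact: ltW.
  have yneg := iffLR (OmE _ xy0) Oy; rewrite dotBl in yneg.
  have yd : dot y n <= dot x n - d.
    rewrite leNgt; apply/negP => yd; apply: nS; split=> //=.
    by rewrite yd/= subrK -subr_lt0.
  have lin1 : 1 <= lin y.
    rewrite linE lerBrDr ler_pdivlMr// dotBl /del; lra.
  by rewrite densE /chi /= step_ge1// dstep_out; [ring|right].
have n0 : 0 <= N * (2 / del) * e by rewrite !mulr_ge0 ?invr_ge0 ?(ltW e0) ?(ltW del0).
have MN0 : 0 <= 3 * M * N by rewrite !mulr_ge0.
apply: Rintegral_support_bound; rewrite ?addr_ge0//.
- exact: flux_integrable (Ck1M Cpsi Ccc).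
move=> y Oy; have [Sy|nS] := pselect (S y); last by rewrite out// normr0 addr_ge0.
have [p0 p1 p2] := psiN _ Oy; have [xy /andP[y1 y2]] := Sy.
rewrite densE; apply: le_trans (ler_normD _ _) _; apply: lerD; rewrite normrM.
  have /andP[s0 s1] := step_bound (lin y).
  rewrite -[leRHS]mul1r; apply: ler_pM => //.
    by rewrite ger0_norm /chi /=; lra.
  exact: (density_bound N0 Oy p1 p2 p0).
apply: ler_pM => //; last first.
  by apply: ltW; apply: unif => //; [exact: xK2|rewrite dotBl; lra].
rewrite normrM; apply: ler_pM => //.
have /andP[s0 s2] := dstep_bound (lin y).
by rewrite normrM normfV (gtr0_norm del0) ger0_norm// ler_pM2r ?invr_gt0.
Qed.

(** The balls are removed one at a time by psi = psi b + psi (1 - b), where b is 1 on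
the ball: this replaces a partition of unity. *)
Lemma cover_flux0 (s : seq (X * R)) psi : (forall p, p \in s -> flux_good p.1 (2 * p.2)) ->
  Ck 1 psi -> (forall y, Om y -> psi y != 0 -> exists2 p, p \in s & ball p.1 p.2 y) ->
  flux psi = 0.
Proof.
elim: s psi => [|[z r] s IH] psi sgood Cpsi scover.
  apply: flux_zero => y Oy; apply/eqP; apply: contraT => /(scover _ Oy)[p].
  by rewrite in_nil.
have [r0 zgood] : flux_good z (2 * r) by apply: (sgood (z, r)); rewrite mem_head.
have rp : 0 < r by rewrite -(pmulr_rgt0 _ (ltr0n R 2)).
have [b [Cb b01 b1 bout _]] := bump_exists z rp.
rewrite (fluxM_compl Cpsi Cb) zgood; [|exact: Ck1M|]; last first.
  by move=> y /bout[bz _ _] /=; rewrite bz mulr0.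
rewrite add0r; apply: IH; [|exact: Ck1M Cpsi (Ck1_compl Cb)|].
  by move=> p ps; apply: sgood; rewrite inE ps orbT.
move=> y Oy /= pn0; have [p] := scover _ Oy (ltac:(by apply: contraNneq pn0 => ->; rewrite mul0r)).
rewrite inE => /orP[/eqP ->/= zy|ps py]; last by exists p.
by exfalso; move: pn0; rewrite b1// subrr mulr0 eqxx.
Qed.

Variable corners : seq X.
Hypothesis cornersP : forall x, boundary Om x -> x \notin corners -> exists n, outward_normal Om x n.

(** Outside the given neighbourhoods of the corners the closure of Om is compact
and consists of interior points and of half-plane boundary points. *)
Lemma flux_away_corners psi : Ck 1 psi ->
  (forall z, z \in corners -> exists2 r : R, 0 < r & forall y, ball z r y -> psi y = 0) ->
  flux psi = 0.
Proof.
move=> Cpsi vanish.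
pose V := [set y | exists2 z, z \in corners &
  exists2 r : R, 0 < r /\ (forall y, ball z r y -> psi y = 0) & ball z r y].
have oV : open V.
  rewrite openE => y [z zb [r [r0 pz] zy]].
  have : nbhs y (ball z r) by apply: open_nbhs_nbhs; split=> //; exact: ball_open.
  by apply: filterS => y' zy'; exists z => //; exists r.
pose K := closure Om `&` ~` V.
have cK : compact K.
  apply: (subclosed_compact _ compact_clOm) => [|y []//].
  by apply: closedI; [exact: closed_closure|exact: open_closedC].
have good x : exists r, K x -> flux_good x r.
  have [[clx nVx]|nK] := pselect (K x); last by exists 0.
  have [Ox|nO] := pselect (Om x).
    by have [r rg] := flux_good_interior Ox; exists r.
  have bx : boundary Om x by apply/boundary_open.
  have [n on] : exists n, outward_normal Om x n.
    apply: cornersP => //; apply/negP => xb; apply: nVx; exists x => //.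
    by have [r r0 pr] := vanish _ xb; exists r => //; exact: ballxx.
  by have [r rg] := flux_good_halfplane on; exists r.
have [rad radP] := choice good.
have [|D DK Dcov] := @finite_ball_cover R K (fun x => rad x / 2) cK.
  by move=> x Kx; rewrite divr_gt0//; case: (radP _ Kx).
apply: (@cover_flux0 [seq (x, rad x / 2) | x <- D]) => //.
- move=> p /mapP[x xD ->] /=; rewrite mulrC divfK//.
  exact: radP (DK _ xD).
- move=> y Oy pn0.
  have Ky : K y.
    split; first exact: subset_closure.
    by move=> [z zb [r [r0 pz] /pz py]]; rewrite py eqxx in pn0.
  have [x xD xy] := Dcov _ Ky.
  by exists (x, rad x / 2) => //; apply/mapP; exists x.
Qed.

(** A point has zero capacity for bounded fields: a cut-off of radius r has a
gradient of size 1/r on a square of area of order r^2. *)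
Lemma flux_near_corners (s : seq X) psi : Ck 1 psi ->
  (forall z, z \in corners -> z \notin s -> exists2 r : R, 0 < r & forall y, ball z r y -> psi y = 0) ->
  flux psi = 0.
Proof.
elim: s psi => [|z s IH] psi Cpsi vanish.
  by apply: flux_away_corners => // z zb; apply: vanish.
have [N N0 psiN] := Ck1_bounded Cpsi.
have C0 : 0 <= 432 * M * N.
  exact: mulr_ge0 (mulr_ge0 (ler0n R 432) M0) N0.
apply: (small_eq0 C0) => r r0 r1.
have [b [Cb b01 b1 bout db]] := bump_exists z r0.
have Cbc := Ck1_compl Cb.
rewrite (fluxM_compl Cpsi Cb) [X in _ + X]IH ?addr0; [|exact: Ck1M|]; last first.
  move=> y yb ys; have [->|yz] := eqVneq y z.
    by exists r => // y' /b1 b1'; rewrite /= b1' subrr mulr0.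
  have [|d d0 dP] := vanish _ yb; first by rewrite inE negb_or yz.
  by exists d => // y' /dP py; rewrite /= py mul0r.
have areaB : area (ball z (2 * r)) = ((16 * r * r))%:E.
  by rewrite area_ball ?mulr_ge0 ?ltW//; congr EFin; ring.
apply: (@le_trans _ _ ((27 * M * N / r) * fine (area (ball z (2 * r))))); last first.
  rewrite areaB/=; have -> : 27 * M * N / r * (16 * r * r) = 432 * M * N * r by field; rewrite gt_eqF.
  by [].
have ri : 1 <= r^-1 by rewrite -invr1 lef_pV2 ?posrE// ltW.
have densE y : flux_density (psi \* b) y =
    b y * flux_density psi y + psi y * (F1 y * d1 b y + F2 y * d2 b y).
  by have [q1 q2] := d12M y Cpsi Cb; rewrite /flux_density q1 q2 /=; ring.
have MN0 : 0 <= M * N by rewrite mulr_ge0.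
apply: Rintegral_support_bound => //.
- by apply: plane_open_measurable; exact: ball_open.
- by rewrite areaB ltry.
- exact: flux_integrable (Ck1M Cpsi Cb).
- by rewrite !mulr_ge0// invr_ge0 ltW.
- move=> y Oy; rewrite densE; have [p0 p1 p2] := psiN _ Oy.
  have [g1 g2] := db y; have /andP[h0 h1] := b01 y.
  have i1 : `|b y * flux_density psi y| <= 1 * (3 * M * N).
    rewrite normrM; apply: ler_pM => //; first by rewrite ger0_norm.
    exact: (density_bound N0 Oy p1 p2 p0).
  have j1 : `|F1 y * d1 b y| <= M * (8 / r) by rewrite normrM ler_pM// bF1.
  have j2 : `|F2 y * d2 b y| <= M * (8 / r) by rewrite normrM ler_pM// bF2.
  have i2 : `|psi y * (F1 y * d1 b y + F2 y * d2 b y)| <= N * (M * (8 / r) + M * (8 / r)).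
    by rewrite normrM ler_pM// (le_trans (ler_normD _ _))// lerD.
  apply: le_trans (ler_normD _ _) _; apply: le_trans (lerD i1 i2) _.
  have -> : 27 * M * N / r = 27 * (M * N) * r^-1 by ring.
  have -> : N * (M * (8 / r) + M * (8 / r)) = 16 * (M * N) * r^-1 by ring.
  have -> : 1 * (3 * M * N) = 3 * (M * N) by ring.
  by apply: absorb_le => //; have := ler_wpM2l MN0 ri; rewrite mulr1.
- by move=> y Oy /bout[bz d1z d2z]; rewrite densE bz d1z d2z !mulr0 !mul0r addr0 mulr0 addr0.
Qed.

(** The flux of the cut-off 1. *)
Theorem divergence_theorem0 : \int[area]_(x in Om) (d1 F1 x + d2 F2 x) = 0.
Proof.
rewrite -(@flux_near_corners corners (cst 1)).
- apply: eq_Rintegral => x _; rewrite /flux_density.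
  have z1 := derive_const x e1 (1 : R); have z2 := derive_const x e2 (1 : R).
  by rewrite {2}/d1 {2}/d2 !derive_val !mulr0 mul1r !add0r.
- exact: Ck1_cst.
- by move=> z ->.
Qed.

End Flux.

(** * Functions that are smooth up to the boundary *)

Section UpTo.
Context {R : realType}.
Local Notation X := (R * R)%type.
Variable Om : set X.
Hypotheses (oOm : open Om) (bOm : bounded_set Om).
Implicit Types (I J : set R) (k : nat).

Lemma cvg_withinI (T U : Type) (F : set_system T) {FF : Filter F} (G : set_system U)
    (A : set U) (f : T -> U) :
  f @ F --> G -> (\forall x \near F, A (f x)) -> f @ F --> within A G.
Proof.
move=> fG fA P nP; have := fG _ nP; apply: filterS2 fA => x Ax; exact.
Qed.

Lemma upto_ext (V : normedModType R) I (h k : R -> X -> V) : (forall t x, I t -> Om x -> h t x = k t x) ->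
  continuous_upto I Om h -> continuous_upto I Om k.
Proof.
by move=> hk [H cH Hh]; exists H => // t x It Ox; rewrite Hh// hk.
Qed.

Lemma upto_sub (V : normedModType R) I J (h : R -> X -> V) : J `<=` I ->
  continuous_upto I Om h -> continuous_upto J Om h.
Proof.
move=> JI [H cH Hh]; exists H => [|t x /JI]; last exact: Hh.
by apply: continuous_subspaceW cH => -[t x] [/= /JI It clx].
Qed.

Lemma upto_comp (V W : normedModType R) I (h : R -> X -> V) (f : V -> W) : continuous f ->
  continuous_upto I Om h -> continuous_upto I Om (fun t x => f (h t x)).
Proof.
move=> cf [H /subspace_continuousP cH Hh]; exists (f \o H) => [|t x It Ox]; last by rewrite /= Hh.
by apply/subspace_continuousP => z Az; apply: (cvg_comp H f (cH z Az)); exact: cf.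
Qed.

Lemma upto2 I (h k : R -> X -> R) (op : R -> R -> R) : continuous (fun z : R * R => op z.1 z.2) ->
  continuous_upto I Om h -> continuous_upto I Om k ->
  continuous_upto I Om (fun t x => op (h t x) (k t x)).
Proof.
move=> cop [H /subspace_continuousP cH Hh] [K /subspace_continuousP cK Kk].
exists (fun z => op (H z) (K z)); last first.
  by move=> t x It Ox; rewrite /= Hh// Kk.
apply/subspace_continuousP => z Az.
apply: (cvg_comp (fun z => (H z, K z)) (fun z : R * R => op z.1 z.2)); last exact: cop (H z, K z).
exact: (cvg_pair (cH z Az) (cK z Az)).
Qed.

Lemma uptoD I (h k : R -> X -> R) : continuous_upto I Om h -> continuous_upto I Om k ->
  continuous_upto I Om (fun t x => h t x + k t x).
Proof. by apply: (upto2 (op := +%R)) => z; apply: cvgD; [exact: cvg_fst|exact: cvg_snd]. Qed.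

Lemma uptoB I (h k : R -> X -> R) : continuous_upto I Om h -> continuous_upto I Om k ->
  continuous_upto I Om (fun t x => h t x - k t x).
Proof.
by apply: (upto2 (op := fun a b : R => a - b)) => z; apply: cvgB; [exact: cvg_fst|exact: cvg_snd].
Qed.

Lemma uptoM I (h k : R -> X -> R) : continuous_upto I Om h -> continuous_upto I Om k ->
  continuous_upto I Om (fun t x => h t x * k t x).
Proof. by apply: (upto2 (op := *%R)) => z; apply: cvgM; [exact: cvg_fst|exact: cvg_snd]. Qed.

Lemma upto_cst I (c : R) : continuous_upto I Om (fun _ _ => c).
Proof. by exists (fun _ => c) => // z; exact: cvg_cst. Qed.

Lemma uptoZ I (h : R -> X -> R) (c : R) : continuous_upto I Om h -> continuous_upto I Om (fun t x => c * h t x).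
Proof. by apply: uptoM; exact: upto_cst. Qed.

Lemma upto_fst I (u : R -> X -> X) : continuous_upto I Om u ->
  continuous_upto I Om (fun t x => (u t x).1).
Proof. by apply: upto_comp => z; exact: cvg_fst. Qed.

Lemma upto_snd I (u : R -> X -> X) : continuous_upto I Om u ->
  continuous_upto I Om (fun t x => (u t x).2).
Proof. by apply: upto_comp => z; exact: cvg_snd. Qed.

Lemma upto_bound I J (h : R -> X -> R) : compact J -> J `<=` I -> continuous_upto I Om h ->
  exists2 M : R, 0 <= M & forall t x, J t -> Om x -> `|h t x| <= M.
Proof.
move=> cJ JI /(upto_sub JI)[H cH Hh].
have cK : compact (J `*` closure Om).
  apply: compact_setX => //; apply: closed_bounded_compact; first exact: closed_closure.
  exact: bounded_closure.
have [M M0 HM] := compact_bound cK cH; exists M => // t x Jt Ox.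
by rewrite -Hh//; apply: HM; split=> //; exact: subset_closure.
Qed.

Lemma upto_continuous_x I (h : R -> X -> R) t x : continuous_upto I Om h -> I t -> Om x ->
  {for x, continuous (h t)}.
Proof.
move=> [H /subspace_continuousP cH Hh] It Ox.
have clx : (I `*` closure Om) (t, x) by split=> //; exact: subset_closure.
have nO := open_nbhs_nbhs (conj oOm Ox).
rewrite /prop_for /continuous_at -Hh//.
apply: (@cvg_trans _ (H (t, y) @[y --> x])).
  by apply: near_eq_cvg; move: nO; apply: filterS => y Oy; rewrite Hh.
apply: (cvg_comp (fun y => (t, y)) H _ (cH _ clx)).
apply: cvg_withinI; first exact: (cvg_pair (cvg_cst t) cvg_id).
by move: nO; apply: filterS => y Oy; split=> //; exact: subset_closure.
Qed.

Lemma upto_continuous_t I (h : R -> X -> R) t x : continuous_upto I Om h -> I t -> Om x ->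
  h s x @[s --> within I (nbhs t)] --> h t x.
Proof.
move=> [H /subspace_continuousP cH Hh] It Ox.
have clx : (I `*` closure Om) (t, x) by split=> //; exact: subset_closure.
rewrite -Hh//; apply: (@cvg_trans _ (H (s, x) @[s --> within I (nbhs t)])).
  by apply: near_eq_cvg; near=> s; rewrite Hh//; near: s; exact: withinT.
apply: (cvg_comp (fun s => (s, x)) H _ (cH _ clx)).
apply: cvg_withinI.
  have c1 : (fun s : R => s) @ within I (nbhs t) --> nbhs t by move=> A; exact: cvg_within.
  have c2 : (fun _ : R => x) @ within I (nbhs t) --> nbhs x by exact: cvg_cst.
  exact: (cvg_pair c1 c2).
by near=> s; split=> /=; [near: s; exact: withinT|exact: subset_closure].
Unshelve. all: by end_near. Qed.

Lemma CkU_upto (V : normedModType R) k I (h : R -> X -> V) : Ck_upto k I Om h -> continuous_upto I Om h.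
Proof. by case: k => [|k] []. Qed.

Lemma CkU_d1 (V : normedModType R) k I (h : R -> X -> V) : Ck_upto k.+1 I Om h ->
  Ck_upto k I Om (fun t => d1 (h t)).
Proof. by move=> [_ [_ []]]. Qed.

Lemma CkU_d2 (V : normedModType R) k I (h : R -> X -> V) : Ck_upto k.+1 I Om h ->
  Ck_upto k I Om (fun t => d2 (h t)).
Proof. by move=> [_ [_ []]]. Qed.

Lemma CkU_der1 (V : normedModType R) k I (h : R -> X -> V) t x : Ck_upto k.+1 I Om h ->
  I t -> Om x -> is_derive x e1 (h t) (d1 (h t) x).
Proof. by move=> [_ [dh _]] It Ox; apply/derivableP; exact: (dh t x It Ox).1. Qed.

Lemma CkU_der2 (V : normedModType R) k I (h : R -> X -> V) t x : Ck_upto k.+1 I Om h ->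
  I t -> Om x -> is_derive x e2 (h t) (d2 (h t) x).
Proof. by move=> [_ [dh _]] It Ox; apply/derivableP; exact: (dh t x It Ox).2. Qed.

Lemma CkU_le (V : normedModType R) k I (h : R -> X -> V) : Ck_upto k.+1 I Om h -> Ck_upto k I Om h.
Proof.
elim: k h => [|k IH] h [c [d [h1 h2]]]; first by split.
exact: (conj c (conj d (conj (IH _ h1) (IH _ h2)))).
Qed.

Lemma open_d_eqV (V : normedModType R) (f g : X -> V) x : (forall y, Om y -> f y = g y) ->
  Om x -> d1 f x = d1 g x /\ d2 f x = d2 g x.
Proof.
move=> fg Ox; have nO := open_nbhs_nbhs (conj oOm Ox).
by split; apply: near_eq_derive; move: nO; apply: filterS => y /fg.
Qed.

Lemma open_der_eqV (V : normedModType R) (f g : X -> V) x v df : (forall y, Om y -> f y = g y) ->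
  Om x -> is_derive x v f df -> is_derive x v g df.
Proof.
move=> fg Ox; have nO := open_nbhs_nbhs (conj oOm Ox).
by apply: near_eq_is_derive; move: nO; apply: filterS => y /fg.
Qed.

(** The hypothesis on congruent functions is the next lemma, which is itself proved
by induction with the help of this one. *)
Lemma CkU_intro (V : normedModType R) k I (h : R -> X -> V) (h1 h2 : R -> X -> V) : continuous_upto I Om h ->
  (forall t x, I t -> Om x -> is_derive x e1 (h t) (h1 t x)) ->
  (forall t x, I t -> Om x -> is_derive x e2 (h t) (h2 t x)) ->
  (Ck_upto k I Om h1) -> (Ck_upto k I Om h2) ->
  (forall (f g : R -> X -> V), (forall t x, I t -> Om x -> f t x = g t x) ->
     Ck_upto k I Om f -> Ck_upto k I Om g) -> Ck_upto k.+1 I Om h.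
Proof.
move=> ch D1 D2 C1 C2 ext; split=> //; split.
  by move=> t x It Ox; split; [case: (D1 t x It Ox)|case: (D2 t x It Ox)].
split; [apply: ext C1|apply: ext C2] => t x It Ox.
  by have d := D1 t x It Ox; rewrite /d1 derive_val.
by have d := D2 t x It Ox; rewrite /d2 derive_val.
Qed.

Lemma CkU_ext (V : normedModType R) k I (h g : R -> X -> V) : (forall t x, I t -> Om x -> h t x = g t x) ->
  Ck_upto k I Om h -> Ck_upto k I Om g.
Proof.
elim: k h g => [|k IH] h g hg Ch.
  by case: Ch => c _; split=> //; exact: upto_ext c.
apply: (@CkU_intro _ k I g (fun t => d1 (h t)) (fun t => d2 (h t))).
- by apply: upto_ext (CkU_upto Ch).
- move=> t x It Ox; apply: open_der_eqV (CkU_der1 Ch It Ox) => // y Oy; exact: hg.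
- move=> t x It Ox; apply: open_der_eqV (CkU_der2 Ch It Ox) => // y Oy; exact: hg.
- exact: CkU_d1.
- exact: CkU_d2.
- exact: IH.
Qed.

Lemma CkUI (V : normedModType R) k I (h : R -> X -> V) (h1 h2 : R -> X -> V) : continuous_upto I Om h ->
  (forall t x, I t -> Om x -> is_derive x e1 (h t) (h1 t x)) ->
  (forall t x, I t -> Om x -> is_derive x e2 (h t) (h2 t x)) ->
  Ck_upto k I Om h1 -> Ck_upto k I Om h2 -> Ck_upto k.+1 I Om h.
Proof. by move=> ? ? ? C1 C2; apply: (CkU_intro _ _ _ C1 C2) => //; exact: CkU_ext. Qed.

Lemma CkU_cst k I (c : R) : Ck_upto k I Om (fun _ _ => c).
Proof.
elim: k c => [|k IH] c; first by split=> //; exact: upto_cst.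
apply: (@CkUI _ k I _ (fun _ _ => 0) (fun _ _ => 0)).
- exact: upto_cst.
- exact: IH.
- exact: IH.
Qed.

Lemma CkUD k I (f g : R -> X -> R) : Ck_upto k I Om f -> Ck_upto k I Om g ->
  Ck_upto k I Om (fun t x => f t x + g t x).
Proof.
elim: k f g => [|k IH] f g Cf Cg.
  by split=> //; apply: uptoD; [exact: CkU_upto Cf|exact: CkU_upto Cg].
apply: (@CkUI _ k I _ (fun t x => d1 (f t) x + d1 (g t) x) (fun t x => d2 (f t) x + d2 (g t) x)).
- by apply: uptoD; [exact: CkU_upto Cf|exact: CkU_upto Cg].
- by move=> t x It Ox; exact: derive_add (CkU_der1 Cf It Ox) (CkU_der1 Cg It Ox).
- by move=> t x It Ox; exact: derive_add (CkU_der2 Cf It Ox) (CkU_der2 Cg It Ox).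
- by apply: IH; exact: CkU_d1.
- by apply: IH; exact: CkU_d2.
Qed.

Lemma CkUM k I (f g : R -> X -> R) : Ck_upto k I Om f -> Ck_upto k I Om g ->
  Ck_upto k I Om (fun t x => f t x * g t x).
Proof.
elim: k f g => [|k IH] f g Cf Cg.
  by split=> //; apply: uptoM; [exact: CkU_upto Cf|exact: CkU_upto Cg].
apply: (@CkUI _ k I _ (fun t x => f t x * d1 (g t) x + g t x * d1 (f t) x)
   (fun t x => f t x * d2 (g t) x + g t x * d2 (f t) x)).
- by apply: uptoM; [exact: CkU_upto Cf|exact: CkU_upto Cg].
- by move=> t x It Ox; exact: derive_mul (CkU_der1 Cf It Ox) (CkU_der1 Cg It Ox).
- by move=> t x It Ox; exact: derive_mul (CkU_der2 Cf It Ox) (CkU_der2 Cg It Ox).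
- by apply: CkUD; apply: IH; [exact: CkU_le|exact: CkU_d1|exact: CkU_le|exact: CkU_d1].
- by apply: CkUD; apply: IH; [exact: CkU_le|exact: CkU_d2|exact: CkU_le|exact: CkU_d2].
Qed.

Lemma CkUZ k I (c : R) (f : R -> X -> R) : Ck_upto k I Om f -> Ck_upto k I Om (fun t x => c * f t x).
Proof. by apply: CkUM; exact: CkU_cst. Qed.

Lemma CkUB k I (f g : R -> X -> R) : Ck_upto k I Om f -> Ck_upto k I Om g ->
  Ck_upto k I Om (fun t x => f t x - g t x).
Proof.
move=> Cf Cg; apply: CkU_ext (CkUD Cf (CkUZ (-1) Cg)) => t x _ _.
by rewrite mulN1r.
Qed.

Lemma is_derive_fst (V : normedModType R) (f : V -> X) (a v : V) df : is_derive a v f df ->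
  is_derive a v (fun y => (f y).1) df.1.
Proof.
move=> -[/cvg_ex[l fl] <-]; rewrite /derive (cvg_lim _ fl)//.
have fl1 : h^-1 *: (((fun y => (f y).1) \o shift a) (h *: v) - (f a).1) @[h --> 0^'] --> l.1.
  exact: (cvg_comp _ fst fl (@cvg_fst _ _ _ _ _)).
by split; [apply/cvg_ex; exists l.1|exact: cvg_lim].
Qed.

Lemma is_derive_snd (V : normedModType R) (f : V -> X) (a v : V) df : is_derive a v f df ->
  is_derive a v (fun y => (f y).2) df.2.
Proof.
move=> -[/cvg_ex[l fl] <-]; rewrite /derive (cvg_lim _ fl)//.
have fl1 : h^-1 *: (((fun y => (f y).2) \o shift a) (h *: v) - (f a).2) @[h --> 0^'] --> l.2.
  exact: (cvg_comp _ snd fl (@cvg_snd _ _ _ _ _)).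
by split; [apply/cvg_ex; exists l.2|exact: cvg_lim].
Qed.

Lemma CkU_fst k I (u : R -> X -> X) : Ck_upto k I Om u -> Ck_upto k I Om (fun t x => (u t x).1).
Proof.
elim: k u => [|k IH] u Cu; first by split=> //; apply: upto_fst; exact: CkU_upto Cu.
apply: (@CkUI _ k I _ (fun t x => (d1 (u t) x).1) (fun t x => (d2 (u t) x).1)).
- by apply: upto_fst; exact: CkU_upto Cu.
- by move=> t x It Ox; exact: is_derive_fst (CkU_der1 Cu It Ox).
- by move=> t x It Ox; exact: is_derive_fst (CkU_der2 Cu It Ox).
- by apply: IH; exact: CkU_d1.
- by apply: IH; exact: CkU_d2.
Qed.

Lemma CkU_snd k I (u : R -> X -> X) : Ck_upto k I Om u -> Ck_upto k I Om (fun t x => (u t x).2).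
Proof.
elim: k u => [|k IH] u Cu; first by split=> //; apply: upto_snd; exact: CkU_upto Cu.
apply: (@CkUI _ k I _ (fun t x => (d1 (u t) x).2) (fun t x => (d2 (u t) x).2)).
- by apply: upto_snd; exact: CkU_upto Cu.
- by move=> t x It Ox; exact: is_derive_snd (CkU_der1 Cu It Ox).
- by move=> t x It Ox; exact: is_derive_snd (CkU_der2 Cu It Ox).
- by apply: IH; exact: CkU_d1.
- by apply: IH; exact: CkU_d2.
Qed.

Lemma CkU_lap k I (f : R -> X -> R) : Ck_upto k.+2 I Om f ->
  Ck_upto k I Om (fun t => laplacian (f t)).
Proof.
move=> C; apply: CkUD; first exact: CkU_d1 (CkU_d1 C).
exact: CkU_d2 (CkU_d2 C).
Qed.

Lemma CkU_potential k I (f : R -> X -> R) : Ck_upto k I Om f ->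
  Ck_upto k I Om (fun t x => potential (f t x)).
Proof.
move=> C; have q := CkUB (CkUM C C) (CkU_cst k I (1 : R)).
apply: CkU_ext (CkUZ (4^-1) (CkUM q q)) => t x _ _.
by rewrite /potential; field.
Qed.

Lemma CkU_potential' k I (f : R -> X -> R) : Ck_upto k I Om f ->
  Ck_upto k I Om (fun t x => potential' (f t x)).
Proof.
move=> C; apply: CkU_ext (CkUB (CkUM C (CkUM C C)) C) => t x _ _.
by rewrite /potential'; ring.
Qed.

End UpTo.

(** * Integrals that depend on time *)

Section TimeDependence.
Context {R : realType}.
Local Opaque Ck Rintegral area.
Local Notation X := (R * R)%type.
Local Notation bR := (measurableTypeR R).
Variable Om : set X.
Hypotheses (oOm : open Om) (bOm : bounded_set Om).

Let mOm : measurable (Om : set (bR * bR)) := plane_open_measurable oOm.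

Lemma integrable_cst_Om (c : R) : area.-integrable (Om : set (bR * bR)) (EFin \o cst c).
Proof.
apply: (plane_integrable oOm bOm (M := `|c|)) => x Ox; last exact: lexx.
exact: cvg_cst.
Qed.

Lemma Rintegral_cvg (f_ : nat -> X -> R) (f : X -> R) (M : R) :
  (forall n x, Om x -> {for x, continuous (f_ n)}) ->
  (forall x, Om x -> {for x, continuous f}) ->
  (forall n x, Om x -> `|f_ n x| <= M) ->
  (forall x, Om x -> f_ n x @[n --> \oo] --> f x) ->
  \int[area]_(x in Om) f_ n x @[n --> \oo] --> \int[area]_(x in Om) f x.
Proof.
move=> cf_ cf fM f_f.
have fM' x : Om x -> `|f x| <= M.
  move=> Ox; have fx : `|f_ n x| @[n --> \oo] --> `|f x| by apply: cvg_norm; exact: f_f.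
  by rewrite -(cvg_lim _ fx)//; apply: limr_le; [apply/cvg_ex; exists (`|f x|)|apply: nearW => n; exact: fM].
have intf := plane_integrable oOm bOm cf fM'.
apply: fine_cvg; rewrite fineK; last exact: integrable_fin_num.
apply: (@dominated_cvg _ _ _ area Om mOm (fun n x => (f_ n x)%:E) (fun x => (f x)%:E) (fun x => M%:E)).
- move=> n; apply/measurable_EFinP; apply: plane_continuous_measurable => // x Ox.
  exact: cf_.
- by move=> x Ox; apply: cvg_EFin; [exact: nearW|exact: f_f].
- by [].
- exact: integrable_cst_Om.
- by move=> n x Ox; rewrite lee_fin; exact: fM.
Qed.

(** Composition with the retraction of R onto [c, d] extends a function of time to
the whole line, so that continuity at the end points is no special case. *)
Definition clamp (c d s : R) : R := Num.max c (Num.min d s).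

Lemma clamp_continuous (c d : R) : continuous (clamp c d).
Proof.
have -> : clamp c d = (fun s => c + Num.max 0 (d - c - Num.max 0 (d - s))).
  apply/funext => s; rewrite /clamp [in RHS]addrAC oppr_max oppr0 opprB addr_minr addr0 [d + _]addrC subrK.
  by rewrite addr_maxr addr0 [c + _]addrC subrK.
move=> s; apply: cvgD; first exact: cvg_cst.
apply: (@continuous_comp _ _ _ (fun s => d - c - Num.max 0 (d - s)) (fun s => Num.max 0 s));
  last exact: continuous_maxr0.
apply: cvgB; first exact: cvg_cst.
apply: (@continuous_comp _ _ _ (fun s => d - s) (fun s => Num.max 0 s)); last exact: continuous_maxr0.
by apply: cvgB; [exact: cvg_cst|exact: cvg_id].
Qed.

Lemma clamp_in (c d s : R) : c <= d -> `[c, d]%classic (clamp c d s).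
Proof. by move=> cd; rewrite /= in_itv/= /clamp le_max lexx/= ge_max cd/= ge_min lexx. Qed.

Lemma clamp_id (c d s : R) : `[c, d]%classic s -> clamp c d s = s.
Proof. by rewrite /= in_itv/= => /andP[cs sd]; rewrite /clamp min_r// max_r. Qed.

Lemma upto_clamp (c d : R) (h : R -> X -> R) : c <= d -> continuous_upto `[c, d] Om h ->
  continuous_upto setT Om (fun s => h (clamp c d s)).
Proof.
move=> cd [H /subspace_continuousP cH Hh].
exists (fun z => H (clamp c d z.1, z.2)) => [|t x _ Ox]; last first.
  by rewrite /= Hh//; exact: clamp_in.
apply/subspace_continuousP => z [_ clz].
have zA : (`[c, d] `*` closure Om) (clamp c d z.1, z.2) by split=> //; exact: clamp_in.
apply: (cvg_comp (fun z => (clamp c d z.1, z.2)) H _ (cH _ zA)).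
apply: cvg_withinI.
  have c1 : clamp c d y.1 @[y --> within (setT `*` closure Om) (nbhs z)] --> clamp c d z.1.
    apply: cvg_within_filter.
    apply: (@continuous_comp _ _ _ fst (clamp c d)); [exact: cvg_fst|exact: clamp_continuous].
  have c2 : y.2 @[y --> within (setT `*` closure Om) (nbhs z)] --> z.2.
    by apply: cvg_within_filter; exact: cvg_snd.
  exact: (cvg_pair c1 c2).
near=> y; split; first exact: clamp_in.
suff [] : (setT `*` closure Om) y by [].
by near: y; exact: withinT.
Unshelve. all: by end_near. Qed.

Lemma param_continuousT (h : R -> X -> R) : continuous_upto setT Om h ->
  continuous (fun s => \int[area]_(x in Om) h s x).
Proof.
move=> ch t.
have [M M0 hM] : exists2 M : R, 0 <= M & forall s x, `[t - 1, t + 1]%classic s -> Om x -> `|h s x| <= M.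
  exact: (upto_bound bOm (segment_compact (a := t - 1) (b := t + 1)) (@subsetT _ _) ch).
have cx s x : Om x -> {for x, continuous (h s)} by move=> Ox; exact: upto_continuous_x ch I Ox.
apply: (@continuity_under_integral R _ _ area h Om mOm (t - 1) (t + 1) _ _ (fun=> M)).
- move=> s ts; apply: (plane_integrable oOm bOm (M := M)) => x Ox; first exact: cx.
  by apply: hM => //; exact: subset_itv_oo_cc.
- apply: aeW => x Ox s _ A; have /= := @upto_continuous_t _ _ setT h s x ch I Ox A.
  by rewrite withinET.
- exact: integrable_cst_Om.
- by move=> s ts; apply: aeW => x Ox; apply: hM => //; exact: subset_itv_oo_cc.
- by apply/mem_set; rewrite /= in_itv/=; lra.
Qed.

Lemma param_continuous (c d : R) (h : R -> X -> R) : c <= d -> continuous_upto `[c, d] Om h ->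
  {within `[c, d], continuous (fun s => \int[area]_(x in Om) h s x)}.
Proof.
move=> cd ch; have cc := param_continuousT (upto_clamp cd ch).
apply: (@subspace_eq_continuous _ _ _ (fun s => \int[area]_(x in Om) h (clamp c d s) x)).
  by move=> s /set_mem scd; rewrite clamp_id.
exact: continuous_subspaceT.
Qed.

Lemma lipschitz_derive (g g' : R -> R) (c d M : R) :
  (forall s, c < s < d -> is_derive s (1 : R) g (g' s)) ->
  (forall s, c < s < d -> `|g' s| <= M) ->
  forall s t, c < s < d -> c < t < d -> `|g s - g t| <= M * `|s - t|.
Proof.
move=> dg gM.
have main s t : c < s -> s < t -> t < d -> `|g t - g s| <= M * `|t - s|.
  move=> cs st td.
  have inI r : r \in `[s, t] -> c < r < d by rewrite in_itv/=; lra.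
  have [||r rst ->] := @MVT R g g' s t st.
  - by move=> r rst; apply: dg; apply: inI; exact: subset_itv_oo_cc.
  - apply: derivable_within_continuous => r rst.
    by case: (dg _ (inI _ rst)).
  rewrite normrM; apply: ler_wpM2r => //; apply: gM; apply: inI.
  exact: subset_itv_oo_cc.
move=> s t /andP[cs sd] /andP[ct td]; have [st|st|->] := ltgtP s t.
- by rewrite distrC [`|s - t|]distrC; exact: main.
- exact: main.
- by rewrite !subrr normr0 mulr0.
Qed.

Lemma dnbhs_shift (t : R) : h + t @[h --> (0 : R)^'] --> t^'.
Proof.
move=> A [e /= e0 eA]; exists e => // h /=; rewrite sub0r normrN => he h0.
apply: eA => /=; last by rewrite -subr_eq0 addrK.
by rewrite opprD addrCA subrr addr0 normrN.
Qed.

(** Differentiation under the integral sign for a quantity whose increments are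
integrals of products (a s - a t) (b s + b t): only the first factor has to be
differentiable. *)
Lemma derive_pairing (P : R -> R) (a a' b : R -> X -> R) (c d t M : R) : c < t < d ->
  (forall s, c < s < d -> P s - P t = \int[area]_(x in Om) ((a s x - a t x) * (b s x + b t x))) ->
  (forall s x, c < s < d -> Om x -> is_derive s (1 : R) (a ^~ x) (a' s x)) ->
  (forall s x, c < s < d -> Om x -> `|a' s x| <= M) ->
  (forall s x, c < s < d -> Om x -> `|b s x| <= M) ->
  (forall s x, c < s < d -> Om x -> {for x, continuous (a s)}) ->
  (forall s x, c < s < d -> Om x -> {for x, continuous (b s)}) ->
  (forall x, Om x -> {for x, continuous (a' t)}) ->
  (forall x, Om x -> {for t, continuous (b ^~ x)}) ->
  is_derive t (1 : R) P (\int[area]_(x in Om) (a' t x * (2 * b t x))).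
Proof.
move=> tcd PE da a'M bM ca cb ca' cbt.
have M0 x : Om x -> 0 <= M by move=> Ox; apply: le_trans (a'M _ _ tcd Ox).
set L := \int[area]_(x in Om) _.
suff lim : (s - t)^-1 * (P s - P t) @[s --> t^'] --> L.
  have lim0 : h^-1 *: ((P \o shift t) (h *: (1 : R)) - P t) @[h --> (0 : R)^'] --> L.
    rewrite (_ : (fun h => _) = (fun s => (s - t)^-1 * (P s - P t)) \o (fun h : R => h + t)); last first.
      by apply/funext => h; rewrite /= addrK [h *: _]mulr1.
    exact: (cvg_comp _ _ (@dnbhs_shift t) lim).
  by split; [apply/cvg_ex; exists L|exact: cvg_lim].
apply/cvgr_dnbhsP => u [ut u_t].
(* Only the tail of the sequence lies in ]c, d[, where the bounds hold. *)
have [N Ncd] : exists N : nat, forall n, c < u (n + N)%N < d.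
  have /cvgr_lt/(_ d) h1 := u_t; have /cvgr_gt/(_ c) h2 := u_t.
  have [ct td] := andP tcd.
  have [N1 _ N1P] := h1 td; have [N2 _ N2P] := h2 ct.
  exists (N1 + N2)%N => n; apply/andP; split; [apply: N2P|apply: N1P] => /=.
    by rewrite addnA leq_addl.
  by rewrite addnCA leq_addr.
rewrite -(cvg_shiftn N) /=.
pose q n x := (u (n + N)%N - t)^-1 * ((a (u (n + N)%N) x - a t x) * (b (u (n + N)%N) x + b t x)).
have qc n x : Om x -> {for x, continuous (q n)}.
  move=> Ox; apply: cvgM; first exact: cvg_cst.
  by apply: cvgM; [apply: cvgB; exact: ca|apply: cvgD; exact: cb].
have aL s x : c < s < d -> Om x -> `|a s x - a t x| <= M * `|s - t|.
  move=> scd Ox; apply: (@lipschitz_derive (a ^~ x) (a' ^~ x) c d M) => // r rcd; first exact: da.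
  exact: a'M.
have un0 n : u n - t != 0 by rewrite subr_eq0.
have qM n x : Om x -> `|q n x| <= M * (M + M).
  move=> Ox; rewrite /q normrM normfV mulrC ler_pdivrMr ?normr_gt0// normrM mulrAC.
  apply: ler_pM => //; first exact: aL.
  by rewrite (le_trans (ler_normD _ _))// lerD// bM.
have -> : (fun n => (u (n + N)%N - t)^-1 * (P (u (n + N)%N) - P t)) = (fun n => \int[area]_(x in Om) q n x).
  apply/funext => n; rewrite PE// -RintegralZl//.
  apply: (plane_integrable oOm bOm (M := M * `|u (n + N)%N - t| * (M + M))) => x Ox.
    by apply: cvgM; [apply: cvgB; exact: ca|apply: cvgD; exact: cb].
  rewrite normrM; apply: ler_pM => //; first exact: aL.
  by rewrite (le_trans (ler_normD _ _))// lerD// bM.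
apply: (Rintegral_cvg qc _ qM) => x Ox.
  by apply: cvgM; [exact: ca'|apply: cvgM; [exact: cvg_cst|exact: cb]].
rewrite /q; under eq_fun do rewrite mulrA.
apply: cvgM; last first.
  rewrite mulr_natl mulr2n; apply: cvgD; last exact: cvg_cst.
  have := cbt x Ox; rewrite /prop_for /continuous_at => /(@cvg_nbhsP R^o R^o); apply.
  by rewrite (cvg_shiftn N).
have [/cvg_ex[l al] dal] := da t x tcd Ox.
have la : l = a' t x by rewrite -dal; apply/esym/cvg_lim.
have /cvgr_dnbhsP := al => /(_ (fun n => u (n + N)%N - t)); rewrite la.
have -> : (fun n => (u (n + N)%N - t)^-1 *: (((a ^~ x) \o shift t) ((u (n + N)%N - t) *: (1 : R)) - a t x)) =
   (fun n => (u (n + N)%N - t)^-1 * (a (u (n + N)%N) x - a t x)).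
  by apply/funext => n; rewrite /= [_ *: (1 : R)]mulr1 subrK.
apply; split=> [n|]; first exact: un0.
by apply/subr_cvg0; rewrite (cvg_shiftn N).
Qed.

Lemma dt_filter_interior (T t : R) : 0 < t < T -> dt_filter T t = t^'.
Proof.
move=> tT; rewrite /dt_filter; apply/seteqP; split=> P; last exact: cvg_within.
have [t0 tT'] := andP tT.
move=> nP; have nt : \forall s \near t^', `]0, T]%classic s.
  apply: nbhs_dnbhs; near=> s; rewrite /= in_itv/=.
  by apply/andP; split; [near: s; exact: (lt_nbhsr t0)|apply: ltW; near: s; exact: (lt_nbhsl tT')].
near=> s; have h1 : `]0, T]%classic s by near: s.
have h2 : `]0, T]%classic s -> P s by near: s; exact: nP.
exact: h2 h1.
Unshelve. all: by end_near. Qed.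

Lemma dtE (V : normedModType R) (T : R) (h : R -> X -> V) t x : 0 < t < T ->
  dt T h t x = lim (dt_quotient h x t @ t^').
Proof. by move=> tT; rewrite -(dt_filter_interior tT). Qed.

Lemma derivable_t_cvg (V : normedModType R) (T : R) (h : R -> X -> V) t x : 0 < t < T ->
  derivable_t T h t x -> exists l : V, dt_quotient h x t @ t^' --> l.
Proof. by move=> tT; rewrite -(dt_filter_interior tT) => /cvg_ex. Qed.

Lemma quotient_is_derive (h : R -> X -> R) t x (l : R) : dt_quotient h x t @ t^' --> l ->
  is_derive t (1 : R) (h ^~ x) l.
Proof.
move=> hl.
have lim0 : r^-1 *: (((h ^~ x) \o shift t) (r *: (1 : R)) - h t x) @[r --> (0 : R)^'] --> l.
  rewrite (_ : (fun r : R => r^-1 *: (((h ^~ x) \o shift t) (r *: (1 : R)) - h t x)) =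
    (dt_quotient h x t) \o (fun r : R => r + t)); last first.
    by apply/funext => r; rewrite /= /dt_quotient addrK [r *: (1 : R)]mulr1.
  exact: (cvg_comp _ _ (@dnbhs_shift t) hl).
by split; [apply/cvg_ex; exists l|exact: cvg_lim].
Qed.

Lemma dt_is_derive (T : R) (h : R -> X -> R) t x : 0 < t < T -> derivable_t T h t x ->
  is_derive t (1 : R) (h ^~ x) (dt T h t x).
Proof.
move=> tT /(derivable_t_cvg tT)[l hl].
by rewrite (dtE _ _ tT) (cvg_lim _ hl)//; exact: quotient_is_derive.
Qed.

Lemma dt_fst (T : R) (u : R -> X -> X) t x : 0 < t < T -> derivable_t T u t x ->
  is_derive t (1 : R) (fun s => (u s x).1) (dt T u t x).1.
Proof.
move=> tT /(derivable_t_cvg tT)[l ul].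
rewrite (dtE _ _ tT) (cvg_lim _ ul)//; apply: (@quotient_is_derive (fun s y => (u s y).1)).
exact: (cvg_comp _ fst ul (@cvg_fst _ _ _ _ _)).
Qed.

Lemma dt_snd (T : R) (u : R -> X -> X) t x : 0 < t < T -> derivable_t T u t x ->
  is_derive t (1 : R) (fun s => (u s x).2) (dt T u t x).2.
Proof.
move=> tT /(derivable_t_cvg tT)[l ul].
rewrite (dtE _ _ tT) (cvg_lim _ ul)//; apply: (@quotient_is_derive (fun s y => (u s y).2)).
exact: (cvg_comp _ snd ul (@cvg_snd _ _ _ _ _)).
Qed.

End TimeDependence.

(** * The energy balance at a fixed time *)

Section Space.
Context {R : realType}.
Local Opaque Ck Rintegral area.
Local Notation X := (R * R)%type.
Local Notation bR := (measurableTypeR R).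
Variable Om : set X.
Hypotheses (oOm : open Om) (bOm : bounded_set Om).
Variable corners : seq X.
Hypothesis cornersP : forall x, boundary Om x -> x \notin corners -> exists n, outward_normal Om x n.
Implicit Types (f g a : X -> R) (k : nat).

Let mOm : measurable (Om : set (bR * bR)) := plane_open_measurable oOm.

(** Functions of the position alone are those that do not depend on time: the
calculus of the previous part applies to them. *)
Definition CkS k f : Prop := Ck_upto k [set: R] Om (fun=> f).
Definition cS f : Prop := continuous_upto [set: R] Om (fun=> f).

Lemma cS_at I (h : R -> X -> R) t : continuous_upto I Om h -> I t -> cS (h t).
Proof.
move=> [H /subspace_continuousP cH Hh] It.
exists (fun z => H (t, z.2)) => [|s x _ Ox]; last by rewrite /= Hh.
apply/subspace_continuousP => z [_ clz].
have zA : (I `*` closure Om) (t, z.2) by split.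
apply: (cvg_comp (fun z => (t, z.2)) H _ (cH _ zA)).
apply: cvg_withinI.
  have c1 : (fun _ : R * X => t) @ within (setT `*` closure Om) (nbhs z) --> nbhs t by exact: cvg_cst.
  have c2 : y.2 @[y --> within (setT `*` closure Om) (nbhs z)] --> z.2.
    by apply: cvg_within_filter; exact: cvg_snd.
  exact: (cvg_pair c1 c2).
near=> y; split=> //.
suff [] : (setT `*` closure Om) y by [].
by near: y; exact: withinT.
Unshelve. all: by end_near. Qed.

Lemma CkS_at k I (h : R -> X -> R) t : Ck_upto k I Om h -> I t -> CkS k (h t).
Proof.
move=> + It; elim: k h => [|k IH] h; first by move=> [c _]; split=> //; exact: (cS_at c It).
move=> [c [d [h1 h2]]]; split; first exact: (cS_at c It).
split; first by move=> _ x _; exact: d.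
by split; [exact: IH h1|exact: IH h2].
Qed.

Lemma CkS_cS k f : CkS k f -> cS f. Proof. exact: CkU_upto. Qed.
Lemma CkS_d1 k f : CkS k.+1 f -> CkS k (d1 f). Proof. exact: CkU_d1. Qed.
Lemma CkS_d2 k f : CkS k.+1 f -> CkS k (d2 f). Proof. exact: CkU_d2. Qed.
Lemma CkS_le k f : CkS k.+1 f -> CkS k f. Proof. exact: CkU_le. Qed.
Lemma CkS_der1 k f x : CkS k.+1 f -> Om x -> is_derive x e1 f (d1 f x).
Proof. by move=> Cf; exact: (CkU_der1 (t := 0) Cf I). Qed.
Lemma CkS_der2 k f x : CkS k.+1 f -> Om x -> is_derive x e2 f (d2 f x).
Proof. by move=> Cf; exact: (CkU_der2 (t := 0) Cf I). Qed.
Lemma CkS_D k f g : CkS k f -> CkS k g -> CkS k (fun x => f x + g x).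
Proof. exact: CkUD. Qed.
Lemma CkS_B k f g : CkS k f -> CkS k g -> CkS k (fun x => f x - g x).
Proof. exact: CkUB. Qed.
Lemma CkS_M k f g : CkS k f -> CkS k g -> CkS k (fun x => f x * g x).
Proof. exact: CkUM. Qed.
Lemma CkS_Z k (c : R) f : CkS k f -> CkS k (fun x => c * f x).
Proof. exact: CkUZ. Qed.
Lemma CkS_cst k (c : R) : CkS k (fun=> c). Proof. exact: CkU_cst. Qed.
Lemma cS_D f g : cS f -> cS g -> cS (fun x => f x + g x). Proof. exact: uptoD. Qed.
Lemma cS_B f g : cS f -> cS g -> cS (fun x => f x - g x). Proof. exact: uptoB. Qed.
Lemma cS_M f g : cS f -> cS g -> cS (fun x => f x * g x). Proof. exact: uptoM. Qed.
Lemma cS_Z (c : R) f : cS f -> cS (fun x => c * f x). Proof. exact: uptoZ. Qed.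
Lemma cS_cst (c : R) : cS (fun=> c). Proof. exact: upto_cst. Qed.
Lemma cS_continuous f x : cS f -> Om x -> {for x, continuous f}.
Proof. by move=> cf Ox; exact: (upto_continuous_x (t := 0) oOm cf I Ox). Qed.

Lemma cS_bound f : cS f -> exists2 M : R, 0 <= M & forall x, Om x -> `|f x| <= M.
Proof.
move=> cf; have [M M0 fM] := upto_bound bOm (@compact_set1 R 0) (@subsetT _ _) cf.
by exists M => // x Ox; exact: (fM 0).
Qed.

Lemma cS_integrable f : cS f -> area.-integrable (Om : set (bR * bR)) (EFin \o f).
Proof.
move=> cf; have [M M0 fM] := cS_bound cf.
by apply: (plane_integrable oOm bOm (M := M)) => // x Ox; exact: cS_continuous.
Qed.

Lemma intD f g : cS f -> cS g ->
  \int[area]_(x in Om) (f x + g x) = \int[area]_(x in Om) f x + \int[area]_(x in Om) g x.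
Proof. by move=> cf cg; apply: RintegralD; [exact: mOm|exact: cS_integrable|exact: cS_integrable]. Qed.

Lemma intB f g : cS f -> cS g ->
  \int[area]_(x in Om) (f x - g x) = \int[area]_(x in Om) f x - \int[area]_(x in Om) g x.
Proof. by move=> cf cg; apply: RintegralB; [exact: mOm|exact: cS_integrable|exact: cS_integrable]. Qed.

Lemma intZ (c : R) f : cS f -> \int[area]_(x in Om) (c * f x) = c * \int[area]_(x in Om) f x.
Proof. by move=> cf; apply: RintegralZl; [exact: mOm|exact: cS_integrable]. Qed.

Lemma eq_int f g : (forall x, Om x -> f x = g x) ->
  \int[area]_(x in Om) f x = \int[area]_(x in Om) g x.
Proof. by move=> fg; apply: eq_Rintegral => x /set_mem; exact: fg. Qed.

Lemma CkS_lap k (phi : X -> R) : CkS k.+2 phi -> CkS k (laplacian phi).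
Proof. exact: CkU_lap. Qed.

Lemma CkS_potential' k (phi : X -> R) : CkS k phi -> CkS k (fun x => potential' (phi x)).
Proof. exact: CkU_potential'. Qed.

Lemma CkS_potential k (phi : X -> R) : CkS k phi -> CkS k (fun x => potential (phi x)).
Proof. exact: CkU_potential. Qed.

Lemma trace_ext f g x (l : R) : (forall x, Om x -> f x = g x) -> trace_at Om f x l -> trace_at Om g x l.
Proof.
move=> fg; apply: cvg_trans; apply: near_eq_cvg; near=> y; rewrite fg//.
by near: y; exact: withinT.
Unshelve. all: by end_near. Qed.

Lemma trace_add f g x (l m : R) : trace_at Om f x l -> trace_at Om g x m ->
  trace_at Om (fun y => f y + g y) x (l + m).
Proof. by move=> fl gm; apply: cvgD. Qed.

Lemma trace_bounded_mul f g x (M : R) : (forall x, Om x -> `|f x| <= M) -> trace_at Om g x 0 ->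
  trace_at Om (fun y => f y * g y) x 0.
Proof.
move=> fM /cvgrPdist_lt g0; apply/cvgrPdist_lt => e e0.
have M1 : 0 < `|M| + 1 by rewrite ltr_wpDl.
have ne := g0 _ (divr_gt0 e0 M1).
near=> y.
have Oy : Om y by near: y; exact: withinT.
have : `|0 - g y| < e / (`|M| + 1) by near: y; exact: ne.
rewrite !sub0r !normrN normrM ltr_pdivlMr// mulrC; apply: le_lt_trans.
apply: ler_wpM2r => //; apply: le_trans (fM _ Oy) _.
by rewrite (le_trans (ler_norm _))// lerDl.
Unshelve. all: by end_near. Qed.

Lemma d1_val f x df : is_derive x e1 f df -> d1 f x = df.
Proof. by move=> d; rewrite /d1 derive_val. Qed.
Lemma d2_val f x df : is_derive x e2 f df -> d2 f x = df.
Proof. by move=> d; rewrite /d2 derive_val. Qed.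

Local Opaque CkS cS d1 d2 trace_at.

(** Green's formula; at each regular boundary point either the scalar factor or the
normal component of the field has to vanish. *)
Lemma green f a1 a2 : CkS 1 f -> CkS 1 a1 -> CkS 1 a2 ->
  (forall x (n : X), boundary Om x -> outward_normal Om x n ->
     trace_at Om f x 0 \/ trace_at Om (fun y => a1 y * n.1 + a2 y * n.2) x 0) ->
  \int[area]_(x in Om) (f x * (d1 a1 x + d2 a2 x)) =
  - \int[area]_(x in Om) (d1 f x * a1 x + d2 f x * a2 x).
Proof.
move=> Cf C1 C2 tr.
have V1 := CkS_M Cf C1; have V2 := CkS_M Cf C2.
have D1 x : Om x -> d1 (fun x => f x * a1 x) x = f x * d1 a1 x + a1 x * d1 f x.
  move=> Ox; exact: d1_val (derive_mul (CkS_der1 Cf Ox) (CkS_der1 C1 Ox)).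
have D2 x : Om x -> d2 (fun x => f x * a2 x) x = f x * d2 a2 x + a2 x * d2 f x.
  move=> Ox; exact: d2_val (derive_mul (CkS_der2 Cf Ox) (CkS_der2 C2 Ox)).
have [M1 M10 b1] := cS_bound (CkS_cS V1); have [M2 M20 b2] := cS_bound (CkS_cS V2).
have c1 := CkS_cS (CkS_d1 V1); have c2 := CkS_cS (CkS_d2 V2).
have [M3 M30 b3] := cS_bound (cS_D c1 c2).
have [Mf Mf0 bf] := cS_bound (CkS_cS Cf).
have div0 : \int[area]_(x in Om) (d1 (fun x => f x * a1 x) x + d2 (fun x => f x * a2 x) x) = 0.
  apply: (@divergence_theorem0 _ Om _ _ (M1 + M2 + M3) oOm bOm _ _ _ _ _ _ _ _ _ _ _ corners cornersP).
  - by rewrite !addr_ge0.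
  - by move=> x Ox; exact: cS_continuous (CkS_cS V1) Ox.
  - by move=> x Ox; exact: cS_continuous (CkS_cS V2) Ox.
  - by move=> x Ox; case: (CkS_der1 V1 Ox).
  - by move=> x Ox; case: (CkS_der2 V2 Ox).
  - by move=> x Ox; exact: cS_continuous c1 Ox.
  - by move=> x Ox; exact: cS_continuous c2 Ox.
  - by move=> x Ox; apply: le_trans (b1 _ Ox) _; lra.
  - by move=> x Ox; apply: le_trans (b2 _ Ox) _; lra.
  - by move=> x Ox; apply: le_trans (b3 _ Ox) _; lra.
  - move=> x n bx on; have [t0|t0] := tr x n bx on.
      have ca : cS (fun y => n.1 * a1 y + n.2 * a2 y).
        by apply: cS_D; apply: cS_Z; [exact: CkS_cS C1|exact: CkS_cS C2].
      have [Ma Ma0 ba] := cS_bound ca.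
      by apply: trace_ext (trace_bounded_mul ba t0) => y _; ring.
    by apply: trace_ext (trace_bounded_mul bf t0) => y _; ring.
have := div0; rewrite (@eq_int _ (fun x => f x * (d1 a1 x + d2 a2 x) + (d1 f x * a1 x + d2 f x * a2 x))); last first.
  by move=> x Ox; rewrite D1// D2//; ring.
rewrite intD; first by move/eqP; rewrite addr_eq0 => /eqP.
- apply: cS_M (CkS_cS Cf) _; apply: cS_D; [exact: CkS_cS (CkS_d1 C1)|exact: CkS_cS (CkS_d2 C2)].
- by apply: cS_D; apply: cS_M; [exact: CkS_cS (CkS_d1 Cf)|exact: CkS_cS C1|
    exact: CkS_cS (CkS_d2 Cf)|exact: CkS_cS C2].
Qed.

(** The chemical potential is - lam * wpot. *)
Definition wpot (eps : R) (phi : X -> R) x : R := laplacian phi x - eps ^- 2 * potential' (phi x).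

Lemma CkS_wpot k eps (phi : X -> R) : CkS k.+2 phi -> CkS k (wpot eps phi).
Proof.
move=> C; apply: CkS_B; first exact: CkS_lap.
by apply: CkS_Z; apply: CkS_potential'; do 2 apply: CkS_le.
Qed.

Lemma is_derive_potential (s : R) : is_derive s (1 : R) potential (potential' s).
Proof.
have q := derive_sub (derive_mul (derive_idR s) (derive_idR s)) (derive_const s (1 : R) 1).
have := derive_scale (4^-1) (derive_mul q q).
rewrite (_ : (fun y => _) = potential); last by apply/funext => y; rewrite /potential; field.
by move=> d; apply: derive_value d _; rewrite /potential'; field.
Qed.

Lemma is_derive_potential' (s : R) : is_derive s (1 : R) potential' (3 * s ^+ 2 - 1).
Proof.
have := derive_sub (derive_mul (derive_idR s) (derive_mul (derive_idR s) (derive_idR s))) (derive_idR s).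
rewrite (_ : (fun y => _) = potential'); last by apply/funext => y; rewrite /potential'; ring.
by move=> d; apply: derive_value d _; ring.
Qed.

Lemma d_wpot eps (phi : X -> R) x : CkS 3 phi -> Om x ->
  d1 (wpot eps phi) x = d1 (laplacian phi) x - eps ^- 2 * ((3 * phi x ^+ 2 - 1) * d1 phi x) /\
  d2 (wpot eps phi) x = d2 (laplacian phi) x - eps ^- 2 * ((3 * phi x ^+ 2 - 1) * d2 phi x).
Proof.
move=> C Ox; have CL := CkS_lap C.
have r1 := derive_sub (CkS_der1 CL Ox)
  (derive_scale (eps ^- 2) (is_derive_compR (CkS_der1 C Ox) (is_derive_potential' _))).
have r2 := derive_sub (CkS_der2 CL Ox)
  (derive_scale (eps ^- 2) (is_derive_compR (CkS_der2 C Ox) (is_derive_potential' _))).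
by split; [exact: d1_val r1|exact: d2_val r2].
Qed.

Definition normal_free (a1 a2 : X -> R) : Prop := forall x (n : X), boundary Om x ->
  outward_normal Om x n -> trace_at Om (fun y => a1 y * n.1 + a2 y * n.2) x 0.

Lemma normal_free_wpot eps (phi : X -> R) : CkS 3 phi -> normal_free (d1 phi) (d2 phi) ->
  normal_free (d1 (laplacian phi)) (d2 (laplacian phi)) ->
  normal_free (d1 (wpot eps phi)) (d2 (wpot eps phi)).
Proof.
move=> C nf1 nf2 x n bx on.
have cq : cS (fun y => - eps ^- 2 * (3 * (phi y * phi y) - 1)).
  have c := CkS_cS C; apply: cS_Z; apply: cS_B (cS_cst _); apply: cS_Z; exact: cS_M.
have [M M0 bM] := cS_bound cq.
have tr := trace_add (nf2 x n bx on) (trace_bounded_mul bM (nf1 x n bx on)).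
rewrite addr0 in tr; apply: trace_ext tr => y Oy /=; have [-> ->] := d_wpot eps C Oy.
by rewrite /=; ring.
Qed.

Lemma green_grad f : CkS 2 f ->
  (forall x (n : X), boundary Om x -> outward_normal Om x n ->
     trace_at Om f x 0 \/ trace_at Om (fun y => d1 f y * n.1 + d2 f y * n.2) x 0) ->
  \int[area]_(x in Om) (f x * laplacian f x) = - \int[area]_(x in Om) (dot (grad f x) (grad f x)).
Proof. by move=> C tr; exact: green (CkS_le C) (CkS_d1 C) (CkS_d2 C) tr. Qed.

Lemma cS_dot_grad f : CkS 1 f -> cS (fun x => dot (grad f x) (grad f x)).
Proof.
by move=> C; apply: cS_D; apply: cS_M; [exact: CkS_cS (CkS_d1 C)|exact: CkS_cS (CkS_d1 C)|
  exact: CkS_cS (CkS_d2 C)|exact: CkS_cS (CkS_d2 C)].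
Qed.

(** The increment of the gradient energy paired with the increment of the function
itself: it can be differentiated in time although nothing is known about the time
derivative of the gradient. Green's formula turns the right-hand side into the
integral of the product of grad (phi - psi) and grad (phi + psi). *)
Lemma grad_increment (phi psi : X -> R) : CkS 2 phi -> CkS 2 psi ->
  normal_free (d1 phi) (d2 phi) -> normal_free (d1 psi) (d2 psi) ->
  \int[area]_(x in Om) dot (grad phi x) (grad phi x) -
  \int[area]_(x in Om) dot (grad psi x) (grad psi x) =
  \int[area]_(x in Om) ((phi x - psi x) * (- laplacian phi x - laplacian psi x)).
Proof.
move=> C D nC nD.
have C1 := CkS_le C; have D1 := CkS_le D.
rewrite -intB; [|exact: cS_dot_grad|exact: cS_dot_grad].
have G := @green (fun x => phi x - psi x) (fun x => d1 phi x + d1 psi x) (fun x => d2 phi x + d2 psi x)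
  (CkS_B C1 D1) (CkS_D (CkS_d1 C) (CkS_d1 D)) (CkS_D (CkS_d2 C) (CkS_d2 D)).
transitivity (- \int[area]_(x in Om) ((phi x - psi x) *
   (d1 (fun x => d1 phi x + d1 psi x) x + d2 (fun x => d2 phi x + d2 psi x) x))); last first.
  rewrite -mulN1r -intZ; last first.
    apply: cS_M; first exact: CkS_cS (CkS_B C1 D1).
    apply: cS_D.
      exact: CkS_cS (CkS_d1 (CkS_D (CkS_d1 C) (CkS_d1 D))).
    exact: CkS_cS (CkS_d2 (CkS_D (CkS_d2 C) (CkS_d2 D))).
  apply: eq_int => x Ox.
  have -> : d1 (fun x => d1 phi x + d1 psi x) x = d1 (d1 phi) x + d1 (d1 psi) x.
    by apply: d1_val; exact: derive_add (CkS_der1 (CkS_d1 C) Ox) (CkS_der1 (CkS_d1 D) Ox).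
  have -> : d2 (fun x => d2 phi x + d2 psi x) x = d2 (d2 phi) x + d2 (d2 psi) x.
    by apply: d2_val; exact: derive_add (CkS_der2 (CkS_d2 C) Ox) (CkS_der2 (CkS_d2 D) Ox).
  rewrite /laplacian.
  move: (phi x) (psi x) (d1 (d1 phi) x) (d1 (d1 psi) x) (d2 (d2 phi) x) (d2 (d2 psi) x) => a b c d e f.
  ring.
rewrite G; last first.
  move=> x n bx on; right; have := trace_add (nC x n bx on) (nD x n bx on).
  by rewrite addr0; apply: trace_ext => y _; ring.
rewrite opprK; apply: eq_int => x Ox.
have -> : d1 (fun x => phi x - psi x) x = d1 phi x - d1 psi x.
  by apply: d1_val; exact: derive_sub (CkS_der1 C Ox) (CkS_der1 D Ox).
have -> : d2 (fun x => phi x - psi x) x = d2 phi x - d2 psi x.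
  by apply: d2_val; exact: derive_sub (CkS_der2 C Ox) (CkS_der2 D Ox).
by rewrite /dot /grad /=; ring.
Qed.

(** Gradients are orthogonal to the solenoidal fields that vanish on the boundary. *)
Lemma solenoidal_orthogonal (f u1 u2 : X -> R) : CkS 1 f -> CkS 1 u1 -> CkS 1 u2 ->
  (forall x, Om x -> d1 u1 x + d2 u2 x = 0) ->
  (forall x, boundary Om x -> trace_at Om u1 x 0) ->
  (forall x, boundary Om x -> trace_at Om u2 x 0) ->
  \int[area]_(x in Om) (d1 f x * u1 x + d2 f x * u2 x) = 0.
Proof.
move=> Cf Cu1 Cu2 div0 t1 t2; apply/eqP; rewrite -oppr_eq0 -green//.
  by rewrite (@eq_int _ (fun=> 0)) ?Rintegral_cst ?mul0r// => x Ox; rewrite div0// mulr0.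
have mul_cst (c : R) (v : X -> R) x : trace_at Om v x 0 -> trace_at Om (fun y => c * v y) x 0.
  exact: (trace_bounded_mul (f := fun=> c) (M := `|c|) (fun _ _ => lexx _)).
move=> x n bx on; right.
have := trace_add (mul_cst n.1 _ _ (t1 x bx)) (mul_cst n.2 _ _ (t2 x bx)).
by rewrite addr0; apply: trace_ext => y _; ring.
Qed.

(** Transport by u and diffusion of the potential are divergences of fields without
normal component on the boundary. *)
Lemma mass_rate (u1 u2 phi q : X -> R) (gam eps : R) : CkS 2 u1 -> CkS 2 u2 -> CkS 4 phi ->
  (forall x, Om x -> d1 u1 x + d2 u2 x = 0) ->
  (forall x, Om x -> q x + (u1 x * d1 phi x + u2 x * d2 phi x) + gam * laplacian (wpot eps phi) x = 0) ->
  (forall x, boundary Om x -> trace_at Om u1 x 0) -> (forall x, boundary Om x -> trace_at Om u2 x 0) ->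
  normal_free (d1 phi) (d2 phi) -> normal_free (d1 (laplacian phi)) (d2 (laplacian phi)) ->
  \int[area]_(x in Om) q x = 0.
Proof.
move=> Cu1 Cu2 C div0 eqq t1 t2 nf1 nf2.
have Cw : CkS 2 (wpot eps phi) := CkS_wpot eps C.
have C1 : CkS 1 phi by do 3 apply: CkS_le.
have Cu1' := CkS_le Cu1; have Cu2' := CkS_le Cu2.
have nfw : normal_free (d1 (wpot eps phi)) (d2 (wpot eps phi)).
  by exact: normal_free_wpot (CkS_le C) nf1 nf2.
have A := solenoidal_orthogonal C1 Cu1' Cu2' div0 t1 t2.
have B : \int[area]_(x in Om) (1 * (d1 (d1 (wpot eps phi)) x + d2 (d2 (wpot eps phi)) x)) = 0.
  rewrite (@green (fun=> 1) _ _ (CkS_cst 1 1) (CkS_d1 Cw) (CkS_d2 Cw)); last first.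
    by move=> x n bx on; right; exact: nfw.
  rewrite (@eq_int _ (fun=> 0)) ?Rintegral_cst ?mul0r ?oppr0// => x Ox.
  have -> : d1 (fun=> 1 : R) x = 0 by apply: d1_val; exact: derive_const.
  have -> : d2 (fun=> 1 : R) x = 0 by apply: d2_val; exact: derive_const.
  by rewrite !mul0r addr0.
have cA : cS (fun x => d1 phi x * u1 x + d2 phi x * u2 x).
  by apply: cS_D; apply: cS_M; [exact: CkS_cS (CkS_d1 C1)|exact: CkS_cS Cu1|
    exact: CkS_cS (CkS_d2 C1)|exact: CkS_cS Cu2].
have cB : cS (fun x => 1 * (d1 (d1 (wpot eps phi)) x + d2 (d2 (wpot eps phi)) x)).
  by apply: cS_Z; exact: CkS_cS (CkS_lap Cw).
transitivity (- 1 * \int[area]_(x in Om) (d1 phi x * u1 x + d2 phi x * u2 x) -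
  gam * \int[area]_(x in Om) (1 * (d1 (d1 (wpot eps phi)) x + d2 (d2 (wpot eps phi)) x))); last first.
  by rewrite A B !mulr0 subrr.
rewrite -(intZ (- 1) cA) -(intZ gam cB) -(intB (cS_Z (- 1) cA) (cS_Z gam cB)).
apply: eq_int => x Ox; have := eqq x Ox; rewrite /laplacian.
by move/eqP; rewrite -addrA addr_eq0 => /eqP ->; ring.
Qed.

Lemma int_lin5 (k1 k2 k4 : R) (a0 a1 a2 a3 a4 : X -> R) : cS a0 -> cS a1 -> cS a2 -> cS a3 -> cS a4 ->
  \int[area]_(x in Om) (a0 x + k1 * a1 x + k2 * a2 x - a3 x + k4 * a4 x) =
  \int[area]_(x in Om) a0 x + k1 * \int[area]_(x in Om) a1 x + k2 * \int[area]_(x in Om) a2 x -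
  \int[area]_(x in Om) a3 x + k4 * \int[area]_(x in Om) a4 x.
Proof.
move=> c0 c1 c2 c3 c4; have z1 := cS_Z k1 c1; have z2 := cS_Z k2 c2; have z4 := cS_Z k4 c4.
have d1 := cS_D c0 z1; have d2 := cS_D d1 z2; have d3 := cS_B d2 c3.
by rewrite (intD d3 z4) (intB d2 c3) (intD d1 z2) (intD c0 z1) (intZ k1 c1) (intZ k2 c2) (intZ k4 c4).
Qed.

(** The momentum equation is tested with u and the phase equation with - lam * w,
where w is wpot eps phi. The capillary force against u and the transport term against
w cancel up to the derivative along u of a scalar, whose integral vanishes. *)
Lemma energy_rate (u1 u2 v1 v2 p phi q g1 g2 : X -> R) (nu lam gam eps : R) :
  CkS 2 u1 -> CkS 2 u2 -> CkS 1 p -> CkS 4 phi -> cS g1 -> cS g2 ->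
  (forall x, Om x -> v1 x - nu * laplacian u1 x + (u1 x * d1 u1 x + u2 x * d2 u1 x) + d1 p x +
     lam * laplacian phi x * d1 phi x = g1 x) ->
  (forall x, Om x -> v2 x - nu * laplacian u2 x + (u1 x * d1 u2 x + u2 x * d2 u2 x) + d2 p x +
     lam * laplacian phi x * d2 phi x = g2 x) ->
  (forall x, Om x -> d1 u1 x + d2 u2 x = 0) ->
  (forall x, Om x -> q x + (u1 x * d1 phi x + u2 x * d2 phi x) + gam * laplacian (wpot eps phi) x = 0) ->
  (forall x, boundary Om x -> trace_at Om u1 x 0) -> (forall x, boundary Om x -> trace_at Om u2 x 0) ->
  normal_free (d1 phi) (d2 phi) -> normal_free (d1 (laplacian phi)) (d2 (laplacian phi)) ->
  \int[area]_(x in Om) (u1 x * v1 x + u2 x * v2 x - lam * (wpot eps phi x * q x)) =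
  \int[area]_(x in Om) (u1 x * g1 x + u2 x * g2 x) -
  (nu * \int[area]_(x in Om) (dot (grad u1 x) (grad u1 x) + dot (grad u2 x) (grad u2 x)) +
   lam * gam * \int[area]_(x in Om) dot (grad (wpot eps phi) x) (grad (wpot eps phi) x)).
Proof.
move=> Cu1 Cu2 Cp C cg1 cg2 eq1 eq2 div0 eqq t1 t2 nf1 nf2.
pose w := wpot eps phi.
have Cw : CkS 2 w := CkS_wpot eps C.
have C1 : CkS 1 phi by do 3 apply: CkS_le.
have Cu1' := CkS_le Cu1; have Cu2' := CkS_le Cu2.
have nfw : normal_free (d1 w) (d2 w) by exact: normal_free_wpot (CkS_le C) nf1 nf2.
(* Bernoulli head plus free energy density: the gradients to which u is orthogonal. *)
pose S x := 2^-1 * (u1 x * u1 x + u2 x * u2 x) + p x + lam * eps ^- 2 * potential (phi x).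
have CS : CkS 1 S.
  apply: CkS_D; [apply: CkS_D => //|apply: CkS_Z; exact: CkS_potential].
  by apply: CkS_Z; apply: CkS_D; exact: CkS_M.
have S1 x : Om x -> d1 S x = u1 x * d1 u1 x + u2 x * d1 u2 x + d1 p x +
    lam * eps ^- 2 * (potential' (phi x) * d1 phi x).
  move=> Ox; have D1 := CkS_der1 Cu1 Ox; have D2 := CkS_der1 Cu2 Ox.
  have F := is_derive_compR (CkS_der1 C Ox) (is_derive_potential _).
  have d := derive_add (derive_add (derive_scale (2^-1) (derive_add (derive_mul D1 D1) (derive_mul D2 D2))) (CkS_der1 Cp Ox)) (derive_scale (lam * eps ^- 2) F).
  apply: d1_val; apply: derive_value d _.
  by move: (eps ^- 2) => k; field.
have S2 x : Om x -> d2 S x = u1 x * d2 u1 x + u2 x * d2 u2 x + d2 p x +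
    lam * eps ^- 2 * (potential' (phi x) * d2 phi x).
  move=> Ox; have D1 := CkS_der2 Cu1 Ox; have D2 := CkS_der2 Cu2 Ox.
  have F := is_derive_compR (CkS_der2 C Ox) (is_derive_potential _).
  have d := derive_add (derive_add (derive_scale (2^-1) (derive_add (derive_mul D1 D1) (derive_mul D2 D2))) (CkS_der2 Cp Ox)) (derive_scale (lam * eps ^- 2) F).
  apply: d2_val; apply: derive_value d _.
  by move: (eps ^- 2) => k; field.
have A3 := solenoidal_orthogonal CS Cu1' Cu2' div0 t1 t2.
have G1 := green_grad Cu1 (fun x n bx _ => or_introl (t1 x bx)).
have G2 := green_grad Cu2 (fun x n bx _ => or_introl (t2 x bx)).
have G3 := green_grad Cw (fun x n bx on => or_intror (nfw x n bx on)).
have cA0 : cS (fun x => u1 x * g1 x + u2 x * g2 x).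
  by apply: cS_D; apply: cS_M => //; [exact: CkS_cS Cu1|exact: CkS_cS Cu2].
have cL (f : X -> R) : CkS 2 f -> cS (fun x => f x * laplacian f x).
  by move=> Cf; apply: cS_M; [exact: CkS_cS Cf|exact: CkS_cS (CkS_lap Cf)].
have cA3 : cS (fun x => d1 S x * u1 x + d2 S x * u2 x).
  by apply: cS_D; apply: cS_M; [exact: CkS_cS (CkS_d1 CS)|exact: CkS_cS Cu1|
    exact: CkS_cS (CkS_d2 CS)|exact: CkS_cS Cu2].
have c1 := cL _ Cu1; have c2 := cL _ Cu2; have c3 := cL _ Cw.
have alg (I0 I1 I2 I3 I4 b c d e : R) : I1 = - b -> I2 = - c -> I3 = 0 -> I4 = - d -> e = b + c ->
  I0 + nu * I1 + nu * I2 - I3 + lam * gam * I4 = I0 - (nu * e + lam * gam * d).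
  by move=> -> -> -> -> ->; ring.
apply: etrans (alg _ _ _ _ _ _ _ _ _ G1 G2 A3 G3 (intD (cS_dot_grad Cu1') (cS_dot_grad Cu2'))).
apply: etrans (int_lin5 nu nu (lam * gam) cA0 c1 c2 cA3 c3).
apply: eq_int => x Ox /=; rewrite S1// S2// -eq1// -eq2//.
have -> : q x = - (u1 x * d1 phi x + u2 x * d2 phi x) - gam * laplacian w x.
  by have := eqq x Ox; rewrite -/w -addrA => /eqP; rewrite addr_eq0 => /eqP ->; ring.
have -> : wpot eps phi x = laplacian phi x - eps ^- 2 * potential' (phi x) by [].
have -> : w x = laplacian phi x - eps ^- 2 * potential' (phi x) by [].
move: (laplacian phi x) (laplacian w x) (potential' (phi x)) (laplacian u1 x) (laplacian u2 x).
move: (d1 p x) (d2 p x) (d1 phi x) (d2 phi x) (d1 u1 x) (d2 u1 x) (d1 u2 x) (d2 u2 x).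
move: (u1 x) (u2 x) (v1 x) (v2 x) (eps ^- 2) => *.
ring.
Qed.

End Space.

(** * Gronwall's inequality on an open interval *)

Section Gronwall.
Context {R : realType}.
Local Notation mu := (@lebesgue_measure R).
Implicit Types (f E D G r : R -> R) (a b s t : R).

Lemma within_itv_continuous f a b t : a < t < b -> {within `[a, b], continuous f} ->
  {for t, continuous f}.
Proof.
move=> /andP[at_ tb] /subspace_continuousP cf.
have tab : `[a, b]%classic t by rewrite /= in_itv/= !ltW.
have := cf t tab; rewrite within_interior//.
by rewrite interior_itv/= in_itv/= at_ tb.
Qed.

Lemma itv_integrable f a b : {within `[a, b], continuous f} ->
  mu.-integrable `[a, b] (EFin \o f).
Proof. by move=> cf; apply: continuous_compact_integrable => //; exact: segment_compact. Qed.

(** Since f may be unbounded at the end points, ]0, T[ is exhausted by compact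
intervals. *)
Lemma integral_itvoo_le f (T C : R) : 0 < T -> (forall t, 0 < t < T -> 0 <= f t) ->
  (forall a b, 0 < a -> a < b -> b < T -> {within `[a, b], continuous f}) ->
  (forall a b, 0 < a -> a < b -> b < T -> \int[mu]_(t in `[a, b]) f t <= C) ->
  (\int[mu]_(t in `]0%R, T[) (f t)%:E <= C%:E)%E.
Proof.
move=> T0 f0 cf fC.
pose d (n : nat) : R := T / n.+3%:R.
have d0 n : 0 < d n by rewrite divr_gt0.
have dT n : d n < T - d n.
  have : d n <= T / 3 by rewrite ler_pM2l// lef_pV2 ?posrE// ler_nat.
  lra.
have dT' n : T - d n < T by rewrite ltrBlDr ltrDl.
pose F n : set R := `[d n, T - d n]%classic.
have FE : \bigcup_n F n = `]0, T[%classic.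
  apply/seteqP; split=> [t [n _]|t].
    by rewrite /F/= !in_itv/= => /andP[dt td]; rewrite (lt_le_trans (d0 n))//= (le_lt_trans td).
  rewrite /= in_itv/= => /andP[t0 tT].
  have m0 : 0 < Num.min t (T - t) by rewrite lt_min t0 subr_gt0.
  have [n nP] : exists n : nat, T / Num.min t (T - t) < n%:R.
    exists (Num.truncn (T / Num.min t (T - t))).+1; exact: truncnS_gt.
  have dn : d n <= Num.min t (T - t).
    rewrite /d ler_pdivrMr// -ler_pdivrMl// mulrC; apply: ltW; apply: lt_le_trans nP _.
    by rewrite ler_nat -addn3 leq_addr.
  exists n => //; rewrite /F/= in_itv/=; move: dn; rewrite le_min => /andP[-> dn] /=.
  by rewrite lerBrDr -lerBrDl.
rewrite -FE.
have cv : (\int[mu]_(x in F i) (f x)%:E)%E @[i --> \oo] --> (\int[mu]_(x in \bigcup_i F i) (f x)%:E)%E.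
  apply: ge0_nondecreasing_set_cvg_integral.
  - move=> n m nm; apply/subsetPset => t; rewrite /F/= !in_itv/= => /andP[t1 t2].
    have dmn : d m <= d n by rewrite ler_pM2l// lef_pV2 ?posrE// ler_nat !ltnS.
    by rewrite (le_trans dmn t1)/= (le_trans t2)// lerB.
  - by move=> n; exact: measurable_itv.
  - by move=> n; apply: (measurable_int mu); exact: itv_integrable (cf _ _ (d0 n) (dT n) (dT' n)).
  - move=> n t; rewrite /F/= in_itv/= => /andP[t1 t2]; rewrite lee_fin; apply: f0.
    by rewrite (lt_le_trans (d0 n) t1) (le_lt_trans t2).
rewrite -(cvg_lim _ cv)//; apply: lime_le; first by apply/cvg_ex; exists (\int[mu]_(x in \bigcup_i F i) (f x)%:E)%E.
apply: nearW => n; have intf := itv_integrable (cf _ _ (d0 n) (dT n) (dT' n)).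
by rewrite /= -(fineK (integrable_fin_num _ intf))// lee_fin; exact: fC.
Qed.

Lemma Rintegral_itv_mono f a b a' : a' <= a -> (forall t, a' <= t <= b -> 0 <= f t) ->
  {within `[a', b], continuous f} ->
  \int[mu]_(t in `[a, b]) f t <= \int[mu]_(t in `[a', b]) f t.
Proof.
move=> aa f0 cf; have intf := itv_integrable cf.
have sub : `[a, b] `<=` `[a', b].
  by move=> t; rewrite /= !in_itv/= => /andP[/(le_trans aa)-> ->].
have intf' : mu.-integrable `[a, b] (EFin \o f) by apply: integrableS intf.
apply: fine_le; [exact: integrable_fin_num|exact: integrable_fin_num|].
apply: ge0_subset_integral => //; first exact: (measurable_int mu).
Qed.

(** With K s = expR (- s) * E s the hypothesis on r says that the derivative of K is at
most G - expR (- T) * D, so the bound on ]a, b[ follows by integration; then a tends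
to 0. *)
Lemma gronwall (E r D G : R -> R) (T G0 : R) :
  (forall t, 0 < t < T -> is_derive t (1 : R) E (r t)) ->
  (forall t, 0 < t < T -> [/\ 0 <= E t, 0 <= D t, 0 <= G t & r t <= G t + E t - D t]) ->
  (forall a b, 0 < a -> a < b -> b < T -> {within `[a, b], continuous r}) ->
  (forall a b, 0 < a -> a < b -> b < T -> {within `[a, b], continuous D}) ->
  (forall a b, 0 < a -> a < b -> b < T -> {within `[a, b], continuous G}) ->
  (forall a b, 0 < a -> a < b -> b < T -> \int[mu]_(t in `[a, b]) G t <= G0) ->
  E s @[s --> (0 : R)^'+] --> E 0 ->
  forall a b, 0 < a -> a < b -> b < T ->
    E b + \int[mu]_(t in `[a, b]) D t <= expR T * (E 0 + G0).
Proof.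
move=> derE pos cr cD cG GG0 E0.
have main a b : 0 < a -> a < b -> b < T ->
    expR (- T) * (E b + \int[mu]_(t in `[a, b]) D t) <= E a + G0.
  move=> a0 ab bT.
  have inT s : a <= s <= b -> 0 < s < T by lra.
  have bT' : 0 < b < T by lra.
  have aT' : 0 < a < T by lra.
  have e1 s : 0 < s < T -> expR (- s) <= 1 by move=> sT; rewrite -expR0 ler_expR; lra.
  have eT s : 0 < s < T -> expR (- T) <= expR (- s) by move=> sT; rewrite ler_expR; lra.
  have alg (c eb ka kb ea ID IK IG : R) : IK <= IG -> IG <= G0 - c * ID -> IK = kb - ka ->
    c * eb <= kb -> ka <= ea -> c * (eb + ID) <= ea + G0 by move=> *; lra.
  have alg2 (e c r' E' G' D' : R) : 0 < e -> e <= 1 -> c <= e -> 0 <= G' -> 0 <= D' -> r' <= G' + E' - D' ->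
    e * (r' - E') <= G' - c * D'.
    move=> p1 p2 p3 p4 p5 p6; apply: (@le_trans _ _ (e * (G' - D'))).
      by rewrite ler_pM2l//; lra.
    by nra.
  pose K s := expR (- s) * E s.
  pose k s := expR (- s) * (r s - E s).
  have dK s : 0 < s < T -> is_derive s (1 : R) K (k s).
    move=> sT.
    have de : is_derive s (1 : R) (fun s => expR (- s)) (expR (- s) * (0 - 1)).
      have dn : is_derive s (1 : R) (fun s : R => 0 - s) (0 - 1) := derive_sub (derive_const s 1 0) (derive_idR s).
      have := is_derive_compR dn (is_derive_expR _).
      rewrite (_ : expR \o _ = (fun s => expR (- s))) ?sub0r//.
      by apply/funext => z; rewrite /= sub0r.
    by apply: derive_value (derive_mul de (derE _ sT)) _; rewrite /k; ring.
  have cE s : 0 < s < T -> {for s, continuous E}.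
    by move=> sT; apply: differentiable_continuous; apply/derivable1_diffP; case: (derE s sT).
  have cexp (s : R) : {for s, continuous (fun s : R => expR (- s))}.
    apply: (@continuous_comp _ _ _ (fun s : R => - s) expR); last exact: continuous_expR.
    by apply: cvgN; exact: cvg_id.
  have ck : {within `[a, b], continuous k}.
    apply/subspace_continuousP => s sab; apply: cvgM.
      by apply: cvg_within_filter; exact: cexp.
    apply: cvgB; first by have /subspace_continuousP := cr _ _ a0 ab bT; exact.
    by apply: cvg_within_filter; apply: cE; apply: inT; move: sab; rewrite /= in_itv.
  have K1 : \int[mu]_(t in `[a, b]) k t = K b - K a.
    rewrite /Rintegral (@continuous_FTC2 R k K a b ab ck)//.
      have cK s : 0 < s < T -> {for s, continuous K}.
        by move=> sT; apply: differentiable_continuous; apply/derivable1_diffP; case: (dK s sT).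
      split.
      + move=> s; rewrite in_itv/= => sab.
        have sT : 0 < s < T by apply: inT; lra.
        by case: (dK s sT).
      + by apply: cvg_at_right_filter; apply: cK; lra.
      + by apply: cvg_at_left_filter; apply: cK; lra.
    move=> s; rewrite in_itv/= => sab.
    have sT : 0 < s < T by apply: inT; lra.
    by have dKs := dK s sT; rewrite derive1E derive_val.
  have intD := itv_integrable (cD _ _ a0 ab bT).
  have intG := itv_integrable (cG _ _ a0 ab bT).
  have intk := itv_integrable ck.
  have cTD : {within `[a, b], continuous (fun s => expR (- T) * D s)}.
    apply/subspace_continuousP => s sab; apply: cvgM; first exact: cvg_cst.
    by have /subspace_continuousP := cD _ _ a0 ab bT; exact.
  have cGD : {within `[a, b], continuous (fun s => G s - expR (- T) * D s)}.
    apply/subspace_continuousP => s sab; apply: cvgB.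
      by have /subspace_continuousP := cG _ _ a0 ab bT; exact.
    by move/subspace_continuousP : cTD; exact.
  have le1 : \int[mu]_(t in `[a, b]) k t <= \int[mu]_(t in `[a, b]) (G t - expR (- T) * D t).
    apply: le_Rintegral => //; first exact: itv_integrable.
    move=> s; rewrite /= in_itv/= => sab.
    have sT := inT s sab; have [Es Ds Gs rs] := pos s sT.
    exact: alg2 (expR_gt0 _) (e1 _ sT) (eT _ sT) Gs Ds rs.
  have le2 : \int[mu]_(t in `[a, b]) (G t - expR (- T) * D t) <= G0 - expR (- T) * \int[mu]_(t in `[a, b]) D t.
    rewrite RintegralB//; last exact: itv_integrable.
    rewrite RintegralZl// lerD2r; exact: GG0.
  have [Eb _ _ _] := pos b bT'; have [Ea _ _ _] := pos a aT'.
  have h1 : expR (- T) * E b <= K b by rewrite /K ler_wpM2r// eT.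
  have h2 : K a <= E a by rewrite /K -[leRHS]mul1r ler_wpM2r// e1.
  exact: alg le1 le2 K1 h1 h2.
move=> a b a0 ab bT.
have c0 : expR (- T) * (E b + \int[mu]_(t in `[a, b]) D t) <= E 0 + G0.
  have lim0 : E s + G0 @[s --> (0 : R)^'+] --> E 0 + G0 by apply: cvgD => //; exact: cvg_cst.
  apply: (cvgr_to_ge lim0); near=> a'.
  have a'0 : 0 < a' by near: a'; exact: nbhs_right_gt.
  have a'a : a' <= a by near: a'; exact: nbhs_right_le.
  have a'b : a' < b by exact: le_lt_trans ab.
  apply: le_trans (main a' b a'0 a'b bT).
  rewrite ler_pM2l ?expR_gt0// lerD2l; apply: Rintegral_itv_mono => //; last exact: cD.
  move=> t ta; have tT : 0 < t < T by lra.
  by have [] := pos t tT.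
move: c0; rewrite expRN mulrC ler_pdivrMr ?expR_gt0// mulrC; exact.
Unshelve. all: by end_near. Qed.

End Gronwall.

(** * The energy estimate *)

Lemma laplacianE (R : realType) (V : normedModType R) (f : R * R -> V) x :
  laplacian f x = d1 (d1 f) x + d2 (d2 f) x.
Proof. by []. Qed.

Section Functionals.
Context {R : realType}.
Local Notation X := (R * R)%type.
Variable Om : set X.

(** The energy with the classical gradient in place of the weak one. *)
Definition total_energy (eps lam : R) (v : X -> X) (phi : X -> R) : R :=
  2^-1 * \int[area]_(x in Om) dot (v x) (v x) +
  lam / 2 * \int[area]_(x in Om) dot (grad phi x) (grad phi x) +
  lam * eps ^- 2 * \int[area]_(x in Om) potential (phi x).

Definition viscous_dissipation (nu : R) (v : X -> X) : R :=
  nu * \int[area]_(x in Om) (dot (grad (fun y => (v y).1) x) (grad (fun y => (v y).1) x) +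
                             dot (grad (fun y => (v y).2) x) (grad (fun y => (v y).2) x)).

Definition diffusive_dissipation (lam gam eps : R) (phi : X -> R) : R :=
  lam * gam * \int[area]_(x in Om) dot (grad (wpot eps phi) x) (grad (wpot eps phi) x).
End Functionals.

Section Evolution.
Context {R : realType}.
Local Opaque Ck Rintegral area CkS cS d1 d2 trace_at dt laplacian continuous_upto.
Local Notation X := (R * R)%type.
Local Notation bR := (measurableTypeR R).
Variable Om : set X.
Hypotheses (oOm : open Om) (bOm : bounded_set Om).
Variable corners : seq X.
Hypothesis cornersP : forall x, boundary Om x -> x \notin corners -> exists n, outward_normal Om x n.

(** The bounds needed around t hold on [t / 2, (t + T) / 2], a compact subset of ]0, T]. *)
Lemma derive_pairing_upto (T : R) (P : R -> R) (a a' b : R -> X -> R) t : 0 < t < T ->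
  (forall s, 0 < s < T -> P s - P t = \int[area]_(x in Om) ((a s x - a t x) * (b s x + b t x))) ->
  (forall s x, 0 < s < T -> Om x -> is_derive s (1 : R) (a ^~ x) (a' s x)) ->
  continuous_upto `]0, T] Om a -> continuous_upto `]0, T] Om a' -> continuous_upto `]0, T] Om b ->
  is_derive t (1 : R) P (\int[area]_(x in Om) (a' t x * (2 * b t x))).
Proof.
move=> tT PE da ca ca' cb.
pose c := t / 2; pose d := (t + T) / 2.
have c0 : 0 < c by rewrite /c; lra.
have dT : d < T by rewrite /d; lra.
have tcd : c < t < d by rewrite /c /d; lra.
have sub s : c < s < d -> 0 < s < T by lra.
have sub2 s : c < s < d -> `]0, T]%classic s by move=> scd; rewrite /= in_itv/=; lra.
have sub3 : `[c, d] `<=` `]0, T] by move=> s; rewrite /= !in_itv/=; lra.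
have [M1 M10 bM1] := upto_bound bOm (segment_compact (a := c) (b := d)) sub3 ca'.
have [M2 M20 bM2] := upto_bound bOm (segment_compact (a := c) (b := d)) sub3 cb.
have sub4 s : c < s < d -> `[c, d]%classic s by move=> scd; rewrite /= in_itv/=; lra.
apply: (@derive_pairing R Om oOm bOm P a a' b c d t (M1 + M2) tcd).
- by move=> s /sub; exact: PE.
- by move=> s x /sub sT Ox; exact: da.
- by move=> s x /sub4 sI Ox; apply: le_trans (bM1 s x sI Ox) _; rewrite lerDl.
- by move=> s x /sub4 sI Ox; apply: le_trans (bM2 s x sI Ox) _; rewrite lerDr.
- by move=> s x /sub2 sI Ox; exact: upto_continuous_x ca sI Ox.
- by move=> s x /sub2 sI Ox; exact: upto_continuous_x cb sI Ox.
- by move=> x Ox; exact: upto_continuous_x ca' (sub2 _ tcd) Ox.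
- move=> x Ox A nA; have /= := upto_continuous_t cb (sub2 _ tcd) Ox nA.
  rewrite within_interior//.
  by rewrite interior_itv /= in_itv/= tT.
Qed.

Variables (T nu lam gam eps : R) (g : R -> X -> X).
Variables (u : R -> X -> X) (phi p : R -> X -> R).
Hypotheses (T0 : 0 < T) (nu0 : 0 < nu) (lam0 : 0 < lam) (gam0 : 0 < gam) (eps0 : 0 < eps).
Hypothesis reg : regular Om T u phi p.
Hypothesis eqs : equations Om T nu lam gam eps g u phi p.
Hypothesis bcs : boundary_conditions Om T u phi.

Let U1 t x := (u t x).1.
Let U2 t x := (u t x).2.
Let V1 t x := (dt T u t x).1.
Let V2 t x := (dt T u t x).2.
Let G1 t x := (g t x).1.
Let G2 t x := (g t x).2.
Let Q t x := dt T phi t x.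
Let W t x := wpot eps (phi t) x.
Let I := `]0, T]%classic.

Let Cu : Ck_upto 2 I Om u. Proof. by case: reg => -[]. Qed.
Let Cphi : Ck_upto 4 I Om phi. Proof. by case: reg => _ [[]]. Qed.
Let Cp : Ck_upto 1 I Om p. Proof. by case: reg => _ []. Qed.
Let CU1 : Ck_upto 2 I Om U1 := CkU_fst oOm Cu.
Let CU2 : Ck_upto 2 I Om U2 := CkU_snd oOm Cu.
Let cV1 : continuous_upto I Om V1. Proof. by apply: upto_fst; case: reg => -[]. Qed.
Let cV2 : continuous_upto I Om V2. Proof. by apply: upto_snd; case: reg => -[]. Qed.
Let cQ : continuous_upto I Om Q.
Proof. by apply: (@CkU_upto _ _ _ 1); case: reg => _ [[]]. Qed.

Let CW : Ck_upto 2 I Om W.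
Proof.
apply: (CkUB oOm); first exact: (CkU_lap oOm Cphi).
by apply: (CkUZ oOm); apply: (CkU_potential' oOm); exact: CkU_le (CkU_le Cphi).
Qed.

Let inI t : 0 < t < T -> I t.
Proof. by move=> /andP[t0 tT]; rewrite /I/= in_itv/= t0 ltW. Qed.

Let I_in t : I t -> 0 < t <= T.
Proof. by rewrite /I/= in_itv. Qed.

Let d1U1 t x : I t -> Om x -> (d1 (u t) x).1 = d1 (U1 t) x.
Proof. by move=> It Ox; exact/esym/d1_val/(is_derive_fst (CkU_der1 Cu It Ox)). Qed.
Let d2U1 t x : I t -> Om x -> (d2 (u t) x).1 = d2 (U1 t) x.
Proof. by move=> It Ox; exact/esym/d2_val/(is_derive_fst (CkU_der2 Cu It Ox)). Qed.
Let d1U2 t x : I t -> Om x -> (d1 (u t) x).2 = d1 (U2 t) x.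
Proof. by move=> It Ox; exact/esym/d1_val/(is_derive_snd (CkU_der1 Cu It Ox)). Qed.
Let d2U2 t x : I t -> Om x -> (d2 (u t) x).2 = d2 (U2 t) x.
Proof. by move=> It Ox; exact/esym/d2_val/(is_derive_snd (CkU_der2 Cu It Ox)). Qed.

Let lapU1 t x : I t -> Om x -> (laplacian (u t) x).1 = laplacian (U1 t) x.
Proof.
move=> It Ox.
have E1 := d1_val (is_derive_fst (CkU_der1 (CkU_d1 Cu) It Ox)).
have E2 := d2_val (is_derive_fst (CkU_der2 (CkU_d2 Cu) It Ox)).
have [F1 _] := open_d_eqV oOm (fun y => @d1U1 t y It) Ox.
have [_ F2] := open_d_eqV oOm (fun y => @d2U1 t y It) Ox.
rewrite !laplacianE; exact: (congr2 +%R (etrans (esym E1) F1) (etrans (esym E2) F2)).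
Qed.

Let lapU2 t x : I t -> Om x -> (laplacian (u t) x).2 = laplacian (U2 t) x.
Proof.
move=> It Ox.
have E1 := d1_val (is_derive_snd (CkU_der1 (CkU_d1 Cu) It Ox)).
have E2 := d2_val (is_derive_snd (CkU_der2 (CkU_d2 Cu) It Ox)).
have [F1 _] := open_d_eqV oOm (fun y => @d1U2 t y It) Ox.
have [_ F2] := open_d_eqV oOm (fun y => @d2U2 t y It) Ox.
rewrite !laplacianE; exact: (congr2 +%R (etrans (esym E1) F1) (etrans (esym E2) F2)).
Qed.

Let eqU1 t x : I t -> Om x -> V1 t x - nu * laplacian (U1 t) x +
  (U1 t x * d1 (U1 t) x + U2 t x * d2 (U1 t) x) + d1 (p t) x +
     lam * laplacian (phi t) x * d1 (phi t) x = G1 t x.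
Proof.
move=> It Ox; have [E _ _] := eqs (I_in It) Ox.
by rewrite -(lapU1 It Ox) -(d1U1 It Ox) -(d2U1 It Ox) /G1 -E.
Qed.

Let eqU2 t x : I t -> Om x -> V2 t x - nu * laplacian (U2 t) x +
  (U1 t x * d1 (U2 t) x + U2 t x * d2 (U2 t) x) + d2 (p t) x +
     lam * laplacian (phi t) x * d2 (phi t) x = G2 t x.
Proof.
move=> It Ox; have [E _ _] := eqs (I_in It) Ox.
by rewrite -(lapU2 It Ox) -(d1U2 It Ox) -(d2U2 It Ox) /G2 -E.
Qed.

Let divU t x : I t -> Om x -> d1 (U1 t) x + d2 (U2 t) x = 0.
Proof. by move=> It Ox; have [_ E _] := eqs (I_in It) Ox. Qed.

Let eqphi t x : I t -> Om x -> Q t x + (U1 t x * d1 (phi t) x + U2 t x * d2 (phi t) x) +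
  gam * laplacian (W t) x = 0.
Proof. by move=> It Ox; have [_ _ E] := eqs (I_in It) Ox. Qed.

Let traceU1 t x : I t -> boundary Om x -> trace_at Om (U1 t) x 0.
Proof.
move=> It bx; have [tr _] := bcs (I_in It) bx.
exact: (cvg_comp _ fst tr (@cvg_fst _ _ _ _ _)).
Qed.

Let traceU2 t x : I t -> boundary Om x -> trace_at Om (U2 t) x 0.
Proof.
move=> It bx; have [tr _] := bcs (I_in It) bx.
exact: (cvg_comp _ snd tr (@cvg_snd _ _ _ _ _)).
Qed.

Let nfphi t : I t -> normal_free Om (d1 (phi t)) (d2 (phi t)).
Proof. by move=> It x n bx on; have [_ tr] := bcs (I_in It) bx; have [] := tr n on. Qed.

Let nflap t : I t -> normal_free Om (d1 (laplacian (phi t))) (d2 (laplacian (phi t))).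
Proof. by move=> It x n bx on; have [_ tr] := bcs (I_in It) bx; have [] := tr n on. Qed.

Let cG1 : continuous_upto I Om G1.
Proof.
apply: (upto_ext (fun t x It Ox => eqU1 It Ox)).
have c1 := CkU_upto (CkU_d1 CU1); have c2 := CkU_upto (CkU_d2 CU1).
apply: uptoD; [apply: uptoD; [apply: uptoD; [apply: uptoB|]|]|].
- exact: cV1.
- by apply: uptoZ; exact: CkU_upto (CkU_lap oOm CU1).
- by apply: uptoD; apply: uptoM; [exact: CkU_upto CU1|exact: c1|exact: CkU_upto CU2|exact: c2].
- exact: CkU_upto (CkU_d1 Cp).
- apply: uptoM; first by apply: uptoZ; exact: CkU_upto (CkU_lap oOm Cphi).
  exact: CkU_upto (CkU_d1 Cphi).
Qed.

Let cG2 : continuous_upto I Om G2.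
Proof.
apply: (upto_ext (fun t x It Ox => eqU2 It Ox)).
have c1 := CkU_upto (CkU_d1 CU2); have c2 := CkU_upto (CkU_d2 CU2).
apply: uptoD; [apply: uptoD; [apply: uptoD; [apply: uptoB|]|]|].
- exact: cV2.
- by apply: uptoZ; exact: CkU_upto (CkU_lap oOm CU2).
- by apply: uptoD; apply: uptoM; [exact: CkU_upto CU1|exact: c1|exact: CkU_upto CU2|exact: c2].
- exact: CkU_upto (CkU_d2 Cp).
- apply: uptoM; first by apply: uptoZ; exact: CkU_upto (CkU_lap oOm Cphi).
  exact: CkU_upto (CkU_d2 Cphi).
Qed.

Let dU1 s x : 0 < s < T -> Om x -> is_derive s (1 : R) (U1 ^~ x) (V1 s x).
Proof.
move=> sT Ox; apply: dt_fst => //; case: reg => -[_ _ d _] _; apply: d => //.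
exact: I_in (inI sT).
Qed.

Let dU2 s x : 0 < s < T -> Om x -> is_derive s (1 : R) (U2 ^~ x) (V2 s x).
Proof.
move=> sT Ox; apply: dt_snd => //; case: reg => -[_ _ d _] _; apply: d => //.
exact: I_in (inI sT).
Qed.

Let dphi s x : 0 < s < T -> Om x -> is_derive s (1 : R) (phi ^~ x) (Q s x).
Proof.
move=> sT Ox; apply: dt_is_derive => //; case: reg => _ [[_ _ d _] _]; apply: d => //.
exact: I_in (inI sT).
Qed.

(* The rate of the energy, the energy, its dissipation and the load. *)
Let RR t := \int[area]_(x in Om) (U1 t x * V1 t x + U2 t x * V2 t x - lam * (W t x * Q t x)).
Let EE t := total_energy Om eps lam (u t) (phi t).
Let DV t := viscous_dissipation Om nu (u t).
Let DW t := diffusive_dissipation Om lam gam eps (phi t).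
Let DD t := DV t + DW t.
Let GG t := 2^-1 * \int[area]_(x in Om) dot (g t x) (g t x).

(* The increments of the parts of the energy in the form of derive_pairing. For a
   quantity without quadratic structure the second factors are constants 1/2. *)
Let sq_increment (f h : X -> R) : cS Om f -> cS Om h ->
  \int[area]_(x in Om) (f x * f x) - \int[area]_(x in Om) (h x * h x) =
  \int[area]_(x in Om) ((f x - h x) * (f x + h x)).
Proof.
move=> cf ch; rewrite -(intB oOm bOm (cS_M cf cf) (cS_M ch ch)).
by apply: eq_int => x _; move: (f x) (h x) => a b; ring.
Qed.

Let sum_half (f h : X -> R) : cS Om f -> cS Om h ->
  \int[area]_(x in Om) f x - \int[area]_(x in Om) h x =
  \int[area]_(x in Om) ((f x - h x) * (2^-1 + 2^-1)).
Proof.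
move=> cf ch; rewrite -(intB oOm bOm cf ch).
by apply: eq_int => x _; move: (f x) (h x) => a b; field.
Qed.

Let dP1 t : 0 < t < T -> is_derive t (1 : R) (fun s => \int[area]_(x in Om) (U1 s x * U1 s x))
  (\int[area]_(x in Om) (V1 t x * (2 * U1 t x))).
Proof.
move=> tT; have c1 := CkU_upto CU1.
apply: (derive_pairing_upto tT _ dU1 c1 cV1 c1) => s sT.
exact: sq_increment (cS_at c1 (inI sT)) (cS_at c1 (inI tT)).
Qed.

Let dP2 t : 0 < t < T -> is_derive t (1 : R) (fun s => \int[area]_(x in Om) (U2 s x * U2 s x))
  (\int[area]_(x in Om) (V2 t x * (2 * U2 t x))).
Proof.
move=> tT; have c1 := CkU_upto CU2.
apply: (derive_pairing_upto tT _ dU2 c1 cV2 c1) => s sT.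
exact: sq_increment (cS_at c1 (inI sT)) (cS_at c1 (inI tT)).
Qed.

Let clap : continuous_upto I Om (fun t x => -1 * laplacian (phi t) x).
Proof. by apply: uptoZ; exact: CkU_upto (CkU_lap oOm Cphi). Qed.

Let C2phi t : I t -> CkS Om 2 (phi t).
Proof. by move=> It; exact: CkS_le (CkS_le (CkS_at Cphi It)). Qed.

Let dP3 t : 0 < t < T ->
  is_derive t (1 : R) (fun s => \int[area]_(x in Om) dot (grad (phi s) x) (grad (phi s) x))
  (\int[area]_(x in Om) (Q t x * (2 * (-1 * laplacian (phi t) x)))).
Proof.
move=> tT.
apply: (derive_pairing_upto tT _ dphi (CkU_upto Cphi) cQ clap) => s sT.
have [It Is] := (inI tT, inI sT).
rewrite (grad_increment oOm bOm cornersP (C2phi Is) (C2phi It) (nfphi Is) (nfphi It)).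
apply: eq_int => x _.
move: (laplacian (phi s) x) (laplacian (phi t) x) => a b.
by rewrite !mulN1r.
Qed.

Let cpotQ : continuous_upto I Om (fun t x => potential' (phi t x) * Q t x).
Proof. by apply: uptoM cQ; apply: CkU_upto; apply: (CkU_potential' oOm); exact: Cphi. Qed.

Let dP4 t : 0 < t < T -> is_derive t (1 : R) (fun s => \int[area]_(x in Om) potential (phi s x))
  (\int[area]_(x in Om) (potential' (phi t x) * Q t x * (2 * 2^-1))).
Proof.
move=> tT; have cF := CkU_upto (CkU_potential oOm Cphi).
apply: (derive_pairing_upto (a := fun t x => potential (phi t x)) (b := fun _ _ => 2^-1)
  tT _ _ cF cpotQ (upto_cst _ _ _)).
  by move=> s sT; exact: sum_half (cS_at cF (inI sT)) (cS_at cF (inI tT)).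
move=> s x sT Ox; exact: is_derive_compR (dphi sT Ox) (is_derive_potential _).
Qed.

Let int_lin4 (k1 k2 k3 k4 : R) (a1 a2 a3 a4 : X -> R) : cS Om a1 -> cS Om a2 -> cS Om a3 -> cS Om a4 ->
  \int[area]_(x in Om) (k1 * a1 x + k2 * a2 x + k3 * a3 x + k4 * a4 x) =
  k1 * \int[area]_(x in Om) a1 x + k2 * \int[area]_(x in Om) a2 x +
  k3 * \int[area]_(x in Om) a3 x + k4 * \int[area]_(x in Om) a4 x.
Proof.
move=> c1 c2 c3 c4; have z1 := cS_Z k1 c1; have z2 := cS_Z k2 c2.
have z3 := cS_Z k3 c3; have z4 := cS_Z k4 c4.
have s2 := cS_D z1 z2; have s3 := cS_D s2 z3.
by rewrite (intD oOm bOm s3 z4) (intD oOm bOm s2 z3) (intD oOm bOm z1 z2)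
  (intZ oOm bOm k1 c1) (intZ oOm bOm k2 c2) (intZ oOm bOm k3 c3) (intZ oOm bOm k4 c4).
Qed.

Let energy_derive t : 0 < t < T -> is_derive t (1 : R) EE (RR t).
Proof.
move=> tT; have It := inI tT.
have cU1 := CkU_upto CU1; have cU2 := CkU_upto CU2.
have near_E : \forall s \near t,
    2^-1 * (\int[area]_(x in Om) (U1 s x * U1 s x) + \int[area]_(x in Om) (U2 s x * U2 s x)) +
    lam / 2 * \int[area]_(x in Om) dot (grad (phi s) x) (grad (phi s) x) +
    lam * eps ^- 2 * \int[area]_(x in Om) potential (phi s x) = EE s.
  near=> s; have sT : 0 < s < T.
    apply/andP; split; near: s; [apply: lt_nbhsr|apply: lt_nbhsl]; by case/andP: tT.
  have a1 := cS_at cU1 (inI sT); have a2 := cS_at cU2 (inI sT).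
  rewrite /EE /total_energy; congr (_ * _ + _ + _).
  by rewrite -(intD oOm bOm (cS_M a1 a1) (cS_M a2 a2)).
apply: (near_eq_is_derive near_E).
have d := derive_add (derive_add (derive_scale (2^-1) (derive_add (dP1 tT) (dP2 tT))) (derive_scale (lam / 2) (dP3 tT)))
  (derive_scale (lam * eps ^- 2) (dP4 tT)).
apply: derive_value d _.
have b1 := cS_at cU1 It; have b2 := cS_at cU2 It; have v1 := cS_at cV1 It; have v2 := cS_at cV2 It.
have q := cS_at cQ It; have l := cS_at clap It; have f := cS_at cpotQ It.
rewrite mulrDr -int_lin4; last 4 first.
- by apply: cS_M => //; exact: cS_Z.
- by apply: cS_M => //; exact: cS_Z.
- by apply: cS_M => //; exact: cS_Z.
- by apply: cS_M => //; exact: cS_cst.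
apply: eq_int => x Ox.
have -> : W t x = laplacian (phi t) x - eps ^- 2 * potential' (phi t x) by [].
move: (laplacian (phi t) x) (potential' (phi t x)) (eps ^- 2) (U1 t x) (V1 t x) (U2 t x) (V2 t x) (Q t x) => *.
by field.
Unshelve. all: by end_near. Qed.

Let C1U1 t : I t -> CkS Om 1 (U1 t). Proof. by move=> It; exact: CkS_le (CkS_at CU1 It). Qed.
Let C1U2 t : I t -> CkS Om 1 (U2 t). Proof. by move=> It; exact: CkS_le (CkS_at CU2 It). Qed.
Let C2W t : I t -> CkS Om 2 (W t). Proof. by move=> It; exact: CkS_at CW It. Qed.

Let rate t : I t -> RR t = \int[area]_(x in Om) (U1 t x * G1 t x + U2 t x * G2 t x) - DD t.
Proof.
move=> It; exact: (energy_rate oOm bOm cornersP (CkS_at CU1 It) (CkS_at CU2 It) (CkS_at Cp It)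
  (CkS_at Cphi It) (cS_at cG1 It) (cS_at cG2 It) (fun x => @eqU1 t x It) (fun x => @eqU2 t x It)
  (fun x => @divU t x It) (fun x => @eqphi t x It) (fun x => @traceU1 t x It)
  (fun x => @traceU2 t x It) (nfphi It) (nflap It)).
Qed.

Let dot_ge0 (z : X) : 0 <= dot z z.
Proof. by rewrite /dot -!expr2 addr_ge0 ?sqr_ge0. Qed.

Let int_ge0 (f : X -> R) : (forall x, 0 <= f x) -> 0 <= \int[area]_(x in Om) f x.
Proof. by move=> f0; apply: Rintegral_ge0 => x _; exact: f0. Qed.

Let int_part_ge0 (f : X -> R) :
  0 <= lam / 2 * \int[area]_(x in Om) dot (grad f x) (grad f x) +
    lam * eps ^- 2 * \int[area]_(x in Om) potential (f x).
Proof.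
apply: addr_ge0; apply: mulr_ge0.
- by rewrite divr_ge0// ltW.
- by apply: int_ge0 => x; exact: dot_ge0.
- by rewrite mulr_ge0 ?invr_ge0 ?exprn_ge0 ?ltW.
- by apply: int_ge0 => x; rewrite /potential divr_ge0// sqr_ge0.
Qed.

Lemma total_energy_ge0 (v : X -> X) (f : X -> R) : 0 <= total_energy Om eps lam v f.
Proof.
rewrite /total_energy -addrA; apply: addr_ge0 (int_part_ge0 f).
by apply: mulr_ge0; [rewrite invr_ge0|apply: int_ge0 => x; exact: dot_ge0].
Qed.

Lemma viscous_dissipation_ge0 t : 0 <= DV t.
Proof.
apply: mulr_ge0; first exact: ltW.
by apply: int_ge0 => x; apply: addr_ge0; exact: dot_ge0.
Qed.

Lemma diffusive_dissipation_ge0 t : 0 <= DW t.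
Proof.
apply: mulr_ge0; first by rewrite mulr_ge0// ltW.
by apply: int_ge0 => x; exact: dot_ge0.
Qed.

Let D_ge0 t : 0 <= DD t.
Proof. by apply: addr_ge0; [exact: viscous_dissipation_ge0|exact: diffusive_dissipation_ge0]. Qed.

Let G_ge0 t : 0 <= GG t.
Proof. by rewrite mulr_ge0// Rintegral_ge0. Qed.

Let rate_le t : I t -> RR t <= GG t + EE t - DD t.
Proof.
move=> It; rewrite rate// lerD2r.
have b1 := cS_at (CkU_upto CU1) It; have b2 := cS_at (CkU_upto CU2) It.
have g1 := cS_at cG1 It; have g2 := cS_at cG2 It.
have cu : cS Om (fun x => dot (u t x) (u t x)) by apply: cS_D; exact: cS_M.
have cg : cS Om (fun x => dot (g t x) (g t x)) by apply: cS_D; exact: cS_M.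
have cug : cS Om (fun x => U1 t x * G1 t x + U2 t x * G2 t x) by apply: cS_D; exact: cS_M.
have le1 : \int[area]_(x in Om) (U1 t x * G1 t x + U2 t x * G2 t x) <=
    \int[area]_(x in Om) (2^-1 * dot (g t x) (g t x) + 2^-1 * dot (u t x) (u t x)).
  apply: le_Rintegral (cS_integrable oOm bOm cug) (cS_integrable oOm bOm (cS_D (cS_Z _ cg) (cS_Z _ cu))) _.
  - exact: plane_open_measurable.
  - move=> x _; rewrite /dot -/(U1 t x) -/(U2 t x) -/(G1 t x) -/(G2 t x).
    move: (U1 t x) (U2 t x) (G1 t x) (G2 t x) => a b c d.
    have := sqr_ge0 (a - c); have := sqr_ge0 (b - d); rewrite !expr2; lra.
apply: le_trans le1 _.
rewrite (intD oOm bOm (cS_Z _ cg) (cS_Z _ cu)) (intZ oOm bOm _ cg) (intZ oOm bOm _ cu).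
by rewrite /GG lerD2l /EE /total_energy -addrA lerDl; exact: int_part_ge0.
Qed.

Let subI a b : 0 < a -> b < T -> `[a, b] `<=` I.
Proof. by move=> a0 bT s; rewrite /I/= !in_itv/=; lra. Qed.

Let within_scale (a b k : R) (f : R -> R) : {within `[a, b], continuous f} ->
  {within `[a, b], continuous (fun s => k * f s)}.
Proof.
move=> /subspace_continuousP c; apply/subspace_continuousP => s sab.
by apply: cvgM; [exact: cvg_cst|exact: c].
Qed.

Let param_cont (h : R -> X -> R) a b : continuous_upto I Om h -> 0 < a -> a < b -> b < T ->
  {within `[a, b], continuous (fun s => \int[area]_(x in Om) h s x)}.
Proof.
move=> ch a0 ab bT; apply: (param_continuous oOm bOm (ltW ab)).
exact: upto_sub (subI a0 bT) ch.
Qed.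

Let cR a b : 0 < a -> a < b -> b < T -> {within `[a, b], continuous RR}.
Proof.
apply: param_cont; apply: uptoB; first apply: uptoD.
- exact: uptoM (CkU_upto CU1) cV1.
- exact: uptoM (CkU_upto CU2) cV2.
- by apply: uptoZ; exact: uptoM (CkU_upto CW) cQ.
Qed.

Let cdotgrad (f : R -> X -> R) J : Ck_upto 1 J Om f ->
  continuous_upto J Om (fun t x => dot (grad (f t) x) (grad (f t) x)).
Proof.
move=> C; have c1 := CkU_upto (CkU_d1 C); have c2 := CkU_upto (CkU_d2 C).
exact: uptoD (uptoM c1 c1) (uptoM c2 c2).
Qed.

Lemma viscous_dissipation_continuous (a b : R) : 0 < a -> a < b -> b < T ->
  {within `[a, b], continuous DV}.
Proof.
move=> a0 ab bT; apply: within_scale; apply: param_cont => //.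
by apply: uptoD; apply: cdotgrad; [exact: CkU_le CU1|exact: CkU_le CU2].
Qed.

Lemma diffusive_dissipation_continuous (a b : R) : 0 < a -> a < b -> b < T ->
  {within `[a, b], continuous DW}.
Proof.
move=> a0 ab bT; apply: within_scale; apply: param_cont => //.
by apply: cdotgrad; exact: CkU_le CW.
Qed.

Let cD a b : 0 < a -> a < b -> b < T -> {within `[a, b], continuous DD}.
Proof.
move=> a0 ab bT.
have /subspace_continuousP c1 := viscous_dissipation_continuous a0 ab bT.
have /subspace_continuousP c2 := diffusive_dissipation_continuous a0 ab bT.
by apply/subspace_continuousP => s sab; apply: cvgD; [exact: c1|exact: c2].
Qed.

Lemma load_continuous (a b : R) : 0 < a -> a < b -> b < T -> {within `[a, b], continuous GG}.
Proof.
move=> a0 ab bT; apply: within_scale; apply: param_cont => //.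
exact: uptoD (uptoM cG1 cG1) (uptoM cG2 cG2).
Qed.

Let E_cvg0 : EE s @[s --> (0 : R)^'+] --> EE 0.
Proof.
have cu : continuous_upto `[0, T] Om u by case: reg => -[].
have cphi : Ck_upto 1 `[0, T] Om phi by case: reg => _ [[]].
have lim0 (h : R -> X -> R) : continuous_upto `[0, T] Om h ->
    \int[area]_(x in Om) h s x @[s --> (0 : R)^'+] --> \int[area]_(x in Om) h 0 x.
  move=> ch; have := param_continuous oOm bOm (ltW T0) ch.
  by move=> /(continuous_within_itvP _ T0)[].
have c1 := upto_fst cu; have c2 := upto_snd cu.
apply: cvgD; first apply: cvgD.
- apply: cvgM; first exact: cvg_cst.
  exact: lim0 (uptoD (uptoM c1 c1) (uptoM c2 c2)).
- by apply: cvgM; [exact: cvg_cst|exact: lim0 (cdotgrad cphi)].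
- apply: cvgM; first exact: cvg_cst.
  exact: lim0 (CkU_upto (CkU_potential oOm cphi)).
Qed.

(** By Young's inequality and since the energy controls the kinetic energy, the rate of
the energy is at most GG + EE - DD: this is the hypothesis of Gronwall's inequality. *)
Lemma energy_estimate (G0 : R) :
  (forall a b : R, 0 < a -> a < b -> b < T ->
    \int[lebesgue_measure]_(t in `[a, b]) GG t <= G0) ->
  forall a b : R, 0 < a -> a < b -> b < T ->
    EE b + \int[lebesgue_measure]_(t in `[a, b]) DD t <= expR T * (EE 0 + G0).
Proof.
move=> GG0; apply: (gronwall energy_derive _ cR cD load_continuous GG0 E_cvg0) => t tT; split.
- exact: total_energy_ge0.
- exact: D_ge0.
- exact: G_ge0.
- exact: rate_le (inI tT).
Qed.

(** The phase is continuous down to t = 0 but differentiable in time only for t > 0,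
hence the mean value theorem. *)
Lemma mass_conservation (t : R) : 0 < t < T ->
  \int[area]_(x in Om) phi t x = \int[area]_(x in Om) phi 0 x.
Proof.
move=> /andP[t0 tT].
have cphi : continuous_upto `[0, T] Om phi by apply: (@CkU_upto _ _ _ 1); case: reg => _ [[]].
have sub : `[0, t] `<=` `[0, T] by move=> s; rewrite /= !in_itv/=; lra.
have cM := param_continuous oOm bOm (ltW t0) (upto_sub sub cphi).
have mass_derive s : s \in `]0, t[ -> is_derive s (1 : R) (fun s => \int[area]_(x in Om) phi s x) 0.
  rewrite in_itv/= => st; have sT : 0 < s < T by lra.
  have Is := inI sT.
  have d := derive_pairing_upto (P := fun s => \int[area]_(x in Om) phi s x) (b := fun _ _ => 2^-1) sT
    (fun r rT => sum_half (cS_at (CkU_upto Cphi) (inI rT)) (cS_at (CkU_upto Cphi) Is))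
    dphi (CkU_upto Cphi) cQ (upto_cst _ _ _).
  apply: derive_value d _.
  rewrite -(mass_rate oOm bOm cornersP (CkS_at CU1 Is) (CkS_at CU2 Is) (CkS_at Cphi Is)
    (fun x => @divU s x Is) (fun x => @eqphi s x Is) (fun x => @traceU1 s x Is)
    (fun x => @traceU2 s x Is) (nfphi Is) (nflap Is)).
  by apply: eq_int => x _; rewrite divff ?mulr1.
have [r _] := MVT t0 mass_derive cM.
by rewrite mul0r => /eqP; rewrite subr_eq0 => /eqP.
Qed.

Lemma solution_smooth (t : R) : 0 < t < T ->
  [/\ CkS Om 1 (fun x => (u t x).1), CkS Om 1 (fun x => (u t x).2), CkS Om 1 (phi t) &
      CkS Om 2 (wpot eps (phi t))].
Proof.
move=> tT; have It := inI tT; split; [exact: C1U1|exact: C1U2| |exact: C2W].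
exact: CkS_le (C2phi It).
Qed.

(** The load inherits its regularity from the other terms of the momentum equation. *)
Lemma load_bounded_continuous (t : R) : 0 < t < T ->
  cS Om (fun x => (g t x).1) /\ cS Om (fun x => (g t x).2).
Proof. by move=> tT; split; [exact: cS_at cG1 (inI tT)|exact: cS_at cG2 (inI tT)]. Qed.

Lemma material_dt_wpot (t : R) x : 0 < t < T -> Om x ->
  material_dt T u phi t x = - gam * laplacian (wpot eps (phi t)) x.
Proof.
move=> tT Ox; have E := eqphi (inI tT) Ox.
by rewrite mulNr; apply/eqP; rewrite -addr_eq0; apply/eqP.
Qed.

End Evolution.

(** * Sobolev norms of functions that are smooth up to the boundary *)

Section Sobolev.
Context {R : realType}.
Local Notation X := (R * R)%type.
Local Notation bR := (measurableTypeR R).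
Variable Om : set X.
Hypotheses (oOm : open Om) (bOm : bounded_set Om).
Implicit Types (f g h v w q : X -> R).

Let mOm : measurable (Om : set (bR * bR)) := plane_open_measurable oOm.

Lemma Ck_CkS k f : Ck k f -> CkS Om k f.
Proof.
elim: k f => [|k IH] f [cf]; last first.
  move=> [df [C1 C2]]; split; last first.
    split; first by move=> _ x _ _; exact: df.
    by split; [exact: IH C1|exact: IH C2].
  exists (fun z => f z.2) => //; apply: continuous_subspaceT => z.
  by apply: (@continuous_comp _ _ _ snd f); [exact: cvg_snd|exact: cf].
move=> _; split=> //; exists (fun z => f z.2) => //; apply: continuous_subspaceT => z.
by apply: (@continuous_comp _ _ _ snd f); [exact: cvg_snd|exact: cf].
Qed.

Local Opaque Ck Rintegral area CkS cS d1 d2.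

Lemma ipE f g : ip Om f g = \int[area]_(x in Om) (f x * g x).
Proof. by []. Qed.

Lemma Rintegral_EFin f : area.-integrable (Om : set (bR * bR)) (EFin \o f) ->
  (\int[area]_(x in Om) (f x)%:E)%E = (\int[area]_(x in Om) f x)%:E.
Proof. by move=> intf; have /fineK <- := integrable_fin_num mOm intf. Qed.

Lemma L2_sq_integrable f : L2 Om f -> area.-integrable (Om : set (bR * bR)) (EFin \o (fun x => f x * f x)).
Proof.
move=> [mf fin]; apply/integrableP; split.
  by apply/measurable_EFinP; exact: measurable_funM.
apply: le_lt_trans fin; rewrite le_eqVlt; apply/orP; left; apply/eqP; apply: eq_integral => x _.
by rewrite /= ger0_norm -?expr2 ?sqr_ge0.
Qed.

Lemma L2_mul_integrable f g : L2 Om f -> L2 Om g ->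
  area.-integrable (Om : set (bR * bR)) (EFin \o (fun x => f x * g x)).
Proof.
move=> Lf Lg; have i1 := L2_sq_integrable Lf; have i2 := L2_sq_integrable Lg.
have i3 := integrableD mOm i1 i2.
apply: (le_integrable mOm _ _ i3).
  by apply/measurable_EFinP; apply: measurable_funM; [case: Lf|case: Lg].
move=> x _; rewrite /= lee_fin [leRHS]ger0_norm; last by rewrite -!expr2 addr_ge0 ?sqr_ge0.
move: (f x) (g x) => a b; rewrite ler_norml; apply/andP; split.
  by have := sqr_ge0 (a + b); have := sqr_ge0 (a - b); rewrite !expr2; lra.
by have := sqr_ge0 (a + b); have := sqr_ge0 (a - b); rewrite !expr2; lra.
Qed.

Lemma L2_intro f : measurable_fun (Om : set (bR * bR)) f ->
  area.-integrable (Om : set (bR * bR)) (EFin \o (fun x => f x * f x)) -> L2 Om f.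
Proof.
move=> mf intf; split=> //; rewrite /L2sq.
under eq_integral do rewrite expr2.
by rewrite (Rintegral_EFin intf) ltry.
Qed.

Lemma L2_cS f : cS Om f -> L2 Om f.
Proof.
move=> cf; apply: L2_intro; last exact: (cS_integrable oOm bOm (cS_M cf cf)).
exact: (@plane_continuous_measurable R Om f oOm (fun x => @cS_continuous R Om oOm f x cf)).
Qed.

Lemma integrable_lin (a b c : R) f g h :
  area.-integrable (Om : set (bR * bR)) (EFin \o f) ->
  area.-integrable (Om : set (bR * bR)) (EFin \o g) ->
  area.-integrable (Om : set (bR * bR)) (EFin \o h) ->
  area.-integrable (Om : set (bR * bR)) (EFin \o (fun x => a * f x + b * g x + c * h x)) /\
  \int[area]_(x in Om) (a * f x + b * g x + c * h x) =
  a * \int[area]_(x in Om) f x + b * \int[area]_(x in Om) g x + c * \int[area]_(x in Om) h x.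
Proof.
move=> i1 i2 i3.
have j1 : area.-integrable (Om : set (bR * bR)) (EFin \o (fun x => a * f x)) := integrableZl mOm a i1.
have j2 : area.-integrable (Om : set (bR * bR)) (EFin \o (fun x => b * g x)) := integrableZl mOm b i2.
have j3 : area.-integrable (Om : set (bR * bR)) (EFin \o (fun x => c * h x)) := integrableZl mOm c i3.
have j12 : area.-integrable (Om : set (bR * bR)) (EFin \o (fun x => a * f x + b * g x)) := integrableD mOm j1 j2.
split; first exact: (integrableD mOm j12 j3).
rewrite (RintegralD mOm j12 j3) (RintegralD mOm j1 j2).
by rewrite (RintegralZl a mOm i1) (RintegralZl b mOm i2) (RintegralZl c mOm i3).
Qed.

Lemma ip_sq f g (s : R) : L2 Om f -> L2 Om g ->
  area.-integrable (Om : set (bR * bR)) (EFin \o (fun x => (f x + s * g x) * (f x + s * g x))) /\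
  ip Om (fun x => f x + s * g x) (fun x => f x + s * g x) =
  ip Om f f + 2 * s * ip Om f g + s ^+ 2 * ip Om g g.
Proof.
move=> Lf Lg.
have [j1 j2] := integrable_lin 1 (2 * s) (s ^+ 2)
  (L2_sq_integrable Lf) (L2_mul_integrable Lf Lg) (L2_sq_integrable Lg).
have E x : 1 * (f x * f x) + 2 * s * (f x * g x) + s ^+ 2 * (g x * g x) = (f x + s * g x) * (f x + s * g x).
  by move: (f x) (g x) => a b; ring.
split; first by move: j1; under [X in _ (EFin \o X)]eq_fun => x do rewrite E.
rewrite !ipE -[X in _ = X + _ + _]mul1r -j2; exact: eq_int (fun x _ => esym (E x)).
Qed.

Lemma ip_sq_ge0 f : 0 <= ip Om f f.
Proof. by rewrite ipE; apply: Rintegral_ge0 => x _; rewrite -expr2 sqr_ge0. Qed.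

Lemma L2_addM f g (s : R) : L2 Om f -> L2 Om g -> L2 Om (fun x => f x + s * g x).
Proof.
move=> Lf Lg; apply: L2_intro; last by have [] := ip_sq s Lf Lg.
by apply: measurable_funD; [case: Lf|apply: measurable_funM; [exact: measurable_cst|case: Lg]].
Qed.

Lemma L2_B f g : L2 Om f -> L2 Om g -> L2 Om (fun x => f x - g x).
Proof.
move=> Lf Lg; have := L2_addM (-1) Lf Lg.
by rewrite (_ : (fun x => _) = (fun x => f x - g x))//; apply/funext => x; rewrite mulN1r.
Qed.

Lemma ipBr f g h : L2 Om f -> L2 Om g -> L2 Om h ->
  ip Om f (fun x => g x - h x) = ip Om f g - ip Om f h.
Proof.
move=> Lf Lg Lh; rewrite !ipE -(RintegralB mOm (L2_mul_integrable Lf Lg) (L2_mul_integrable Lf Lh)).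
by apply: eq_int => x _; rewrite mulrBr.
Qed.

Lemma discriminant_le (A P B : R) : 0 <= A -> 0 <= B ->
  (forall s, 0 <= A + 2 * s * P + s ^+ 2 * B) -> P ^+ 2 <= A * B.
Proof.
move=> A0; rewrite le_eqVlt => /orP[/eqP <- pos|B0 pos].
  rewrite mulr0; have [->|P0] := eqVneq P 0; first by rewrite expr0n.
  have := pos (- (A + 1) / (2 * P)).
  have -> : A + 2 * (- (A + 1) / (2 * P)) * P + (- (A + 1) / (2 * P)) ^+ 2 * 0 = - 1 by field.
  by rewrite oppr_ge0 ler10.
have := pos (- P / B).
have -> : A + 2 * (- P / B) * P + (- P / B) ^+ 2 * B = (A * B - P ^+ 2) / B by field; rewrite gt_eqF.
by rewrite pmulr_lge0 ?invr_gt0// subr_ge0.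
Qed.

Lemma ip_cauchy_schwarz f1 f2 g1 g2 : L2 Om f1 -> L2 Om f2 -> L2 Om g1 -> L2 Om g2 ->
  (ip Om f1 g1 + ip Om f2 g2) ^+ 2 <= (ip Om f1 f1 + ip Om f2 f2) * (ip Om g1 g1 + ip Om g2 g2).
Proof.
move=> F1 F2 G1 G2; apply: discriminant_le => [||s].
- by rewrite addr_ge0 ?ip_sq_ge0.
- by rewrite addr_ge0 ?ip_sq_ge0.
- have [_ E1] := ip_sq s F1 G1; have [_ E2] := ip_sq s F2 G2.
  have p1 := ip_sq_ge0 (fun x => f1 x + s * g1 x); have p2 := ip_sq_ge0 (fun x => f2 x + s * g2 x).
  rewrite E1 in p1; rewrite E2 in p2.
  move: p1 p2; move: (ip Om f1 f1) (ip Om f2 f2) (ip Om g1 g1) (ip Om g2 g2) (ip Om f1 g1) (ip Om f2 g2) => *.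
  lra.
Qed.

Lemma ip_cauchy_schwarz1 f g : L2 Om f -> L2 Om g -> ip Om f g ^+ 2 <= ip Om f f * ip Om g g.
Proof.
move=> F G; apply: discriminant_le => [||s]; [exact: ip_sq_ge0|exact: ip_sq_ge0|].
by have [_ <-] := ip_sq s F G; exact: ip_sq_ge0.
Qed.

Lemma L2sqE f : L2 Om f -> L2sq Om f = (ip Om f f)%:E.
Proof.
move=> Lf; rewrite ipE -(Rintegral_EFin (L2_sq_integrable Lf)); exact: eq_integral.
Qed.

Lemma L2sqvE (G : X -> X) : L2 Om (fun x => (G x).1) -> L2 Om (fun x => (G x).2) ->
  L2sqv Om G = (ip Om (fun x => (G x).1) (fun x => (G x).1) + ip Om (fun x => (G x).2) (fun x => (G x).2))%:E.
Proof.
move=> LG1 LG2; have i1 := L2_sq_integrable LG1; have i2 := L2_sq_integrable LG2.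
rewrite !ipE -(RintegralD mOm i1 i2); apply: Rintegral_EFin; exact: (integrableD mOm i1 i2).
Qed.

(** The product with a test function has compact support in Om: integrate its
derivatives. *)
Lemma weak_grad_classical f : CkS Om 1 f -> weak_grad Om f (grad f).
Proof.
move=> Cf psi [Cpsi [K [cK KOm psi0]]].
have Cp := Ck_CkS (Cpsi 1%N).
have Ch : CkS Om 1 (fun x => f x * psi x) := CkS_M oOm Cf Cp.
have h0 x : ~ K x -> f x * psi x = 0 by move=> /psi0 ->; rewrite mulr0.
have i1 : cS Om (fun x => f x * d1 psi x) := cS_M (CkS_cS Cf) (CkS_cS (CkS_d1 Cp)).
have i2 : cS Om (fun x => psi x * d1 f x) := cS_M (CkS_cS Cp) (CkS_cS (CkS_d1 Cf)).
have i3 : cS Om (fun x => f x * d2 psi x) := cS_M (CkS_cS Cf) (CkS_cS (CkS_d2 Cp)).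
have i4 : cS Om (fun x => psi x * d2 f x) := cS_M (CkS_cS Cp) (CkS_cS (CkS_d2 Cf)).
have Z1 : \int[area]_(x in Om) d1 (fun x => f x * psi x) x = 0.
  apply: (Rintegral_d1_compact cK KOm h0) => x Ox.
    by case: (CkS_der1 Ch Ox).
  exact: (@cS_continuous R Om oOm _ x (CkS_cS (CkS_d1 Ch)) Ox).
have Z2 : \int[area]_(x in Om) d2 (fun x => f x * psi x) x = 0.
  apply: (Rintegral_d2_compact cK KOm h0) => x Ox.
    by case: (CkS_der2 Ch Ox).
  exact: (@cS_continuous R Om oOm _ x (CkS_cS (CkS_d2 Ch)) Ox).
have alg (a b : R) : a + b = 0 -> a = - b by move=> /eqP; rewrite addr_eq0 => /eqP.
have E1 x : Om x -> d1 (fun x => f x * psi x) x = f x * d1 psi x + psi x * d1 f x.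
  by move=> Ox; exact: d1_val (derive_mul (CkS_der1 Cf Ox) (CkS_der1 Cp Ox)).
have E2 x : Om x -> d2 (fun x => f x * psi x) x = f x * d2 psi x + psi x * d2 f x.
  by move=> Ox; exact: d2_val (derive_mul (CkS_der2 Cf Ox) (CkS_der2 Cp Ox)).
split.
  rewrite !ipE; apply: alg; rewrite -Z1 (eq_int E1) (intD oOm bOm i1 i2); congr (_ + _).
  by apply: eq_int => x _; rewrite mulrC.
rewrite !ipE; apply: alg; rewrite -Z2 (eq_int E2) (intD oOm bOm i3 i4); congr (_ + _).
by apply: eq_int => x _; rewrite mulrC.
Qed.

Lemma H1_classical f : CkS Om 1 f -> H1 Om f (grad f).
Proof.
move=> Cf; split.
- exact: L2_cS (CkS_cS Cf).
- exact: L2_cS (CkS_cS (CkS_d1 Cf)).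
- exact: L2_cS (CkS_cS (CkS_d2 Cf)).
- exact: weak_grad_classical.
Qed.

Lemma L2sqv_cS (G : X -> X) : cS Om (fun x => (G x).1) -> cS Om (fun x => (G x).2) ->
  L2sqv Om G = (\int[area]_(x in Om) dot (G x) (G x))%:E.
Proof.
move=> c1 c2; apply: Rintegral_EFin; apply: (cS_integrable oOm bOm).
exact: cS_D (cS_M c1 c1) (cS_M c2 c2).
Qed.

Lemma H1semi2_le f : CkS Om 1 f ->
  (H1semi2 Om f <= (\int[area]_(x in Om) dot (grad f x) (grad f x))%:E)%E.
Proof.
move=> Cf; rewrite -(L2sqv_cS (G := grad f) (CkS_cS (CkS_d1 Cf)) (CkS_cS (CkS_d2 Cf))).
by apply: ge_ereal_inf; exists (L2sqv Om (grad f)) => //; exists (grad f) => //; exact: H1_classical.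
Qed.

Lemma energy_le (eps lam : R) (v : X -> X) f : 0 < lam ->
  cS Om (fun x => (v x).1) -> cS Om (fun x => (v x).2) -> CkS Om 1 f ->
  (energy Om eps lam v f <= (2^-1 * \int[area]_(x in Om) dot (v x) (v x) +
     lam / 2 * \int[area]_(x in Om) dot (grad f x) (grad f x) +
     lam * eps ^- 2 * \int[area]_(x in Om) potential (f x))%:E)%E.
Proof.
move=> l0 c1 c2 Cf; rewrite /energy (L2sqv_cS c1 c2) !EFinD !EFinM.
have cF := CkS_cS (CkS_potential oOm Cf).
rewrite (Rintegral_EFin (cS_integrable oOm bOm cF)).
apply: leeD => //; apply: leeD => //; apply: lee_wpmul2l (H1semi2_le Cf).
by rewrite lee_fin divr_ge0// ltW.
Qed.

Lemma pairing_error (e a0 b3 b4 l0 v0 p1 q1 p2 q2 : R) : a0 = l0 - v0 -> b3 = p1 - q1 -> b4 = p2 - q2 ->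
  p1 + p2 = - e -> l0 = e -> v0 + (q1 + q2) = - (a0 + (b3 + b4)).
Proof. by move=> *; lra. Qed.

Lemma sqr_oppD_le (x y p q : R) : x ^+ 2 <= p -> y ^+ 2 <= q -> (- (x + y)) ^+ 2 <= 2 * (p + q).
Proof. by rewrite sqrrN !expr2 => *; have := sqr_ge0 (x - y); rewrite expr2; lra. Qed.

(** Green's formula against H^1_0: it holds for the test functions that approximate v
by integration by parts, and both sides are continuous by Cauchy-Schwarz. *)
Lemma ip_laplacian_H10 f v (G : X -> X) : CkS Om 2 f -> H10 Om v G ->
  ip Om (laplacian f) v = - (ip Om (d1 f) (fun x => (G x).1) + ip Om (d2 f) (fun x => (G x).2)).
Proof.
move=> Cf [[Lv LG1 LG2 _] [psi [tpsi cv cG]]].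
have C1 := CkS_d1 Cf; have C2 := CkS_d2 Cf.
have Lw1 := L2_cS (CkS_cS C1); have Lw2 := L2_cS (CkS_cS C2).
have c11 := CkS_cS (CkS_d1 C1); have c22 := CkS_cS (CkS_d2 C2).
have Ll : L2 Om (laplacian f) := L2_cS (cS_D c11 c22).
have Cp k : CkS Om 1 (psi k) by apply: Ck_CkS; case: (tpsi k).
have Lp k := L2_cS (CkS_cS (Cp k)).
have Lp1 k := L2_cS (CkS_cS (CkS_d1 (Cp k))).
have Lp2 k := L2_cS (CkS_cS (CkS_d2 (Cp k))).
pose N := ip Om (laplacian f) v + (ip Om (d1 f) (fun x => (G x).1) + ip Om (d2 f) (fun x => (G x).2)).
pose av k : X -> R := fun x => psi k x - v x.
pose b1 k : X -> R := fun x => d1 (psi k) x - (G x).1.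
pose b2 k : X -> R := fun x => d2 (psi k) x - (G x).2.
have Lav k : L2 Om (av k) := L2_B (Lp k) Lv.
have Lb1 k : L2 Om (b1 k) := L2_B (Lp1 k) LG1.
have Lb2 k : L2 Om (b2 k) := L2_B (Lp2 k) LG2.
pose A := ip Om (laplacian f) (laplacian f).
pose S := ip Om (d1 f) (d1 f) + ip Om (d2 f) (d2 f).
have cva : ip Om (av k) (av k) @[k --> \oo] --> (0 : R).
  have /fine_cvgP[_] := cv; apply: cvg_trans; apply: near_eq_cvg; apply: nearW => k.
  by rewrite /= (L2sqE (Lav k)).
have cvb : ip Om (b1 k) (b1 k) + ip Om (b2 k) (b2 k) @[k --> \oo] --> (0 : R).
  have /fine_cvgP[_] := cG; apply: cvg_trans; apply: near_eq_cvg; apply: nearW => k.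
  have := @L2sqvE (fun x => grad (psi k) x - G x) (Lb1 k) (Lb2 k).
  by rewrite /= => ->.
have NE k : N = - (ip Om (laplacian f) (av k) + (ip Om (d1 f) (b1 k) + ip Om (d2 f) (b2 k))).
  have [W1 _] := weak_grad_classical C1 (tpsi k); have [_ W2] := weak_grad_classical C2 (tpsi k).
  have cp := CkS_cS (Cp k).
  have El : ip Om (laplacian f) (psi k) = ip Om (d1 (d1 f)) (psi k) + ip Om (d2 (d2 f)) (psi k).
    apply: (etrans _ (intD oOm bOm (cS_M c11 cp) (cS_M c22 cp))).
    exact: (eq_int (fun x _ => mulrDl (d1 (d1 f) x) (d2 (d2 f) x) (psi k x))).
  have Ea : ip Om (laplacian f) (av k) = ip Om (laplacian f) (psi k) - ip Om (laplacian f) v := ipBr Ll (Lp k) Lv.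
  have Eb1 : ip Om (d1 f) (b1 k) =
      ip Om (d1 f) (d1 (psi k)) - ip Om (d1 f) (fun x => (G x).1) := ipBr Lw1 (Lp1 k) LG1.
  have Eb2 : ip Om (d2 f) (b2 k) =
      ip Om (d2 f) (d2 (psi k)) - ip Om (d2 f) (fun x => (G x).2) := ipBr Lw2 (Lp2 k) LG2.
  apply: pairing_error Ea Eb1 Eb2 _ El; rewrite W1 W2 opprD; congr (- _ - _).
have Nle k : N ^+ 2 <= 2 * (A * ip Om (av k) (av k) + S * (ip Om (b1 k) (b1 k) + ip Om (b2 k) (b2 k))).
  have h1 := ip_cauchy_schwarz1 Ll (Lav k).
  have h2 := ip_cauchy_schwarz Lw1 Lw2 (Lb1 k) (Lb2 k).
  rewrite (NE k); exact: sqr_oppD_le h1 h2.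
have cvr : 2 * (A * ip Om (av k) (av k) +
    S * (ip Om (b1 k) (b1 k) + ip Om (b2 k) (b2 k))) @[k --> \oo] --> 2 * (A * 0 + S * 0).
  apply: cvgM; first exact: cvg_cst.
  by apply: cvgD; apply: cvgM => //; exact: cvg_cst.
have N0 : N ^+ 2 <= 0.
  rewrite (_ : 0 = 2 * (A * 0 + S * 0)); last by rewrite !mulr0 addr0 mulr0.
  by apply: (cvgr_to_ge cvr); exact: nearW.
have : N == 0 by rewrite -sqrf_eq0 eq_le N0 sqr_ge0.
by rewrite addr_eq0 => /eqP.
Qed.

Lemma Hm1norm_le (k : R) q f : 0 <= k -> CkS Om 2 f ->
  (forall x, Om x -> q x = - k * laplacian f x) ->
  (Hm1norm Om q <= (k * Num.sqrt (\int[area]_(x in Om) dot (grad f x) (grad f x)))%:E)%E.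
Proof.
move=> k0 Cf qE.
have C1 := CkS_d1 Cf; have C2 := CkS_d2 Cf.
have Lw1 := L2_cS (CkS_cS C1); have Lw2 := L2_cS (CkS_cS C2).
apply: ge_ereal_sup => _ [->|[v [G [H _ ->]]]].
  by rewrite lee_fin mulr_ge0 ?sqrtr_ge0.
have [[Lv LG1 LG2 _] _] := H.
have Ev : ip Om q v = k * (ip Om (d1 f) (fun x => (G x).1) + ip Om (d2 f) (fun x => (G x).2)).
  have -> : ip Om q v = - k * ip Om (laplacian f) v.
    have Ll : L2 Om (laplacian f) := L2_cS (cS_D (CkS_cS (CkS_d1 C1)) (CkS_cS (CkS_d2 C2))).
    rewrite !ipE -(RintegralZl (- k) mOm (L2_mul_integrable Ll Lv)).
    by apply: eq_int => x Ox; rewrite qE// mulrA.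
  by rewrite (ip_laplacian_H10 Cf H) mulrNN.
rewrite (L2sqvE LG1 LG2) Ev lee_fin /=.
have CS := ip_cauchy_schwarz Lw1 Lw2 LG1 LG2.
have -> : \int[area]_(x in Om) dot (grad f x) (grad f x) = ip Om (d1 f) (d1 f) + ip Om (d2 f) (d2 f).
  by rewrite !ipE -(RintegralD mOm (L2_sq_integrable Lw1) (L2_sq_integrable Lw2)).
have S0 : 0 <= ip Om (d1 f) (d1 f) + ip Om (d2 f) (d2 f) by rewrite addr_ge0 ?ip_sq_ge0.
have B0 : 0 <= ip Om (fun x => (G x).1) (fun x => (G x).1) + ip Om (fun x => (G x).2) (fun x => (G x).2).
  by rewrite addr_ge0 ?ip_sq_ge0.
move: CS S0 B0; move: (ip Om (d1 f) (d1 f) + _)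
  (ip Om (fun x => (G x).1) (fun x => (G x).1) + _) (ip Om (d1 f) _ + _).
move=> S B P CS S0 B0.
rewrite -mulrA ler_wpM2l//; move: B0; rewrite le_eqVlt => /orP[/eqP <-|B0].
  by rewrite sqrtr0 invr0 mulr0 sqrtr_ge0.
rewrite ler_pdivrMr ?sqrtr_gt0// -sqrtrM// (le_trans (ler_norm P))//.
by rewrite -sqrtr_sqr ler_wsqrtr.
Qed.

Lemma Hm1norm_ge0 q : (0 <= Hm1norm Om q)%E.
Proof. by apply: ereal_sup_ubound; left. Qed.

Lemma Hm1norm_sqr_le (lam gam : R) q f : 0 < lam -> 0 < gam -> CkS Om 2 f ->
  (forall x, Om x -> q x = - gam * laplacian f x) ->
  ((lam / gam)%:E * Hm1norm Om q ^+ 2 <=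
    (lam * gam * \int[area]_(x in Om) dot (grad f x) (grad f x))%:E)%E.
Proof.
move=> l0 g0 Cf qE; have := Hm1norm_le (ltW g0) Cf qE; have := Hm1norm_ge0 q.
case: (Hm1norm Om q) => [r| |]; rewrite ?leye_eq// lee_fin => r0; rewrite lee_fin => rle.
rewrite -EFin_expe -EFinM lee_fin.
set S := Rintegral _ _ _ in rle *.
have S0 : 0 <= S.
  by apply: Rintegral_ge0 => x _; rewrite /dot -!expr2 addr_ge0 ?sqr_ge0.
have -> : lam * gam * S = lam / gam * (gam * Num.sqrt S) ^+ 2.
  by rewrite exprMn sqr_sqrtr//; field; rewrite gt_eqF.
have k0 : 0 <= lam / gam by rewrite divr_ge0// ltW.
by apply: (ler_wpM2l k0); rewrite ler_pXn2r// nnegrE; exact: le_trans rle.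
Qed.
End Sobolev.

(** * The stability estimate *)

Section Time.
Context {R : realType}.
Local Notation mu := (@lebesgue_measure R).

(** The integral of a nonnegative function is a supremum over the simple functions below
it, so it is monotone on all functions; this spares the measurability in time of the H^-1
norm. *)
Lemma ge0_le_integral_any d (S : measurableType d) (nu : {measure set S -> \bar R}) (D : set S)
    (f h : S -> \bar R) : (forall x, D x -> (0 <= f x)%E) -> (forall x, D x -> (f x <= h x)%E) ->
  (\int[nu]_(x in D) f x <= \int[nu]_(x in D) h x)%E.
Proof.
move=> f0 fh; rewrite !ge0_integralE// => [|x Dx]; last exact: le_trans (f0 x Dx) (fh x Dx).
apply: ge_ereal_sup => _ [k kf <-]; apply: ereal_sup_ubound.
exists k => // x; apply: le_trans (kf x) _.
by rewrite !patchE; case: ifPn => // /set_mem; exact: fh.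
Qed.

Lemma itvoo_measurable (f : R -> R) (T : R) :
  (forall a b : R, 0 < a -> a < b -> b < T -> {within `[a, b], continuous f}) ->
  measurable_fun `]0, T[ f.
Proof.
move=> cf; apply: open_continuous_measurable_fun; first exact: interval_open.
move=> t /set_mem; rewrite /= in_itv/= => /andP[t0 tT].
by apply: within_itv_continuous (cf (t / 2) ((t + T) / 2) _ _ _); lra.
Qed.

Lemma ae_time_measure (T : R) (P : R -> Prop) : (forall t, 0 < t < T -> P t) ->
  {ae time_measure T, forall t, P t}.
Proof.
move=> HP; exists ([set 0] `|` [set T] `|` ~` `[0, T]); split.
- by apply: measurableU; [exact: measurableU|exact: measurableC].
- have N0 : mu ([set 0] `|` [set T]) = 0%E.
    by apply: null_set_setU => //; exact: lebesgue_measure_set1.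
  rewrite /time_measure/= /mrestr; apply: subset_measure0 N0.
  + by apply: measurableI => //; apply: measurableU; [exact: measurableU|exact: measurableC].
  + exact: measurableU.
  + by move=> t [[]].
- move=> t nP; apply: contrapT => nt; apply: nP; apply: HP.
  have [t0 tT] : t <> 0 /\ t <> T by split=> tE; apply: nt; left; [left|right].
  have : `[0, T]%classic t by apply: contrapT => h; apply: nt; right.
  by rewrite /= in_itv/= !le_eqVlt eq_sym => /andP[/orP[/eqP//|->]/orP[/eqP//|->]].
Qed.
End Time.

Section Bounds.
Context {R : realType}.
Local Notation X := (R * R)%type.
Local Notation mu := (@lebesgue_measure R).
Variable Om : set X.
Hypotheses (oOm : open Om) (bOm : bounded_set Om).
Variable corners : seq X.
Hypothesis cornersP : forall x, boundary Om x -> x \notin corners -> exists n, outward_normal Om x n.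
Variables (T nu lam gam eps : R) (g : R -> X -> X) (u0 : X -> X) (phi0 : X -> R).
Hypotheses (T0 : 0 < T) (nu0 : 0 < nu) (lam0 : 0 < lam) (gam0 : 0 < gam) (eps0 : 0 < eps).
Hypothesis gL2 : L2L2 Om T g.
Variables (u : R -> X -> X) (phi p : R -> X -> R).
Hypothesis sol : regular_solution Om T nu lam gam eps g u0 phi0 u phi p.

Local Opaque Ck Rintegral area CkS cS d1 d2 trace_at dt laplacian continuous_upto.

(** Half the square of the norm of g in L^2(0, T; L^2), finite by hypothesis. *)
Definition load_energy : R := fine (\int[mu]_(t in `]0%R, T[) ((2^-1)%:E * L2sqv Om (g t)))%E.

Definition stability_constant : R :=
  expR T * (total_energy Om eps lam u0 phi0 + load_energy).

Let reg : regular Om T u phi p. Proof. by case: sol. Qed.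
Let eqs : equations Om T nu lam gam eps g u phi p. Proof. by case: sol. Qed.
Let bcs : boundary_conditions Om T u phi. Proof. by case: sol. Qed.

Lemma L2sqv_ge0 (v : X -> X) : (0 <= L2sqv Om v)%E.
Proof. by apply: integral_ge0 => x _; rewrite lee_fin /dot -!expr2 addr_ge0 ?sqr_ge0. Qed.

Let half_L2sqv_ge0 t : (0 <= (2^-1)%:E * L2sqv Om (g t))%E.
Proof. by apply: mule_ge0; [rewrite lee_fin invr_ge0|exact: L2sqv_ge0]. Qed.

Lemma load_energy_ge0 : 0 <= load_energy.
Proof. by apply: fine_ge0; apply: integral_ge0 => t _; exact: half_L2sqv_ge0. Qed.

(** On each time interval inside ]0, T[ the classical load is dominated by the given
square-integrable one. *)
Lemma load_bound (a b : R) : 0 < a -> a < b -> b < T ->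
  \int[mu]_(t in `[a, b]) (2^-1 * \int[area]_(x in Om) dot (g t x) (g t x)) <= load_energy.
Proof.
move=> a0 ab bT.
pose GG t := 2^-1 * \int[area]_(x in Om) dot (g t x) (g t x).
have GE t : 0 < t < T -> ((2^-1)%:E * L2sqv Om (g t) = (GG t)%:E)%E.
  move=> tT; have [c1 c2] := load_bounded_continuous oOm reg eqs tT.
  by rewrite (L2sqv_cS oOm bOm c1 c2) -EFinM.
have IE : (\int[mu]_(t in `]0%R, T[) ((2^-1)%:E * L2sqv Om (g t)) = \int[mu]_(t in `]0%R, T[) (GG t)%:E)%E.
  by apply: eq_integral => t /set_mem; rewrite /= in_itv/=; exact: GE.
have GG0 t : 0 <= GG t.
  by rewrite mulr_ge0// Rintegral_ge0// => x _; rewrite /dot -!expr2 addr_ge0 ?sqr_ge0.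
have mG : measurable_fun `]0, T[ GG.
  by apply: itvoo_measurable; exact: (load_continuous oOm bOm reg eqs).
have fin : (\int[mu]_(t in `]0%R, T[) (GG t)%:E)%E \is a fin_num.
  rewrite ge0_fin_numE; last by apply: integral_ge0 => t _; rewrite lee_fin.
  rewrite -IE; apply: le_lt_trans gL2.2; apply: ge0_le_integral_any => t _.
    exact: half_L2sqv_ge0.
  rewrite -[leRHS]mul1e; apply: lee_wpmul2r; first exact: L2sqv_ge0.
  by rewrite lee_fin invf_le1// ler1n.
rewrite /load_energy IE; apply: fine_le => //.
  have iG := itv_integrable (load_continuous oOm bOm reg eqs a0 ab bT).
  exact: integrable_fin_num iG.
apply: ge0_subset_integral => //.
- exact/measurable_EFinP.
- by move=> t _; rewrite lee_fin; exact: GG0.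
- by move=> t; rewrite /= !in_itv/= => /andP[h1 h2]; rewrite (lt_le_trans a0)//= (le_lt_trans h2).
Qed.

Lemma total_energy_initial : total_energy Om eps lam (u 0) (phi 0) = total_energy Om eps lam u0 phi0.
Proof.
have [_ _ _ ini] := sol.
have e1 : \int[area]_(x in Om) dot (u 0 x) (u 0 x) = \int[area]_(x in Om) dot (u0 x) (u0 x).
  by apply: eq_int => x Ox; have [-> _] := ini x Ox.
have e2 : \int[area]_(x in Om) dot (grad (phi 0) x) (grad (phi 0) x) =
    \int[area]_(x in Om) dot (grad phi0 x) (grad phi0 x).
  apply: eq_int => x Ox; have [E1 E2] := open_d_eqV oOm (fun y Oy => (ini y Oy).2) Ox.
  by rewrite /grad E1 E2.
have e3 : \int[area]_(x in Om) potential (phi 0 x) = \int[area]_(x in Om) potential (phi0 x).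
  by apply: eq_int => x Ox; have [_ ->] := ini x Ox.
by rewrite /total_energy e1 e2 e3.
Qed.

Lemma stability_bound (a b : R) : 0 < a -> a < b -> b < T ->
  total_energy Om eps lam (u b) (phi b) +
  \int[mu]_(t in `[a, b]) (viscous_dissipation Om nu (u t) + diffusive_dissipation Om lam gam eps (phi t))
  <= stability_constant.
Proof.
move=> a0 ab bT; rewrite /stability_constant -total_energy_initial.
exact: (energy_estimate oOm bOm cornersP T0 nu0 lam0 gam0 eps0 reg eqs bcs load_bound).
Qed.

Let DD t := viscous_dissipation Om nu (u t) + diffusive_dissipation Om lam gam eps (phi t).

Let DV0 t : 0 <= viscous_dissipation Om nu (u t) := viscous_dissipation_ge0 Om u nu0 t.
Let DW0 t : 0 <= diffusive_dissipation Om lam gam eps (phi t) := diffusive_dissipation_ge0 Om eps phi lam0 gam0 t.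

Lemma energy_bound (t : R) : 0 < t < T -> (energy Om eps lam (u t) (phi t) <= stability_constant%:E)%E.
Proof.
move=> tT; have [c1 c2 c3 _] := solution_smooth oOm eps reg tT.
apply: le_trans (energy_le oOm bOm eps lam0 (CkS_cS c1) (CkS_cS c2) c3) _.
case/andP: tT => t0 tT; rewrite lee_fin.
have t20 : 0 < t / 2 by lra.
have t2t : t / 2 < t by lra.
apply: le_trans (stability_bound t20 t2t tT); rewrite lerDl.
by apply: Rintegral_ge0 => s _; rewrite addr_ge0.
Qed.

Lemma dissipation_bound :
  (\int[mu]_(t in `]0%R, T[) (nu%:E * H1semi2v Om (u t)) +
   \int[mu]_(t in `]0%R, T[) ((lam / gam)%:E * Hm1norm Om (material_dt T u phi t) ^+ 2)
    <= stability_constant%:E)%E.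
Proof.
have cV := viscous_dissipation_continuous oOm bOm (nu := nu) reg.
have cW := diffusive_dissipation_continuous oOm bOm (lam := lam) (gam := gam) (eps := eps) reg.
have int_DD : (\int[mu]_(t in `]0%R, T[) (DD t)%:E <= stability_constant%:E)%E.
  apply: integral_itvoo_le => //.
  - by move=> t _; apply: addr_ge0.
  - move=> a b a0 ab bT.
    have /subspace_continuousP c1 := cV a b a0 ab bT.
    have /subspace_continuousP c2 := cW a b a0 ab bT.
    by apply/subspace_continuousP => s sab; apply: cvgD; [exact: c1|exact: c2].
  - move=> a b a0 ab bT; apply: le_trans (stability_bound a0 ab bT).
    by rewrite lerDr; exact: total_energy_ge0.
have split_DD : (\int[mu]_(t in `]0%R, T[) (DD t)%:E =
    \int[mu]_(t in `]0%R, T[) (viscous_dissipation Om nu (u t))%:E +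
    \int[mu]_(t in `]0%R, T[) (diffusive_dissipation Om lam gam eps (phi t))%:E)%E.
  have mV := (measurable_EFinP _ _).2 (itvoo_measurable cV).
  have mW := (measurable_EFinP _ _).2 (itvoo_measurable cW).
  by apply: (ge0_integralD mu _ _ mV _ mW) => // t _; rewrite lee_fin.
apply: le_trans int_DD; rewrite split_DD; apply: leeD; apply: ge0_le_integral_any.
- move=> t _; apply: mule_ge0; first by rewrite lee_fin ltW.
  by apply: adde_ge0; apply: le_ereal_inf_tmp => _ [G _ <-]; exact: L2sqv_ge0.
- move=> t; rewrite /= in_itv/= => tT; have [c1 c2 _ _] := solution_smooth oOm eps reg tT.
  rewrite /viscous_dissipation EFinM; apply: lee_wpmul2l; first by rewrite lee_fin ltW.
  rewrite (intD oOm bOm (cS_dot_grad c1) (cS_dot_grad c2)) EFinD.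
  by apply: leeD; exact: H1semi2_le.
- move=> t _; apply: mule_ge0; first by rewrite lee_fin divr_ge0// ltW.
  by apply: expe_ge0; exact: Hm1norm_ge0.
- move=> t; rewrite /= in_itv/= => tT; have [_ _ _ cw] := solution_smooth oOm eps reg tT.
  apply: (Hm1norm_sqr_le oOm bOm lam0 gam0 cw) => x Ox.
  exact: (material_dt_wpot eqs tT Ox).
Qed.

End Bounds.

Theorem proposition2p1 (R : realType) (Om : set (R * R))
    (T nu lam gam eps : R) (g : R -> R * R -> R * R)
    (u0 : R * R -> R * R) (phi0 : R * R -> R) :
  polygonal_domain Om -> 0 < T ->
  0 < nu -> 0 < lam -> 0 < gam -> 0 < eps ->
  L2L2 Om T g ->
  (energy Om eps lam u0 phi0 < +oo)%E ->
  exists2 Cstab : R, 0 < Cstab &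
    forall (u : R -> R * R -> R * R) (phi p : R -> R * R -> R),
      regular_solution Om T nu lam gam eps g u0 phi0 u phi p ->
      [/\ {ae lebesgue_measure, forall t : R, 0 < t < T ->
            ip Om (phi t) (cst 1) = ip Om phi0 (cst 1)},
          (ess_sup (time_measure T) (fun t => energy Om eps lam (u t) (phi t))
             <= Cstab%:E)%E &
          (\int[lebesgue_measure]_(t in `]0%R, T[)
               (nu%:E * H1semi2v Om (u t)) +
           \int[lebesgue_measure]_(t in `]0%R, T[)
               ((lam / gam)%:E * Hm1norm Om (material_dt T u phi t) ^+ 2)
             <= Cstab%:E)%E].
Proof.
move=> [[_ oOm _ bOm] [_ finite_corners]] T0 nu0 lam0 gam0 eps0 gL2 _.
have [corners cornersE] := (finite_seqP _).1 finite_corners.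
have cornersP x : boundary Om x -> x \notin corners -> exists n, outward_normal Om x n.
  move=> bx; apply: contraNP => nn; have : [set` corners] x by rewrite -cornersE.
  by [].
pose C := stability_constant Om T lam eps g u0 phi0.
have C0 : 0 <= C.
  apply: mulr_ge0; first exact: expR_ge0.
  by apply: addr_ge0; [exact: total_energy_ge0|exact: load_energy_ge0].
have C1 : (C%:E <= (1 + C)%:E)%E by rewrite lee_fin lerDr.
(* C may vanish, the constant has to be positive. *)
exists (1 + C); first by rewrite ltr_wpDr.
move=> u phi p sol; have [reg eqs bcs ini] := sol; split.
- apply: aeW => t tT.
  have E (f : R * R -> R) : ip Om f (cst 1) = \int[area]_(x in Om) f x.
    by apply: eq_int => x _; rewrite mulr1.
  rewrite !E (mass_conservation oOm bOm cornersP reg eqs bcs tT).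
  by apply: eq_int => x Ox; have [_ ->] := ini x Ox.
- apply/ess_supP; apply: ae_time_measure => t tT; apply: le_trans C1.
  exact: (energy_bound oOm bOm cornersP T0 nu0 lam0 gam0 eps0 gL2 sol tT).
- apply: le_trans C1.
  exact: (dissipation_bound oOm bOm cornersP T0 nu0 lam0 gam0 eps0 gL2 sol).
Qed.
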